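(* Let $\mathfrak g$ be a basic classical Lie superalgebra of type I, i.e. $\mathfrak g=\mathfrak{sl}(m|n)$ with $m\neq n$, or $\mathfrak g=\mathfrak{osp}(2|2n)$, and let $\Lambda=(\lambda|\mu)\in\mathfrak h^*$. Then $$\operatorname{GKdim}\widetilde L(\lambda|\mu)=\operatorname{GKdim}L(\lambda)+\operatorname{GKdim}L(\mu).$$
   Context: Everything is over $\mathbb C$; $m,n\ge 1$. $\mathfrak g=\mathfrak g_0\oplus\mathfrak g_1$ is the decomposition into even and odd parts and $\mathfrak h\subset\mathfrak g_0$ is the standard Cartan subalgebra. Weights are written $\Lambda=(\lambda_1,\dots,\lambda_m|\mu_1,\dots,\mu_n)=\sum_i\lambda_i\epsilon_i+\sum_j\mu_j\delta_j$, abbreviated $(\lambda|\mu)$ (with $m=1$ when $\mathfrak g=\mathfrak{osp}(2|2n)$). Positive roots: for $\mathfrak{sl}(m|n)$, even ones $\Delta_0^+=\{\epsilon_i-\epsilon_j\,(i<j\le m),\ \delta_k-\delta_l\,(k<l\le n)\}$ and odd ones $\Delta_1^+=\{\epsilon_i-\delta_k\}$; for $\mathfrak{osp}(2|2n)$, $\Delta_0^+=\{\delta_k\pm\delta_l\,(k<l),\ 2\delta_k\}$ and $\Delta_1^+=\{\epsilon_1\pm\delta_k\}$. The standard Borel subalgebra is $\mathfrak b=\mathfrak h\oplus\mathfrak n^+$, $\mathfrak n^+$ being the sum of the positive root spaces. $\widetilde L(\lambda|\mu)$ is the simple highest weight $\mathfrak g$-module with highest weight $(\lambda|\mu)$ with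 respect to $\mathfrak b$ (the graded-simple quotient of the Verma module). For $\mathfrak{sl}(m|n)$ one has $\mathfrak g_0=\mathfrak{sl}(m)\oplus\mathfrak{sl}(n)\oplus\mathbb C$, and $L(\lambda)$ (resp. $L(\mu)$) is the simple highest weight module of $\mathfrak{sl}(m)$ (resp. $\mathfrak{sl}(n)$) with highest weight $\lambda$ (resp. $\mu$). For $\mathfrak{osp}(2|2n)$ one has $\mathfrak g_0=\mathfrak{so}(2)\oplus\mathfrak{sp}(2n)$, and $L(\lambda)$ (resp. $L(\mu)$) is the simple highest weight module of $\mathfrak{so}(2)$ (resp. $\mathfrak{sp}(2n)$) with highest weight $\lambda$ (resp. $\mu$). $\operatorname{GKdim}$ of a finitely generated module $M$ over $U=U(\mathfrak g)$ (or the enveloping algebra of a Lie algebra) is $\limsup_{k\to\infty}\log\dim(U_kM')/\log k$, where $M'$ is a finite-dimensional generating subspace and $U_k$ is the standard filtration. *)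

(* Defs.v *)
From mathcomp Require Import all_boot all_order all_algebra.
From mathcomp Require Import complex.
From mathcomp Require Import all_classical all_reals all_analysis.

Set Implicit Arguments.
Unset Strict Implicit.
Unset Printing Implicit Defensive.

Import Order.TTheory GRing.Theory Num.Theory.

Local Open Scope classical_set_scope.
Local Open Scope ring_scope.
Local Open Scope complex_scope.

(* The real field R is only used as the source of the ground field C = R[i]
   and of logarithms.  Every Lie (super)algebra below is a concrete set of
   square matrices over R[i]; the parity of an element is a boolean, with
   [false] for even and [true] for odd. *)

Section LinearAlgebra.
Variables (R : realType) (V : lmodType R[i]).
Implicit Types W M : set V.

Definition subspace W : Prop :=
  W 0 /\ forall (a : R[i]) u v, W u -> W v -> W (a *: u + v).

Definition span (A : set V) : set V := smallest subspace A.

Definition is_basis (d : nat) (b : 'I_d -> V) W : Prop :=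
  (forall c : 'I_d -> R[i],
     \sum_(i < d) c i *: b i = 0 -> forall i, c i = 0) /\
  span (range b) = W.

Definition findim W : Prop := exists d (b : 'I_d -> V), is_basis b W.

(* Only meaningful for [findim] sets. *)
Definition dim W : nat :=
  get [set d : nat | exists b : 'I_d -> V, is_basis b W].

End LinearAlgebra.

Section Actions.
Variables (R : realType) (N : nat) (g : set 'M[R[i]]_N).
Variables (V : lmodType R[i]) (act : 'M[R[i]]_N -> {linear V -> V}).
Implicit Types W M : set V.

Definition submodule W : Prop :=
  subspace W /\ forall x w, g x -> W w -> W (act x w).

Definition generates M : Prop :=
  forall W, submodule W -> M `<=` W -> W = setT.

(* U_k M, where U_k is the span in the enveloping algebra of g of all products
   of at most k elements of g. *)
Fixpoint Ufilt (k : nat) M : set V :=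
  if k is k'.+1 then
    span (Ufilt k' M `|` [set act x w | x in g & w in Ufilt k' M])
  else span M.

Definition generating_subspace M : Prop := findim M /\ generates M.

(* The Gelfand-Kirillov dimension, computed from the generating subspace M. *)
Definition GKdim M : \bar R :=
  limn_esup (fun k : nat => (ln (dim (Ufilt k M))%:R / ln k%:R)%:E).

End Actions.

Section Roots.
Variables (R : realType) (N : nat).
Implicit Types (g : set 'M[R[i]]_N) (Phi : set ('M[R[i]]_N -> R[i])).

(* Elements of h^* are given by functions on all matrices, of which only the
   values on the Cartan subalgebra matter; different functions may thus give
   the same weight. *)
Definition diag_coord (i : 'I_N) : 'M[R[i]]_N -> R[i] := fun t => t i i.

Definition cartan g : set 'M[R[i]]_N := [set t | g t /\ is_diag_mx t].

(* t is even, so the superbracket [t, x] is the commutator also for odd x. *)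
Definition root_space g (h : set 'M[R[i]]_N) (alpha : 'M[R[i]]_N -> R[i]) :
    set 'M[R[i]]_N :=
  [set x | g x /\ forall t, h t -> t *m x - x *m t = alpha t *: x].

Definition nilradical g Phi : set 'M[R[i]]_N :=
  span (\bigcup_(alpha in Phi) root_space g (cartan g) alpha).

Definition super_nilradical (g : bool -> set 'M[R[i]]_N)
    (Phi : bool -> set ('M[R[i]]_N -> R[i])) : set 'M[R[i]]_N :=
  span (\bigcup_(a in [set: bool]) \bigcup_(alpha in Phi a)
          root_space (g a) (cartan (g false)) alpha).

End Roots.

Section Modules.
Variables (R : realType) (N : nat).

(* The values of the action outside g are irrelevant. *)
Record lieModule (g : set 'M[R[i]]_N) := LieModule {
  lm_sort :> lmodType R[i];
  lm_act : 'M[R[i]]_N -> {linear lm_sort -> lm_sort};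
  lm_actD : forall (c : R[i]) x y v, g x -> g y ->
    lm_act (c *: x + y) v = c *: lm_act x v + lm_act y v;
  lm_act_bracket : forall x y v, g x -> g y ->
    lm_act (x *m y - y *m x) v
      = lm_act x (lm_act y v) - lm_act y (lm_act x v)
}.

Definition total_alg (g : bool -> set 'M[R[i]]_N) : set 'M[R[i]]_N :=
  [set x + y | x in g false & y in g true].

Record superModule (g : bool -> set 'M[R[i]]_N) := SuperModule {
  sm_sort :> lmodType R[i];
  sm_part : bool -> set sm_sort;
  sm_act : 'M[R[i]]_N -> {linear sm_sort -> sm_sort};
  sm_part_subspace : forall a, subspace (sm_part a);
  sm_part_sum : forall v, exists v0 v1,
    [/\ sm_part false v0, sm_part true v1 & v = v0 + v1];
  sm_part_direct : forall v, sm_part false v -> sm_part true v -> v = 0;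
  sm_actD : forall (c : R[i]) x y v, total_alg g x -> total_alg g y ->
    sm_act (c *: x + y) v = c *: sm_act x v + sm_act y v;
  sm_act_part : forall a b x v, g a x -> sm_part b v ->
    sm_part (a (+) b) (sm_act x v);
  sm_act_bracket : forall a b x y v, g a x -> g b y ->
    sm_act (x *m y - (-1) ^+ (a && b) *: (y *m x)) v
      = sm_act x (sm_act y v) - (-1) ^+ (a && b) *: sm_act y (sm_act x v)
}.

Definition simple_module (g : set 'M[R[i]]_N) (L : lieModule g) : Prop :=
  (exists v : L, v != 0) /\
  forall W : set L, submodule g (lm_act L) W -> W = [set 0] \/ W = setT.

Definition graded_submodule (g : bool -> set 'M[R[i]]_N) (L : superModule g)
    (W : set L) : Prop :=
  submodule (total_alg g) (sm_act L) W /\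
  forall w, W w -> exists w0 w1,
    [/\ W w0 /\ sm_part false w0, W w1 /\ sm_part true w1 & w = w0 + w1].

Definition graded_simple (g : bool -> set 'M[R[i]]_N) (L : superModule g) :
    Prop :=
  (exists v : L, v != 0) /\
  forall W : set L, graded_submodule W -> W = [set 0] \/ W = setT.

Definition highest_weight_vector (h n : set 'M[R[i]]_N)
    (Lambda : 'M[R[i]]_N -> R[i]) (V : lmodType R[i])
    (act : 'M[R[i]]_N -> {linear V -> V}) (v : V) : Prop :=
  [/\ v != 0,
      forall t, h t -> act t v = Lambda t *: v &
      forall x, n x -> act x v = 0].

(* L is the simple highest weight g-module of highest weight Lambda (unique up
   to isomorphism) for the positive system Phi. *)
Definition simple_highest_weight (g : set 'M[R[i]]_N)
    (Phi : set ('M[R[i]]_N -> R[i])) (Lambda : 'M[R[i]]_N -> R[i])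
    (L : lieModule g) : Prop :=
  simple_module L /\
  exists v : L,
    highest_weight_vector (cartan g) (nilradical g Phi) Lambda (lm_act L) v /\
    generates g (lm_act L) [set v].

(* Unique up to isomorphism and parity change. *)
Definition super_simple_highest_weight (g : bool -> set 'M[R[i]]_N)
    (Phi : bool -> set ('M[R[i]]_N -> R[i])) (Lambda : 'M[R[i]]_N -> R[i])
    (L : superModule g) : Prop :=
  graded_simple L /\
  exists v : L,
    [/\ exists a, sm_part a v,
        highest_weight_vector (cartan (g false)) (super_nilradical g Phi)
          Lambda (sm_act L) v &
        generates (total_alg g) (sm_act L) [set v]].

End Modules.

Section GeneralLinear.
Variables (R : realType) (p q : nat).

Definition parity (i : 'I_(p + q)) : bool := (p <= i)%N.

Definition gl_super (a : bool) : set 'M[R[i]]_(p + q) :=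
  [set x | forall i j, parity i (+) parity j != a -> x i j = 0].

Definition supertrace (x : 'M[R[i]]_(p + q)) : R[i] :=
  \sum_i (-1) ^+ parity i * x i i.

(* Homogeneous x of parity a with
   B(x u, w) + (-1)^(a |u|) B(u, x w) = 0 for the form B(u, w) = u^T B w,
   written on the basis vectors u = e_i and w = e_j. *)
Definition osp_form (B : 'M[R[i]]_(p + q)) (a : bool) :
    set 'M[R[i]]_(p + q) :=
  [set x | gl_super a x /\
     forall i j, (x^T *m B) i j + (-1) ^+ (a && parity i) * (B *m x) i j = 0].

End GeneralLinear.

Section SpecialLinear.
Variable R : realType.

Definition sl (m : nat) : set 'M[R[i]]_m := [set x | \tr x = 0].

Definition sl_roots (m : nat) : set ('M[R[i]]_m -> R[i]) :=
  [set alpha | exists i j : 'I_m,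
     (i < j)%N /\ alpha = diag_coord i \- diag_coord j].

Definition sl_weight (m : nat) (lambda : 'I_m -> R[i]) :
    'M[R[i]]_m -> R[i] :=
  fun t => \sum_(i < m) lambda i * diag_coord i t.

Variables m n : nat.

Definition sl_super (a : bool) : set 'M[R[i]]_(m + n) :=
  [set x | gl_super a x /\ supertrace x = 0].

Definition sl_eps (i : 'I_m) : 'M[R[i]]_(m + n) -> R[i] :=
  diag_coord (lshift n i).
Definition sl_delta (k : 'I_n) : 'M[R[i]]_(m + n) -> R[i] :=
  diag_coord (rshift m k).

Definition sl_super_roots (a : bool) : set ('M[R[i]]_(m + n) -> R[i]) :=
  if a then
    [set alpha | exists i k, alpha = sl_eps i \- sl_delta k]
  else
    [set alpha | exists i j : 'I_m,
       (i < j)%N /\ alpha = sl_eps i \- sl_eps j] `|`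
    [set alpha | exists k l : 'I_n,
       (k < l)%N /\ alpha = sl_delta k \- sl_delta l].

Definition sl_super_weight (lambda : 'I_m -> R[i]) (mu : 'I_n -> R[i]) :
    'M[R[i]]_(m + n) -> R[i] :=
  fun t => \sum_(i < m) lambda i * sl_eps i t
         + \sum_(k < n) mu k * sl_delta k t.

End SpecialLinear.

Section Orthosymplectic.
Variable R : realType.

Definition form_alg (N : nat) (B : 'M[R[i]]_N) : set 'M[R[i]]_N :=
  [set x | x^T *m B + B *m x = 0].

(* The split symmetric form on C^2: so(2) consists of the diag(a, -a). *)
Definition so2_form : 'M[R[i]]_2 := \matrix_(i, j) (i != j)%:R.

Definition so2 : set 'M[R[i]]_2 := form_alg so2_form.

Definition so2_weight (lambda : R[i]) : 'M[R[i]]_2 -> R[i] :=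
  fun t => lambda * diag_coord ord0 t.

Variable n : nat.

Definition sp_form : 'M[R[i]]_(n + n) := block_mx 0 1%:M (- 1%:M) 0.

Definition sp : set 'M[R[i]]_(n + n) := form_alg sp_form.

(* The Cartan subalgebra consists of the diag(t_1..t_n, -t_1..-t_n). *)
Definition sp_delta (k : 'I_n) : 'M[R[i]]_(n + n) -> R[i] :=
  diag_coord (lshift n k).

Definition sp_roots : set ('M[R[i]]_(n + n) -> R[i]) :=
  [set alpha | exists k l : 'I_n, (k < l)%N /\
     (alpha = sp_delta k \- sp_delta l \/ alpha = sp_delta k \+ sp_delta l)] `|`
  [set alpha | exists k, alpha = sp_delta k \+ sp_delta k].

Definition sp_weight (mu : 'I_n -> R[i]) : 'M[R[i]]_(n + n) -> R[i] :=
  fun t => \sum_(k < n) mu k * sp_delta k t.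

Definition osp (a : bool) : set 'M[R[i]]_(2 + (n + n)) :=
  osp_form (block_mx so2_form 0 0 sp_form) a.

(* The Cartan subalgebra consists of the
   diag(s, -s, t_1..t_n, -t_1..-t_n). *)
Definition osp_eps : 'M[R[i]]_(2 + (n + n)) -> R[i] :=
  diag_coord (lshift (n + n) (ord0 : 'I_2)).
Definition osp_delta (k : 'I_n) : 'M[R[i]]_(2 + (n + n)) -> R[i] :=
  diag_coord (rshift 2 (lshift n k)).

Definition osp_roots (a : bool) : set ('M[R[i]]_(2 + (n + n)) -> R[i]) :=
  if a then
    [set alpha | exists k,
       alpha = osp_eps \- osp_delta k \/ alpha = osp_eps \+ osp_delta k]
  else
    [set alpha | exists k l : 'I_n, (k < l)%N /\
       (alpha = osp_delta k \- osp_delta l \/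
        alpha = osp_delta k \+ osp_delta l)] `|`
    [set alpha | exists k, alpha = osp_delta k \+ osp_delta k].

Definition osp_weight (lambda : R[i]) (mu : 'I_n -> R[i]) :
    'M[R[i]]_(2 + (n + n)) -> R[i] :=
  fun t => lambda * osp_eps t + \sum_(k < n) mu k * osp_delta k t.

End Orthosymplectic.

Arguments sl : clear implicits.
Arguments sl_roots : clear implicits.
Arguments sl_super : clear implicits.
Arguments sl_super_roots : clear implicits.
Arguments so2 : clear implicits.
Arguments sp : clear implicits.
Arguments sp_roots : clear implicits.
Arguments osp : clear implicits.
Arguments osp_roots : clear implicits.

(* Main.v *)
From HB Require Import structures.
From Pilot Require Import Defs.
From mathcomp Require Import all_boot all_order all_algebra.
From mathcomp Require Import complex.
From mathcomp Require Import all_classical all_reals all_analysis.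
From mathcomp Require Import -(notations) mpoly.
From mathcomp Require Import zify ring.
Import Pilot.Defs.

(** The proof compares filtrations by dimension.

    Both superalgebras have a central element [z] of the even part [g_0] such
    that [ad z] has eigenvalues [1] and [-1] on the odd part; for [sl(m|n)] this
    is where [m <> n] enters.  Let [L] be the simple highest weight module, with
    highest weight vector [v], and let [T = U(g_0) v].  The odd positive part
    kills [v], hence [T], and so [L] is generated from [T] by the exterior
    algebra of the odd negative part, which is finite dimensional: passing from
    the filtration of [T] to that of [L] costs a bounded factor
    ([odd_cyc_act], [dim_odd_cyc]).  As [z] separates [T] from the images of the
    odd negative part, simplicity of [L] makes [T] nondegenerate over [g_0]:
    a vector of [T] none of whose translates has a component along [v] is zero.

    Up to the line of [z], the algebra [g_0] is the sum of two commuting ideals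
    [s1] and [s2], and the next step replaces [T] by the product of the two
    simple modules [L1] and [L2].  In a module generated by a highest weight
    vector, the component of [u v] along [v], for a product [u] of elements of
    the algebra, depends on [u] and on the highest weight only
    ([universal_coef]).  In [T] this component is multiplicative for a product
    of a word in [s1] and a word in [s2], and in all three modules it detects
    zero.  The Gram matrix of the words of length at most [k] in both factors is
    therefore a Kronecker product, and the subspace of [T] that they span has
    dimension [d1 k * d2 k], where [d1 k] and [d2 k] are the dimensions of the
    steps of the filtrations of [L1] and [L2].

    Consequently [dim (U_k v)] and [d1 k * d2 k] bound each other up to constants
    and rescaling of [k] ([GKdim_typeI]).  An upper limit of a sum is the sum of
    the upper limits as soon as one of the sequences converges ([growth_mul]).
    That [ln (d1 k) / ln k] converges is a weak form of the theorem on Hilbert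
    polynomials ([cyclic_growth]): order the monomials in a basis of [s1] by
    degree and then lexicographically; the monomials that are not combinations
    of smaller ones modulo the annihilator of the vector count the dimension,
    and their exponents form a downward closed set.  The number of elements of
    degree at most [k] in such a set lies between constant multiples of [k ^ d],
    where [d] is the largest dimension of a coordinate subspace contained in it
    ([downset_growth]). *)

Set Implicit Arguments.
Unset Strict Implicit.
Unset Printing Implicit Defensive.

Import Order.TTheory GRing.Theory Num.Theory.

Local Open Scope classical_set_scope.
Local Open Scope ring_scope.
Local Open Scope complex_scope.

(** * Subspaces and their dimensions *)

Section Subspaces.
Variables (R : realType) (V : lmodType R[i]).
Implicit Types (W A B : set V).

Lemma subspace0 W : subspace W -> W 0. Proof. by case. Qed.

Lemma subspaceD W u v : subspace W -> W u -> W v -> W (u + v).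
Proof. by move=> [_ sW] Wu Wv; rewrite -[u]scale1r; apply: sW. Qed.

Lemma subspaceZ W (a : R[i]) u : subspace W -> W u -> W (a *: u).
Proof. by move=> [W0 sW] Wu; rewrite -[_ *: _]addr0; apply: sW. Qed.

Lemma subspaceN W u : subspace W -> W u -> W (- u).
Proof. by move=> sW Wu; rewrite -scaleN1r; apply: subspaceZ. Qed.

Lemma subspaceB W u v : subspace W -> W u -> W v -> W (u - v).
Proof. by move=> sW Wu Wv; apply: subspaceD => //; apply: subspaceN. Qed.

Lemma subspace_sum W (I : Type) (r : seq I) (P : pred I) (F : I -> V) :
  subspace W -> (forall i, P i -> W (F i)) -> W (\sum_(i <- r | P i) F i).
Proof.
move=> sW WF; apply: (big_ind W) => //; first exact: subspace0.
by move=> x y; apply: subspaceD.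
Qed.

Lemma subspace_span A : subspace (span A).
Proof.
split=> [B [[]] //|a u v Au Av B [sB AB]].
by apply: sB.2; [apply: Au|apply: Av].
Qed.

Lemma sub_span A : A `<=` span A.
Proof. by move=> x Ax B [_]; apply. Qed.

Lemma span_min A W : subspace W -> A `<=` W -> span A `<=` W.
Proof. by move=> sW AW x; apply. Qed.

Lemma span_mono A B : A `<=` B -> span A `<=` span B.
Proof.
move=> AB; apply: span_min; first exact: subspace_span.
by apply: subset_trans AB _; apply: sub_span.
Qed.

Lemma span_id W : subspace W -> span W = W.
Proof. by move=> sW; apply/seteqP; split; [apply: span_min|apply: sub_span]. Qed.

Lemma subspace_set0 : subspace [set (0 : V)].
Proof. by split=> // a u v /= -> ->; rewrite scaler0 addr0. Qed.

Lemma subspace_add A B : subspace A -> subspace B ->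
  subspace [set x + y | x in A & y in B].
Proof.
move=> sA sB; split.
  by exists 0; [exact: subspace0|exists 0; rewrite ?addr0 //; apply: subspace0].
move=> a _ _ [x Ax [y By <-]] [x' Ax' [y' By' <-]].
exists (a *: x + x'); first exact: sA.2.
exists (a *: y + y'); first exact: sB.2.
by rewrite scalerDr addrACA.
Qed.

Lemma span_rangeP (I : finType) (b : I -> V) x :
  span (range b) x <-> exists c : I -> R[i], x = \sum_i c i *: b i.
Proof.
split=> [|[c ->]]; last first.
  apply: subspace_sum => [|i _]; first exact: subspace_span.
  apply: (subspaceZ _ (subspace_span _)).
  by apply: sub_span; exists i.
apply: (span_min (W := [set x | exists c : I -> R[i], x = \sum_i c i *: b i])).
  split=> [|a _ _ [c ->] [d ->]] /=.
    by exists (fun=> 0); rewrite big1 // => i _; rewrite scale0r.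
  exists (fun i => a * c i + d i); rewrite scaler_sumr -big_split /=.
  by apply: eq_bigr => i _; rewrite scalerDl scalerA.
move=> _ [i _ <-]; exists (fun j => (j == i)%:R).
rewrite (bigD1 i) //= eqxx scale1r big1 ?addr0 // => j /negPf ->.
by rewrite scale0r.
Qed.

Definition indep (I : finType) (b : I -> V) : Prop :=
  forall c : I -> R[i], \sum_i c i *: b i = 0 -> forall i, c i = 0.

(** The coefficient matrix of the [b i] over the [c j] has a nonzero left
    kernel as soon as it has more rows than columns. *)
Lemma indep_card_le (I J : finType) (b : I -> V) (c : J -> V) :
  indep b -> (forall i, span (range c) (b i)) -> (#|I| <= #|J|)%N.
Proof.
move=> fb bc.
have /boolp.choice [a aE] : forall i, exists a : J -> R[i], b i = \sum_j a j *: c j.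
  by move=> i; apply/span_rangeP.
rewrite leqNgt; apply/negP => ltJI.
pose A := \matrix_(i < #|I|, j < #|J|) a (enum_val i) (enum_val j).
have : ~~ row_free A.
  by rewrite /row_free neq_ltn (leq_ltn_trans (rank_leq_col A)).
rewrite -kermx_eq0 => /rowV0Pn [u /sub_kermxP uA /eqP]; apply.
apply/rowP => k; rewrite mxE -(enum_valK k).
apply: (fb (fun i => u 0 (enum_rank i))).
under eq_bigr => i _ do rewrite aE scaler_sumr.
rewrite exchange_big /= big1 // => j _.
under eq_bigr => i _ do rewrite scalerA.
rewrite -scaler_suml.
suff -> : \sum_i u 0 (enum_rank i) * a i j = 0 by rewrite scale0r.
have := congr1 (fun M : 'rV_#|J| => M 0 (enum_rank j)) uA.
rewrite !mxE => uA0; rewrite -[RHS]uA0.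
rewrite (reindex (@enum_val I predT)) /=; last by apply: onW_bij; apply: enum_val_bij.
by apply: eq_bigr => i _; rewrite !mxE enum_valK enum_rankK.
Qed.

Lemma indep_reindex (I J : finType) (f : J -> I) (b : I -> V) :
  bijective f -> indep b -> indep (b \o f).
Proof.
move=> bf fb c c0 j; have [g fK gK] := bf.
rewrite -(fK j); apply: (fb (c \o g)).
rewrite (reindex f) /=; last exact: onW_bij.
by under eq_bigr => i _ do rewrite fK.
Qed.

Lemma range_reindex (I J : Type) (f : J -> I) (b : I -> V) :
  bijective f -> range (b \o f) = range b.
Proof.
move=> [g fK gK]; apply/seteqP; split=> _ [x _ <-]; first by exists (f x).
by exists (g x) => //=; rewrite gK.
Qed.

Lemma dim_basis (I : finType) (b : I -> V) W :
  indep b -> span (range b) = W -> dim W = #|I|.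
Proof.
move=> fb bW; rewrite /dim.
have /(xgetPex point) : exists d, exists b0 : 'I_d -> V, is_basis b0 W.
  exists #|I|, (b \o enum_val); split; last by rewrite range_reindex //; apply: enum_val_bij.
  by apply: indep_reindex => //; apply: enum_val_bij.
set d := xget _ _ => -[c [fc cW]]; apply/eqP; rewrite eqn_leq.
rewrite -[d]card_ord (indep_card_le (b := c) (c := b)) //=; last first.
  by move=> i; rewrite bW -cW; apply: sub_span; exists i.
rewrite (indep_card_le (b := b) (c := c)) //= => i.
by rewrite cW -bW; apply: sub_span; exists i.
Qed.

Lemma findimP W : findim W ->
  exists (b : 'I_(dim W) -> V), indep b /\ span (range b) = W.
Proof.
move=> [d [b [fb bW]]]; have := dim_basis fb bW; rewrite card_ord => dW.
by move: fb bW; rewrite -dW in b *; exists b.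
Qed.

(** A longest independent family taken from [A] spans [A]. *)
Lemma basis_from A (J : finType) (c : J -> V) :
  A `<=` span (range c) ->
  exists d (b : 'I_d -> V), [/\ forall i, A (b i), indep b &
    span (range b) = span A].
Proof.
move=> Ac.
pose P d := `[< exists b : 'I_d -> V, (forall i, A (b i)) /\ indep b >].
have P0 : exists d, P d.
  by exists 0%N; apply/asboolP; exists (fun=> 0); split=> [[]|? _ []] //.
have Pub d : P d -> (d <= #|J|)%N.
  move=> /asboolP [b [Ab fb]]; rewrite -[d]card_ord.
  by apply: indep_card_le fb _ => i; apply: Ac.
case: (ex_maxnP P0 Pub) => d /asboolP [b [Ab fb]] dmax.
exists d, b; split=> //; apply/seteqP; split.
  by apply: span_mono => _ [i _ <-].
apply: span_min; first exact: subspace_span.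
move=> x Ax; apply: contrapT => bx.
suff /dmax : P d.+1 by rewrite ltnn.
apply/asboolP; exists (fun i => if unlift ord_max i is Some j then b j else x).
split=> [i|e]; first by case: unliftP.
rewrite big_ord_recr /= unlift_none => e0.
have lE (i : 'I_d) : widen_ord (leqnSn d) i = lift ord_max i.
  by apply: val_inj; rewrite /= /bump leqNgt ltn_ord.
have e_max : e ord_max = 0.
  apply/eqP; apply: contra_notT bx => emax0.
  apply/span_rangeP; exists (fun i => - (e ord_max)^-1 * e (lift ord_max i)).
  apply: (scalerI emax0).
  move/eqP: e0; rewrite addr_eq0 => /eqP e0.
  rewrite -[LHS]opprK -e0 scaler_sumr -sumrN; apply: eq_bigr => i _.
  by rewrite lE liftK scalerA mulrA mulrN divff // mulN1r scaleNr.
move: e0; rewrite e_max scale0r addr0 => e0 i.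
case: (unliftP ord_max i) => [j ->|-> //].
apply: (fb (e \o lift ord_max)); rewrite -[RHS]e0.
by apply: eq_bigr => k _; rewrite lE liftK.
Qed.

Lemma findim_span_fin (J : finType) (c : J -> V) : findim (span (range c)).
Proof.
have [d [b [_ fb bE]]] := basis_from (@sub_span (range c)).
by exists d, b.
Qed.

Lemma findim_sub W W' : subspace W -> W `<=` W' -> findim W' -> findim W.
Proof.
move=> sW WW' /findimP [b [_ bW']].
have [|d [c [_ fc cW]]] := @basis_from W _ b; first by rewrite bW'.
by exists d, c; split=> //; rewrite cW span_id.
Qed.

Lemma dim_le W W' : subspace W -> W `<=` W' -> findim W' -> (dim W <= dim W')%N.
Proof.
move=> sW WW' fW'; have [b [fb bW]] := findimP (findim_sub sW WW' fW').
have [c [_ cW']] := findimP fW'.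
rewrite -[X in (X <= _)%N]card_ord -[X in (_ <= X)%N]card_ord.
apply: (indep_card_le (c := c) fb) => i.
by rewrite cW'; apply: WW'; rewrite -[X in X _]bW; apply: sub_span; exists i.
Qed.

Lemma dim_le_card (J : finType) (c : J -> V) W :
  subspace W -> W `<=` span (range c) -> (dim W <= #|J|)%N.
Proof.
move=> sW Wc; have [b [fb bW]] := findimP (findim_sub sW Wc (findim_span_fin c)).
rewrite -[X in (X <= _)%N]card_ord; apply: (indep_card_le (c := c) fb) => i.
by apply: Wc; rewrite -[X in X _]bW; apply: sub_span; exists i.
Qed.

Lemma dim_ge_card (J : finType) (c : J -> V) W :
  findim W -> indep c -> (forall j, W (c j)) -> (#|J| <= dim W)%N.
Proof.
move=> /findimP [b [_ bW]] fc cW; rewrite -[X in (_ <= X)%N]card_ord.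
by apply: (indep_card_le (c := b) fc) => j; rewrite bW.
Qed.

Lemma dim_gt0 W v : findim W -> W v -> v != 0 -> (0 < dim W)%N.
Proof.
move=> fW Wv v0; rewrite -[X in (X < _)%N]/(0)%N -(@card_ord 1).
apply: (@dim_ge_card 'I_1 (fun=> v)) => // c; rewrite big_ord1 => /eqP.
by rewrite scaler_eq0 (negPf v0) orbF => /eqP c0 i; rewrite ord1.
Qed.

End Subspaces.

Lemma subspace_preim (R : realType) (V V' : lmodType R[i])
    (f : {linear V -> V'}) (W : set V') :
  subspace W -> subspace (f @^-1` W).
Proof.
move=> sW; split=> /=; first by rewrite linear0; exact: subspace0 sW.
by move=> a u v Wu Wv /=; rewrite linearP; apply: sW.2.
Qed.

(** * Growth exponents of sequences of dimensions *)

Section Growth.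
Variable R : realType.
Implicit Types (f g : nat -> nat) (l e c : R).

Definition growth f : \bar R :=
  limn_esup (fun k => (ln (f k)%:R / ln k%:R)%:E).

Lemma limn_esup_leP (u : nat -> \bar R) l :
  (limn_esup u <= l%:E)%E <->
  forall e, 0 < e -> exists n0, forall n, (n0 <= n)%N -> (u n <= (l + e)%:E)%E.
Proof.
split=> [ul e e0|ul].
  have : (limn_esup u < (l + e)%:E)%E.
    by apply: le_lt_trans ul _; rewrite lte_fin ltrDl.
  move=> /ereal_inf_lt [_ [A [n0 _ An0] <-]] Ale; exists n0 => n n0n.
  apply: le_trans (ltW Ale); apply: ereal_sup_ubound; exists n => //.
  exact: An0.
apply/lee_addgt0Pr => e e0; have [n0 un] := ul _ e0.
rewrite -EFinD; apply: le_trans (ereal_inf_lbound _) _.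
  by exists [set n | (n0 <= n)%N] => //; exists n0.
by apply: ge_ereal_sup => _ [n n0n <-]; apply: un.
Qed.

Lemma ln_nat_ge0 n : 0 <= ln (n%:R : R).
Proof. by case: n => [|n]; [rewrite ln0|apply: ln_ge0; rewrite ler1n]. Qed.

Lemma growth_ge0 f : (0 <= growth f)%E.
Proof.
apply: limf_esup_ge0 => [|k]; last by rewrite lee_fin divr_ge0 ?ln_nat_ge0.
by move=> [n0 _ /(_ n0)]; apply => /=.
Qed.

(** In this multiplicative form, constant factors and linear rescalings of the
    argument only change [c]. *)
Lemma growth_leP f l : (forall k, 0 < f k)%N ->
  (growth f <= l%:E)%E <->
  forall e, 0 < e -> exists c n0, 0 < c /\
    forall k, (n0 <= k)%N -> (f k)%:R <= c * k%:R `^ (l + e).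
Proof.
move=> f0; split=> [/limn_esup_leP fl e /fl [n0 fn]|fl].
  exists 1, (maxn n0 2); split=> // k; rewrite geq_max mul1r => /andP[/fn + k2].
  have lnk : 0 < ln (k%:R : R) by rewrite ln_gt0 // ltr1n.
  have k0 : 0 < (k%:R : R) by rewrite ltr0n; lia.
  rewrite lee_fin ler_pdivrMr // -ln_powR ler_ln ?posrE ?ltr0n //.
  exact: powR_gt0.
apply/limn_esup_leP => e e0.
have e2 : 0 < e / 2 by rewrite divr_gt0.
have [c [n0 [c0 fn]]] := fl _ e2.
pose n1 := (Num.truncn (c `^ (2 / e))).+1.
exists (maxn (maxn n0 2) n1) => k; rewrite !geq_max => /andP[/andP[/fn fk k2] n1k].
have lnk : 0 < ln (k%:R : R) by rewrite ln_gt0 // ltr1n.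
have k0 : 0 < (k%:R : R) by rewrite ltr0n; lia.
rewrite lee_fin ler_pdivrMr // -ln_powR ler_ln ?posrE ?ltr0n ?powR_gt0 //.
apply: le_trans fk _.
have -> : l + e = e / 2 + (l + e / 2) by field.
rewrite [leRHS]powRD; last by rewrite (gt_eqF k0) implybT.
rewrite ler_wpM2r ?powR_ge0 //.
have /ltW ck : c `^ (2 / e) < k%:R.
  apply: lt_le_trans (truncnS_gt _) _; by rewrite ler_nat.
have -> : c = (c `^ (2 / e)) `^ (e / 2).
  rewrite -powRrM (_ : 2 / e * (e / 2) = 1) ?powRr1 ?ltW //.
  by field; rewrite gt_eqF.
by apply: ge0_ler_powR => //; rewrite ?nnegrE ?powR_ge0 //; apply: ltW.
Qed.

Lemma lee_real (x y : \bar R) :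
  (0 <= y)%E -> (forall l, (y <= l%:E)%E -> (x <= l%:E)%E) -> (x <= y)%E.
Proof. by case: y => [y _|_ _|] //; [apply|rewrite leey]. Qed.

Lemma growth_le f g (a c : nat) :
  (forall k, 0 < f k)%N -> (forall k, 0 < g k)%N -> (0 < a)%N -> (0 < c)%N ->
  (forall k, (0 < k)%N -> f k <= c * g (a * k))%N -> (growth f <= growth g)%E.
Proof.
move=> f0 g0 a0 c0 fg; apply: lee_real => [|l]; first exact: growth_ge0.
move=> /(growth_leP _ g0) gl; apply/(growth_leP _ f0) => e /gl [d [n0 [d0 gn]]].
exists (c%:R * d * a%:R `^ (l + e)), n0.+1; split.
  by rewrite !mulr_gt0 ?powR_gt0 ?ltr0n.
move=> k n0k; apply: (@le_trans _ _ (c * g (a * k)%N)%N%:R).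
  by rewrite ler_nat fg //; lia.
rewrite natrM -!mulrA ler_pM2l ?ltr0n // -powRM // -natrM gn //; nia.
Qed.

(** The exponent of a product is the sum of the exponents because the first
    factor has polynomial growth on both sides; for two arbitrary sequences the
    upper limits would only be subadditive. *)
Lemma growth_mul f g (d c : nat) :
  (forall k, 0 < f k)%N -> (forall k, 0 < g k)%N ->
  (forall k, 0 < k -> k ^ d <= c * f k)%N ->
  (forall k, 0 < k -> f k <= c * k ^ d)%N ->
  growth (fun k => f k * g k)%N = (growth f + growth g)%E.
Proof.
move=> f0 g0 lo hi.
have fg0 k : (0 < f k * g k)%N by rewrite muln_gt0 f0 g0.
have c0 : (0 < c)%N.
  by have := hi 1%N isT; rewrite exp1n muln1; apply: leq_trans.
have cR : 0 < (c%:R : R) by rewrite ltr0n.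
have natX k : ((k ^ d)%N%:R : R) = k%:R `^ d%:R by rewrite powR_mulrn // natrX.
have powDd (k : nat) x : (0 < k)%N -> k%:R `^ (d%:R + x) = k%:R `^ d%:R * k%:R `^ x :> R.
  by move=> k0; rewrite powRD // pnatr_eq0 -lt0n k0 implybT.
have fd : growth f = d%:R%:E.
  apply/eqP; rewrite eq_le; apply/andP; split.
    apply/(growth_leP _ f0) => e e0; exists c%:R, 1%N; split=> // k k1.
    apply: (@le_trans _ _ (c * k ^ d)%N%:R); first by rewrite ler_nat hi.
    rewrite natrM ler_pM2l // natX; apply: ler_powR; last by rewrite lerDl ltW.
    by rewrite ler1n.
  apply: lee_real => [|l]; first exact: growth_ge0.
  move=> fl; rewrite lee_fin leNgt; apply/negP => ld.
  pose e := (d%:R - l) / 2; have e0 : 0 < e by rewrite divr_gt0 // subr_gt0.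
  have [b [n0 [b0 fn]]] := (growth_leP _ f0).1 fl e e0.
  (* [k ^ d <= c * f k <= c * b * k `^ (d - e)] forces [k `^ e <= c * b]. *)
  pose k := (maxn n0 (Num.truncn ((c%:R * b) `^ (e^-1)))).+1.
  have k0 : (0 < k)%N by [].
  have kR : 0 < (k%:R : R) by rewrite ltr0n.
  have : (k%:R `^ d%:R : R) <= c%:R * (b * k%:R `^ (l + e)).
    rewrite -natX; apply: (@le_trans _ _ (c * f k)%N%:R); first by rewrite ler_nat lo.
    by rewrite natrM ler_pM2l // fn // leqW // leq_maxl.
  have -> : d%:R = (l + e) + e by rewrite /e; field.
  rewrite powRD; last by rewrite (gt_eqF kR) implybT.
  rewrite mulrA [leRHS]mulrC ler_pM2l ?powR_gt0 // leNgt => /negP; apply.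
  have -> : c%:R * b = ((c%:R * b) `^ (e^-1)) `^ e.
    by rewrite -powRrM mulVf ?gt_eqF // powRr1 // mulr_ge0 ?ltW.
  apply: gt0_ltr_powR => //; rewrite ?nnegrE ?powR_ge0 ?ler0n //.
  apply: lt_le_trans (truncnS_gt _) _; by rewrite ler_nat ltnS leq_maxr.
apply/eqP; rewrite eq_le; apply/andP; split.
  apply: lee_real => [|l]; first by rewrite adde_ge0 ?growth_ge0.
  rewrite fd addeC -leeBrDr // -EFinB => /(growth_leP _ g0) gl.
  apply/(growth_leP _ fg0) => e /gl [b [n0 [b0 gn]]].
  exists (c%:R * b), n0.+1; split=> [|k n0k]; first exact: mulr_gt0.
  have k0 : (0 < k)%N by lia.
  have -> : l + e = d%:R + (l - d%:R + e) by ring.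
  rewrite natrM powDd // mulrACA; apply: ler_pM => //; last by apply: gn; lia.
  by rewrite -natX -natrM ler_nat hi.
apply: lee_real => [|l]; first exact: growth_ge0.
move=> /(growth_leP _ fg0) fgl; rewrite fd addeC -leeBrDr // -EFinB.
apply/(growth_leP _ g0) => e /fgl [b [n0 [b0 fgn]]].
exists (c%:R * b), n0.+1; split=> [|k n0k]; first exact: mulr_gt0.
have k0 : (0 < k)%N by lia.
have kd : 0 < (k%:R `^ d%:R : R) by rewrite powR_gt0 // ltr0n.
rewrite -(ler_pM2l kd) [leRHS]mulrCA -powDd // addrA [d%:R + _]addrC subrK.
rewrite -natX -natrM; apply: (@le_trans _ _ (c * (f k * g k))%N%:R).
  by rewrite ler_nat mulnA leq_mul2r lo ?orbT.
by rewrite natrM -mulrA ler_pM2l // fgn //; lia.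
Qed.

End Growth.

(** * The standard filtration *)

Section Filtration.
Variables (R : realType) (N : nat) (g : set 'M[R[i]]_N).
Variables (V : lmodType R[i]) (act : 'M[R[i]]_N -> {linear V -> V}).
Implicit Types (M W : set V) (v w : V) (k : nat).

Lemma subspace_Ufilt k M : subspace (Ufilt g act k M).
Proof. by case: k => [|k]; apply: subspace_span. Qed.

Lemma Ufilt_leS k M : Ufilt g act k M `<=` Ufilt g act k.+1 M.
Proof. by move=> w Uw; apply: sub_span; left. Qed.

Lemma Ufilt_le k l M : (k <= l)%N -> Ufilt g act k M `<=` Ufilt g act l M.
Proof.
move=> /subnKC <-; elim: (l - k)%N => [|d IH]; first by rewrite addn0.
by rewrite addnS; apply: subset_trans IH (@Ufilt_leS _ _).
Qed.

Lemma sub_Ufilt k M : M `<=` Ufilt g act k M.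
Proof. by apply: subset_trans (@Ufilt_le 0 k M (leq0n k)); apply: sub_span. Qed.

Lemma Ufilt_act k M x w : g x -> Ufilt g act k M w ->
  Ufilt g act k.+1 M (act x w).
Proof. by move=> gx Uw; apply: sub_span; right; exists x => //; exists w. Qed.

Lemma Ufilt_trans k a M M' : M `<=` Ufilt g act a M' ->
  Ufilt g act k M `<=` Ufilt g act (k + a) M'.
Proof.
move=> MM'; elim: k => [|k IH]; first exact: span_min (subspace_Ufilt _ _) MM'.
apply: span_min; first exact: subspace_Ufilt.
move=> z [/IH Uw|[x gx [w /IH Uw <-]]]; first exact: Ufilt_leS.
exact: Ufilt_act.
Qed.

(** The increasing union of the steps is a submodule containing [M]. *)
Lemma Ufilt_exhaust M w : generates g act M -> exists k, Ufilt g act k M w.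
Proof.
move=> genM; have : [set u | exists k, Ufilt g act k M u] = setT.
  apply: genM => [|u Mu]; last by exists 0%N; apply: sub_span.
  split; last by move=> x u gx [k Uu]; exists k.+1; apply: Ufilt_act.
  split; first by exists 0%N; apply: subspace0 (subspace_Ufilt _ _).
  move=> a u u' [k Uu] [k' Uu']; exists (maxn k k').
  apply: (subspace_Ufilt _ _).2.
    exact: Ufilt_le (leq_maxl _ _) _ Uu.
  exact: Ufilt_le (leq_maxr _ _) _ Uu'.
by move=> E; have : [set: V] w by []; rewrite -E.
Qed.

Definition linear_on : Prop := forall (c : R[i]) x y v, g x -> g y ->
  act (c *: x + y) v = c *: act x v + act y v.

Hypotheses (sg : subspace g) (lin : linear_on).

Lemma act0 v : act 0 v = 0.
Proof.
have g0 := subspace0 sg; have := lin 1 v g0 g0; rewrite !scale1r addr0.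
by move/eqP; rewrite -subr_eq subrr eq_sym => /eqP.
Qed.

Lemma actZ c x v : g x -> act (c *: x) v = c *: act x v.
Proof.
by move=> gx; rewrite -[c *: x]addr0 lin ?act0 ?addr0 //; apply: subspace0 sg.
Qed.

(** Passes from a spanning family of [g] to all of [g]; the inclusion in [g] is
    carried along because the action is linear in the acting element on [g]
    only. *)
Lemma act_span (A : set 'M[R[i]]_N) W v x :
  A `<=` g -> subspace W -> (forall y, A y -> W (act y v)) ->
  span A x -> W (act x v).
Proof.
move=> Ag sW AW Ax; suff : (g `&` [set y | W (act y v)]) x by case.
apply: Ax; split=> [|y Ay]; last by split; [exact: Ag|exact: AW].
split; first by split; [exact: subspace0|rewrite /= act0; apply: subspace0].
move=> a y z [gy Wy] [gz Wz]; split; first exact: sg.2.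
by rewrite /= lin //; apply: sW.2.
Qed.

Lemma finite_span : exists d (x : 'I_d -> 'M[R[i]]_N),
  (forall i, g (x i)) /\ span (range x) = g.
Proof.
have [|d [x [gx _ xg]]] :=
  @basis_from _ _ g _ (fun ij : 'I_N * 'I_N => delta_mx ij.1 ij.2).
  move=> M _; apply/span_rangeP; exists (fun ij => M ij.1 ij.2).
  by rewrite {1}[M]matrix_sum_delta pair_bigA.
by exists d, x; rewrite xg span_id.
Qed.

Lemma findim_Ufilt k M : findim (span M) -> findim (Ufilt g act k M).
Proof.
move=> fM; elim: k => [//|k [d [b [_ bU]]]].
have [e [x [gx xg]]] := finite_span.
apply: (@findim_sub _ _ _ (span (range (fun s : 'I_d + 'I_e * 'I_d =>
   match s with inl i => b i | inr p => act (x p.1) (b p.2) end)))).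
- exact: subspace_span.
- apply: span_min; first exact: subspace_span.
  have inl_sub : Ufilt g act k M `<=` span (range (fun s : 'I_d + 'I_e * 'I_d =>
     match s with inl i => b i | inr p => act (x p.1) (b p.2) end)).
    by rewrite -bU; apply: span_mono => _ [i _ <-]; exists (inl i).
  move=> z [/inl_sub //|[y gy [w Uw <-]]].
  have {}gy : span (range x) y by rewrite xg.
  apply: (act_span (A := range x)) gy => [_ [i _ <-] //||].
    exact: subspace_span.
  move=> _ [i _ <-]; have : Ufilt g act k M w := Uw; rewrite -bU => /span_rangeP [c ->].
  rewrite linear_sum; apply: subspace_sum => [|j _]; first exact: subspace_span.
  rewrite linearZ; apply: (subspaceZ _ (subspace_span _)).
  by apply: sub_span; exists (inr (i, j)).
exact: findim_span_fin.
Qed.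

Lemma findim_set1 v : findim (span [set v]).
Proof.
have -> : [set v] = range (fun _ : 'I_1 => v) :> set V.
  by apply/seteqP; split=> [_ ->|_ [i _ <-]] //; exists ord0.
exact: findim_span_fin.
Qed.

Lemma generates_dim_gt0 M k : (exists v : V, v != 0) -> findim (span M) ->
  generates g act M -> (0 < dim (Ufilt g act k M))%N.
Proof.
move=> [v v0] fM genM; suff [w Mw w0] : exists2 w, M w & w != 0.
  by apply: dim_gt0 w0; [apply: findim_Ufilt|apply: sub_Ufilt].
apply: contrapT => noM.
have : [set (0 : V)] = setT.
  apply: genM => [|w Mw]; last by apply: contrapT => /eqP w0; apply: noM; exists w.
  by split; [exact: subspace_set0|move=> x w _ /= ->; rewrite linear0].
by move=> E; move/eqP: v0; apply; have : [set: V] v by []; rewrite -E.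
Qed.

(** A finite basis of [M] already lies in a single step of the filtration
    generated by [M']. *)
Lemma dim_Ufilt_shift M M' : findim (span M) -> findim (span M') ->
  generates g act M' ->
  exists a, forall k, (dim (Ufilt g act k M) <= dim (Ufilt g act (k + a) M'))%N.
Proof.
move=> fM fM' genM'; have [b [_ bM]] := findimP fM.
have /boolp.choice [a aP] : forall i, exists k, Ufilt g act k M' (b i).
  by move=> i; apply: Ufilt_exhaust.
exists (\max_i a i)%N => k; apply: dim_le; first exact: subspace_Ufilt.
  apply: Ufilt_trans => w Mw; have : span (range b) w by rewrite bM; apply: sub_span.
  move: w {Mw}; apply: span_min; first exact: subspace_Ufilt.
  move=> _ [i _ <-]; exact: Ufilt_le (leq_bigmax i) _ (aP i).
exact: findim_Ufilt.
Qed.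

Lemma growth_Ufilt_le M M' : (exists v : V, v != 0) ->
  findim (span M) -> findim (span M') ->
  generates g act M -> generates g act M' ->
  (growth R (fun k => dim (Ufilt g act k M))
   <= growth R (fun k => dim (Ufilt g act k M')))%E.
Proof.
move=> V0 fM fM' genM genM'; have [a aP] := dim_Ufilt_shift fM fM' genM'.
apply: (@growth_le _ _ _ a.+1 1) => // k; try exact: generates_dim_gt0.
move=> k0; rewrite mul1n; apply: leq_trans (aP k) _.
apply: dim_le; [exact: subspace_Ufilt|apply: Ufilt_le; nia|exact: findim_Ufilt].
Qed.

(** The dimension may be computed from a single generating vector, since two
    generating subspaces have filtrations that differ by bounded shifts. *)
Lemma GKdim_growth M v : v != 0 -> generating_subspace g act M ->
  generates g act [set v] ->
  GKdim g act M = growth R (fun k => dim (Ufilt g act k [set v])).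
Proof.
move=> v0 [fM genM] genv.
have {}fM : findim (span M).
  have [d [b [fb bM]]] := fM; exists d, b; split=> //.
  by rewrite bM [RHS]span_id // -bM; apply: subspace_span.
have V0 : exists v : V, v != 0 by exists v.
have fv := findim_set1 v.
by apply/eqP; rewrite eq_le !growth_Ufilt_le.
Qed.

Definition word k (u : seq 'M[R[i]]_N) : Prop :=
  (size u <= k)%N /\ forall x, x \in u -> g x.

Definition wact (u : seq 'M[R[i]]_N) v : V := foldr (fun x w => act x w) v u.

Lemma wact_cat u u' v : wact (u ++ u') v = wact u (wact u' v).
Proof. by rewrite /wact foldr_cat. Qed.

Lemma wact_is_linear u : linear (wact u).
Proof. by elim: u => [//|x u IH] a v w /=; rewrite IH linearP. Qed.

HB.instance Definition _ u :=
  GRing.isLinear.Build R[i] V V *:%R (wact u) (wact_is_linear u).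

Lemma word_cons k x u : g x -> word k u -> word k.+1 (x :: u).
Proof.
move=> gx [su gu]; split=> // y; rewrite inE => /orP[/eqP -> //|]; exact: gu.
Qed.

Lemma word_le k l u : (k <= l)%N -> word k u -> word l u.
Proof. by move=> kl [su gu]; split=> //; apply: leq_trans kl. Qed.

Lemma word_nil k : word k [::]. Proof. by split. Qed.

Lemma Ufilt_words k v :
  Ufilt g act k [set v] = span [set wact u v | u in word k].
Proof.
apply/seteqP; split.
  elim: k => [|k IH]; first by apply: span_mono => _ ->; exists [::].
  apply: span_min; first exact: subspace_span.
  move=> z [/IH|[x gx [w /IH Uw <-]]].
    by apply: span_mono => _ [u uk <-]; exists u => //; apply: word_le uk.
  apply: (span_min (W := [set w | span [set wact u v | u in word k.+1] (act x w)])) Uw.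
    exact: subspace_preim (subspace_span _).
  move=> _ [u uk <-]; apply: sub_span; exists (x :: u) => //.
  exact: word_cons.
apply: span_min; first exact: subspace_Ufilt.
move=> _ [u [su gu] <-]; apply: (@Ufilt_le (size u)) => //.
elim: u gu {su} => [|x u IH] gu; first exact: sub_span.
apply: (@Ufilt_act (size u)); first by apply: gu; rewrite mem_head.
by apply: IH => y yu; apply: gu; rewrite inE yu orbT.
Qed.

End Filtration.

(** * Polynomial growth of cyclic modules *)

Lemma leq_expl a b e : (a <= b -> a ^ e <= b ^ e)%N.
Proof. by case: e => // e ab; rewrite leq_exp2r. Qed.

Section Downsets.
Variable r : nat.
Implicit Types m : multinom r.

(** The exponent [d] is the largest dimension of a coordinate subspace contained
    in [S].  Any [d.+1] coordinates contain an exponent outside [S]; with [B] a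
    bound for the entries of these finitely many exponents, a member of [S] has
    at most [d] coordinates above [B], so that [S] lies in finitely many
    translates of [d]-dimensional coordinate subspaces. *)
Lemma downset_growth (S : multinom r -> Prop) :
  S mnm0 -> (forall m m', (forall i, m i <= m' i)%N -> S m' -> S m) ->
  exists d c, forall k, (0 < k)%N ->
    (exists (J : finType) (phi : J -> multinom r),
       [/\ injective phi, forall j, S (phi j) /\ (mdeg (phi j) <= k)%N &
           k ^ d <= c * #|J|])%N /\
    (exists (J : finType) (phi : J -> multinom r),
       (forall m, S m -> (mdeg m <= k)%N -> exists j, phi j = m) /\
       (#|J| <= c * k ^ d)%N).
Proof.
move=> S0 Sdown.
pose inS (I : {set 'I_r}) := `[< forall m, (forall i, i \notin I -> m i = 0%N) -> S m >].
have inS0 : inS finset.set0.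
  apply/asboolP => m m0; suff -> : m = mnm0 by [].
  by apply/mnmP => i; rewrite mnm0E m0 // finset.in_set0.
pose D := [arg max_(I > finset.set0 | inS I) #|I|].
have [inSD maxD] : inS D /\ forall I, inS I -> (#|I| <= #|D|)%N.
  by rewrite /D; case: arg_maxnP.
have /boolp.choice [a aP] (I : {set 'I_r}) : exists m, ~~ inS I ->
    (forall i, i \notin I -> m i = 0%N) /\ ~ S m.
  have [|/asboolPn] := boolP (inS I); first by exists mnm0.
  by move=> /existsNP [m /not_implyP [m0 Sm]]; exists m.
pose B := (\max_(I : {set 'I_r}) \max_(i < r) a I i)%N.
pose big m := [set i : 'I_r | (B < m i)%N]%SET.
have card_big m : S m -> (#|big m| <= #|D|)%N.
  move=> Sm; rewrite leqNgt; apply/negP => ltDm.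
  have /aP [a0] : ~~ inS (big m) by apply/negP => /maxD; rewrite leqNgt ltDm.
  apply; apply: Sdown Sm => i.
  have [|/a0 -> //] := boolP (i \in big m); rewrite inE; apply: leq_trans.
  apply: leqW; apply: (@leq_trans (\max_(i < r) a (big m) i)).
    by rewrite (leq_bigmax (F := fun j => a (big m) j)).
  exact: (leq_bigmax (F := fun I => \max_(i < r) a I i)).
exists #|D|, (2 ^ r * B.+1 ^ r * 2 ^ #|D| + r.+1 ^ #|D|)%N => k k0; split.
  pose q := (k %/ r.+1)%N.
  pose phi (e : {ffun {i : 'I_r | i \in D} -> 'I_q.+1}) : multinom r :=
    Multinom [tuple (if insub i is Some j then nat_of_ord (e j) else 0%N) | i < r].
  have phiE e i : phi e i = if insub i is Some j then nat_of_ord (e j) else 0%N.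
    by rewrite /phi multinomE tnth_mktuple.
  exists {ffun {i : 'I_r | i \in D} -> 'I_q.+1}, phi; split.
  - move=> e e' /mnmP ee'; apply/ffunP => j; apply: val_inj.
    by have := ee' (val j); rewrite !phiE valK.
  - move=> e; split.
      by move/asboolP: inSD; apply => i iD; rewrite phiE insubN.
    rewrite mdegE; apply: (@leq_trans (\sum_(i < r) q)).
      by apply: leq_sum => i _; rewrite phiE; case: insub => // j; rewrite -ltnS.
    by rewrite sum_nat_const card_ord /q; have := leq_trunc_div k r.+1; nia.
  rewrite card_ffun card_ord card_sig.
  apply: (@leq_trans (r.+1 ^ #|D| * q.+1 ^ #|D|)); last by rewrite leq_mul2r leq_addl orbT.
  rewrite -expnMn; apply: leq_expl => //.
  by have := ltn_ceil k (ltn0Sn r); rewrite mulnC => /ltnW.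
pose phi (p : {set 'I_r} * {ffun 'I_r -> 'I_B.+1} * #|D|.-tuple 'I_k.+1) : multinom r :=
  Multinom [tuple (if i \in p.1.1 then nat_of_ord (nth ord0 p.2 (index i (enum p.1.1)))
                   else nat_of_ord (p.1.2 i)) | i < r].
exists ({set 'I_r} * {ffun 'I_r -> 'I_B.+1} * #|D|.-tuple 'I_k.+1)%type, phi; split.
  move=> m Sm mk; pose f i : 'I_k.+1 := inord (m i).
  pose s := take #|D| ([seq f i | i <- enum (big m)] ++ nseq #|D| ord0).
  have szs : size s == #|D|.
    by rewrite size_takel // size_cat size_nseq leq_addl.
  exists (big m, [ffun i => inord (m i)], Tuple szs); apply/mnmP => i.
  rewrite /phi multinomE tnth_mktuple /=; case: ifPn => [ibig|].
    have ilt : (index i (enum (big m)) < #|big m|)%N.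
      by rewrite cardE index_mem mem_enum.
    rewrite nth_take; last exact: leq_trans ilt (card_big m Sm).
    rewrite nth_cat size_map -cardE ilt (nth_map i) -?cardE //.
    rewrite nth_index ?mem_enum // inordK // ltnS.
    by apply: leq_trans mk; rewrite mdegE (bigD1 i) //= leq_addr.
  by rewrite inE -leqNgt ffunE => miB; rewrite inordK.
have card_sets : #|{: {set 'I_r}}| = (2 ^ r)%N.
  by rewrite -cardsT -powersetT card_powerset cardsT card_ord.
rewrite !card_prod card_tuple card_ffun !card_ord card_sets.
apply: (@leq_trans (2 ^ r * B.+1 ^ r * 2 ^ #|D| * k ^ #|D|)); last by rewrite leq_mul2r leq_addr orbT.
rewrite -[leqRHS]mulnA leq_mul2l; apply/orP; right.
by rewrite -expnMn; apply: leq_expl => //; lia.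
Qed.

End Downsets.

Definition comm (R : realType) N (x y : 'M[R[i]]_N) := x *m y - y *m x.

(** A representation of the Lie algebra [g] of matrices by bare linear maps,
    so that restrictions along embeddings can share the carrier of a given
    module. *)
Record lie_rep (R : realType) N (g : set 'M[R[i]]_N) (V : lmodType R[i])
    (act : 'M[R[i]]_N -> {linear V -> V}) : Prop := LieRep {
  rep_subspace : subspace g;
  rep_lie : forall x y, g x -> g y -> g (comm x y);
  rep_linear : linear_on g act;
  rep_comm : forall x y v, g x -> g y ->
    act (comm x y) v = act x (act y v) - act y (act x v)
}.

Section PBW.
Variables (R : realType) (N : nat) (g : set 'M[R[i]]_N).
Variables (V : lmodType R[i]) (act : 'M[R[i]]_N -> {linear V -> V}).
Hypothesis rep : lie_rep g act.
Variables (r : nat) (x : 'I_r -> 'M[R[i]]_N) (v : V).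
Hypotheses (gx : forall i, g (x i)) (xg : span (range x) = g).

Let F k := Ufilt g act k [set v].
Let lw (s : seq 'I_r) : V := wact act (map x s) v.
Let mon (m : multinom r) : V := lw (m2s m).

Let sF k : subspace (F k). Proof. exact: subspace_Ufilt. Qed.

Let lwF s : F (size s) (lw s).
Proof.
elim: s => [|i s IH]; first exact: sub_span.
exact: (Ufilt_act (k := size s)).
Qed.

Let lw_swap i s t : F (size (s ++ t)) (lw (i :: s ++ t) - lw (s ++ i :: t)).
Proof.
elim: s => [|j s IH]; first by rewrite subrr; apply: subspace0 (sF _).
have -> : lw (i :: (j :: s) ++ t) - lw ((j :: s) ++ i :: t) =
    act (comm (x i) (x j)) (lw (s ++ t)) +
    act (x j) (lw (i :: s ++ t) - lw (s ++ i :: t)).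
  by rewrite (rep_comm rep) // linearB /= /lw /= addrA subrK.
apply: (subspaceD (sF _)); apply: (Ufilt_act (k := size (s ++ t))) => //.
  exact: rep_lie rep _ _ _ _.
exact: lwF.
Qed.

(** Reordering the letters of a word changes it by shorter words only. *)
Let lw_perm k s t : perm_eq s t -> size s = k.+1 -> F k (lw s - lw t).
Proof.
elim: s t k => [//|i s IH] t k st [sk].
have /splitPr it : i \in t by rewrite -(perm_mem st) mem_head.
case: it st => t1 t2; rewrite -(cat1s i t2) perm_sym perm_catCA.
rewrite /= perm_cons perm_sym => st.
have szt : size (t1 ++ t2) = k by rewrite -sk (perm_size st).
rewrite -[lw (i :: s)](subrK (lw (i :: t1 ++ t2))) -addrA.
apply: (subspaceD (sF _)); last first; [by rewrite -szt; apply: lw_swap|].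
case: k sk szt => [|k] sk szt.
  by rewrite (size0nil sk) (size0nil szt) subrr; apply: subspace0 (sF _).
rewrite -[_ - _]/(act (x i) (lw s) - act (x i) (lw (t1 ++ t2))) -linearB.
exact: (Ufilt_act (k := k)) (IH _ _ st sk).
Qed.

Let perm_s2m (s : seq 'I_r) : perm_eq s (m2s (s2m s)).
Proof.
apply/allP => i _ /=; have := s2mK (s2m s) => /mnmP /(_ i).
by rewrite !multinomE !tnth_mktuple => ->.
Qed.

Let mdeg_s2m (s : seq 'I_r) : mdeg (s2m s) = size s.
Proof. by rewrite -size_m2s -(perm_size (perm_s2m s)). Qed.

Let F_lw k : F k `<=` span [set lw s | s in [set s | (size s <= k)%N]].
Proof.
elim: k => [|k IH]; first by apply: span_mono => _ ->; exists [::].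
apply: span_min; first exact: subspace_span.
have lwS : span [set lw s | s in [set s | (size s <= k)%N]] `<=`
    span [set lw s | s in [set s | (size s <= k.+1)%N]].
  by apply: span_mono => _ [s sk <-]; exists s => //; apply: leq_trans sk _.
move=> w [/IH /lwS //|[y gy [u /IH uk <-]]].
move: gy; rewrite -xg => /(act_span (rep_subspace rep) (rep_linear rep)); apply.
- by move=> _ [i _ <-].
- exact: subspace_span.
move=> _ [i _ <-].
apply: (span_min (W := act (x i) @^-1` span [set lw s | s in [set s | (size s <= k.+1)%N]])) uk.
  exact: subspace_preim (subspace_span _).
by move=> _ [s sk <-]; apply: sub_span; exists (i :: s).
Qed.

(** The spanning half of the Poincare-Birkhoff-Witt theorem; the ordered
    monomials may well be linearly dependent in [V]. *)
Lemma PBW_span k : F k `<=` span [set mon m | m in [set m | (mdeg m <= k)%N]].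
Proof.
suff lwk s : span [set mon m | m in [set m | (mdeg m <= size s)%N]] (lw s).
  apply: subset_trans (@F_lw k) _; apply: span_min; first exact: subspace_span.
  move=> _ [s /= sk <-]; apply: span_mono (lwk s) => _ [m ms <-].
  by exists m => //; apply: leq_trans sk.
have [l] := ubnP (size s); elim: l s => // l IH s /ltnSE sl.
have smon : span [set mon m | m in [set m | (mdeg m <= size s)%N]] (mon (s2m s)).
  by apply: sub_span; exists (s2m s) => //=; rewrite mdeg_s2m.
rewrite -[lw s](subrK (mon (s2m s))).
apply: (subspaceD (subspace_span _)) => //.
case sz : (size s) => [|n].
  rewrite /mon (size0nil sz); suff -> : m2s (s2m [::]) = [::] :> seq 'I_r.
    by rewrite subrr; apply: subspace0 (subspace_span _).
  by apply: size0nil; rewrite -(perm_size (perm_s2m [::])).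
apply: (span_min (subspace_span _) _ (F_lw (lw_perm (perm_s2m s) sz))).
move=> _ [t /= tn <-]; apply: span_mono (IH t _); last by rewrite sz in sl; apply: leq_trans sl.
by move=> _ [m mt <-]; exists m => //; apply: leqW; apply: leq_trans mt tn.
Qed.

Let monF m : F (mdeg m) (mon m).
Proof. by rewrite -size_m2s; apply: lwF. Qed.

Let Lo (m : multinom r) := span [set mon m' | m' in [set m' | (m' < m)%O]].

Let F_Lo k m : (k < mdeg m)%N -> F k `<=` Lo m.
Proof.
move=> km; apply: subset_trans (@PBW_span k) _.
apply: span_mono => _ [m' m'k <-]; exists m' => //.
by apply: lt_mdeg_ltmc; apply: leq_ltn_trans km.
Qed.

Let mon_act i m : F (mdeg m) (act (x i) (mon m) - mon (mnm_add m (mnm1 i))).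
Proof.
rewrite -[act _ _]/(lw (i :: m2s m)); apply: lw_perm; last by rewrite /= size_m2s.
have := perm_s2m (i :: m2s m); congr perm_eq; congr m2s.
apply/mnmP => j; have := s2mK m => /mnmP /(_ j).
by rewrite mnmDE mnm1E !multinomE !tnth_mktuple /= addnC => ->.
Qed.

(** Multiplying by a generator shifts exponents, up to terms of lower degree,
    and the monomial order is compatible with both. *)
Let Lo_step i m : Lo m (mon m) -> Lo (mnm_add m (mnm1 i)) (mon (mnm_add m (mnm1 i))).
Proof.
set m1 := mnm_add m (mnm1 i) => Lom.
have degS m' : mdeg (mnm_add m' (mnm1 i)) = (mdeg m').+1 by rewrite mdegD mdeg1 addn1.
have sLo : subspace (Lo m1) by exact: subspace_span.
rewrite -[mon m1](subrK (act (x i) (mon m))); apply: (subspaceD sLo).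
  rewrite -opprB; apply: (subspaceN sLo); apply: F_Lo (mon_act i m).
  by rewrite degS.
apply: (span_min (W := act (x i) @^-1` Lo m1)) Lom; first exact: subspace_preim.
move=> _ [m' m'm <-]; rewrite /preimage /=.
rewrite -[act _ _](subrK (mon (mnm_add m' (mnm1 i)))); apply: (subspaceD sLo).
  apply: F_Lo (mon_act i m').
  by rewrite degS ltnS; apply: lemc_mdeg; apply: ltW.
by apply: sub_span; exists (mnm_add m' (mnm1 i)) => //=; rewrite ltmc_add2l.
Qed.

Let std (m : multinom r) := ~ Lo m (mon m).

Let std_down (m m' : multinom r) : (forall i, m i <= m' i)%N -> std m' -> std m.
Proof.
move=> mm' sm' Lom; apply: sm'.
have -> : m' = mnm_add m (s2m (m2s (mnm_sub m' m))).
  by rewrite s2mK; apply/mnmP => i; rewrite mnmDE mnmBE subnKC.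
elim: (m2s _) => [|i s IH].
  suff -> : mnm_add m (s2m [::]) = m by [].
  by apply/mnmP => i; rewrite mnmDE multinomE tnth_mktuple addn0.
suff -> : mnm_add m (s2m (i :: s)) = mnm_add (mnm_add m (s2m s)) (mnm1 i).
  exact: Lo_step.
apply/mnmP => j; rewrite !mnmDE mnm1E !multinomE !tnth_mktuple /=.
by rewrite -addnA [(_ + (i == j))%N]addnC.
Qed.

Let std_span k : F k `<=` span [set mon m | m in [set m | std m /\ (mdeg m <= k)%N]].
Proof.
apply: subset_trans (@PBW_span k) _; apply: span_min; first exact: subspace_span.
move=> _ [m + <-]; elim/(@ltmwf r): m => m IH /= mk.
have [/asboolP sm|/asboolP/contrapT Lom] := boolP `[< std m >].
  by apply: sub_span; exists m.
apply: (span_min (subspace_span _) _ Lom) => _ [m' m'm <-].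
by apply: IH => //; apply: leq_trans mk; apply: lemc_mdeg; apply: ltW.
Qed.

Let std_indep (J : finType) (phi : J -> multinom r) :
  injective phi -> (forall j, std (phi j)) -> indep (mon \o phi).
Proof.
move=> phi_inj sphi c c0 j0; apply/eqP; apply: contraT => cj0.
case: (@Order.TotalTheory.arg_maxP _ _ _ j0 (fun j => c j != 0) phi cj0) => j cj jmax.
have sLo : subspace (Lo (phi j)) by exact: subspace_span.
case: (sphi j); rewrite -[mon _]scale1r -(mulVf cj) -scalerA.
apply: (subspaceZ _ sLo).
move/eqP: c0; rewrite (bigD1 j) //= addr_eq0 => /eqP ->.
apply: (subspaceN sLo).
apply: (subspace_sum _ sLo) => j' j'j.
have [->|cj'] := eqVneq (c j') 0.
  by rewrite scale0r; apply: subspace0 sLo.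
apply: (subspaceZ _ sLo); apply: sub_span; exists (phi j') => //=.
by rewrite lt_neqAle (inj_eq phi_inj) j'j; exact: jmax.
Qed.

(** Monomials are compared by degree and then lexicographically.  Those not in
    the span of smaller ones form a basis compatible with the filtration and
    indexed by a downward closed set of exponents. *)
Lemma PBW_growth : v != 0 -> exists d c, forall k, (0 < k)%N ->
  (k ^ d <= c * dim (F k))%N /\ (dim (F k) <= c * k ^ d)%N.
Proof.
move=> v0; have std0 : std mnm0.
  move=> L0; have : [set (0 : V)] (mon mnm0).
    apply: (span_min (subspace_set0 V) _ L0) => _ [m + <-].
    by rewrite /= ltNge; have := lemc_addr mnm0 m; rewrite add0m => ->.
  have m0 : m2s (mnm0 : multinom r) = [::] by apply: size0nil; rewrite size_m2s mdeg0.
  by rewrite /mon m0 /lw /= => /eqP; rewrite (negPf v0).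
have [d [c dcP]] := downset_growth std0 std_down; exists d, c => k k0.
have [[J [phi [phi_inj sphi le_c]]] [J' [phi' [phi'P le_c']]]] := dcP k k0.
have fF : findim (F k).
  apply: findim_Ufilt (findim_set1 _); [exact: rep_subspace rep|exact: rep_linear rep].
split.
  apply: leq_trans le_c _; rewrite leq_mul2l; apply/orP; right.
  apply: (dim_ge_card (c := mon \o phi)) => // [|j].
    by apply: std_indep => // j; have [] := sphi j.
  by apply: (Ufilt_le (sphi j).2); apply: monF.
apply: leq_trans le_c'; apply: (dim_le_card (c := mon \o phi')) => //.
apply: subset_trans (@std_span k) _; apply: span_mono => _ [m [sm mk] <-].
by have [j <-] := phi'P m sm mk; exists j.
Qed.

End PBW.

(** It follows that the upper limit defining the dimension of a cyclic module is
    a limit, which is what makes dimensions additive on products. *)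
Lemma cyclic_growth (R : realType) N (g : set 'M[R[i]]_N) (V : lmodType R[i])
    (act : 'M[R[i]]_N -> {linear V -> V}) (v : V) :
  lie_rep g act -> v != 0 -> exists d c, forall k, (0 < k)%N ->
  (k ^ d <= c * dim (Ufilt g act k [set v]))%N /\
  (dim (Ufilt g act k [set v]) <= c * k ^ d)%N.
Proof.
move=> rep v0; have [r [x [gx xg]]] := finite_span (rep_subspace rep).
have := PBW_growth rep gx xg v0; exact.
Qed.

(** * Highest weight vectors *)

Section Lower.
Variables (R : realType) (V : lmodType R[i]).
Implicit Types (f h : {linear V -> V}) (c : R[i]).

(** The part of a highest weight module that lies strictly below the top
    eigenvalue [c] of a grading operator [f]. *)
Definition lower f c : set V :=
  span [set w | exists j : nat, f w = (c - j.+1%:R) *: w].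

(** Applying [f - a] removes the terms of eigenvalue [a] from a sum of
    eigenvectors and only rescales the sum. *)
Lemma sum_eigenvectors f c (s : seq V) :
  (forall w, w \in s -> exists2 a, a != c & f w = a *: w) ->
  f (\sum_(w <- s) w) = c *: \sum_(w <- s) w -> \sum_(w <- s) w = 0.
Proof.
have [n] := ubnP (size s); elim: n s => // n IH [|w s] /= sn es fs.
  by rewrite big_nil.
have [a ac fw] := es w (mem_head w s).
set S := \sum_(u <- _) u in fs *.
have SE : S = w + \sum_(u <- s) u by rewrite /S big_cons.
pose s' := [seq f u - a *: u | u <- s].
have s'E : \sum_(u <- s') u = (c - a) *: S.
  rewrite big_map sumrB -linear_sum -scaler_sumr scalerBl -fs SE linearD fw.
  by rewrite scalerDr opprD addrACA subrr add0r.
have : \sum_(u <- s') u = 0.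
  apply: IH; first by rewrite size_map.
    move=> u0 /mapP [u us ->].
    have [b bc fu] : exists2 b, b != c & f u = b *: u.
      by apply: es; rewrite inE us orbT.
    by exists b => //; rewrite linearB linearZ fu /= linearZ /= fu scalerBr !scalerA [a * b]mulrC.
  by rewrite s'E linearZ /= fs !scalerA mulrC.
by rewrite s'E => /eqP; rewrite scaler_eq0 subr_eq0 eq_sym (negPf ac) => /eqP.
Qed.

Lemma lower_eigen f c w : lower f c w -> f w = c *: w -> w = 0.
Proof.
pose Q := [set w | exists2 s : seq V,
  forall u, u \in s -> exists2 a, a != c & f u = a *: u & w = \sum_(u <- s) u].
move=> lw; have [s es ->] : Q w.
  apply: (span_min (W := Q)) lw => [|u [j fu]]; last first.
    exists [:: u]; last by rewrite big_seq1.
    move=> _ /[!inE] /eqP ->; exists (c - j.+1%:R) => //.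
    by rewrite -subr_eq0 addrAC subrr add0r oppr_eq0 pnatr_eq0.
  split=> [|a _ _ [s es ->] [t et ->]]; first by exists [::]; rewrite ?big_nil.
  exists ([seq a *: u | u <- s] ++ t); last by rewrite big_cat big_map scaler_sumr.
  move=> u; rewrite mem_cat => /orP[/mapP [u' /es [b bc fu'] ->]|/et //].
  by exists b => //; rewrite linearZ /= fu' !scalerA mulrC.
exact: sum_eigenvectors.
Qed.

Lemma lower_eigen_act f h c (j : nat) w :
  (forall u, f (h u) = h (f u) - j.+1%:R *: h u) ->
  f w = c *: w -> lower f c (h w).
Proof.
move=> fh fw; apply: sub_span; exists j.
by rewrite fh fw linearZ /= scalerBl.
Qed.

Lemma lower_act f h c (j : nat) w :
  (forall u, f (h u) = h (f u) - j.+1%:R *: h u) ->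
  lower f c w -> lower f c (h w).
Proof.
move=> fh; apply: (span_min (W := h @^-1` lower f c)).
  exact: subspace_preim (subspace_span _).
move=> u [k fu]; apply: sub_span; exists (k + j.+1)%N.
rewrite fh fu linearZ /= -scalerBl; congr (_ *: _).
by rewrite -addSn natrD opprD addrA.
Qed.

End Lower.

Section Cyclic.
Variables (R : realType) (N : nat).
Implicit Types (g E B : set 'M[R[i]]_N).

Definition words g : set (seq 'M[R[i]]_N) := 
  [set u : seq 'M[R[i]]_N | forall x, x \in u -> g x].

Lemma words_nil g : words g [::]. Proof. by []. Qed.

Lemma words_cons g x u : g x -> words g u -> words g (x :: u).
Proof. by move=> gx gu y; rewrite inE => /orP[/eqP -> //|]; exact: gu. Qed.

Lemma words_consP g x u : words g (x :: u) -> g x /\ words g u.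
Proof.
move=> gu; split; first by apply: gu; rewrite mem_head.
by move=> y yu; apply: gu; rewrite inE yu orbT.
Qed.

Lemma words_cat g u u' : words g u -> words g u' -> words g (u ++ u').
Proof. by move=> gu gu' x; rewrite mem_cat => /orP[/gu|/gu']. Qed.

Lemma words_sub g g' u : g `<=` g' -> words g u -> words g' u.
Proof. by move=> gg' gu x /gu; apply: gg'. Qed.

Lemma word_words g k u : word g k u -> words g u. Proof. by case. Qed.

Section Module.
Variables (V : lmodType R[i]) (act : 'M[R[i]]_N -> {linear V -> V}).
Implicit Types (v w : V).

(** Used with [g] a Lie algebra, where this is the submodule generated by [W],
    and with [g] a mere set of root vectors. *)
Definition cyc g (W : set V) : set V :=
  span [set wact act u w | u in words g & w in W].

Lemma subspace_cyc g W : subspace (cyc g W). Proof. exact: subspace_span. Qed.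

Lemma sub_cyc g W : W `<=` cyc g W.
Proof. by move=> w Ww; apply: sub_span; exists [::] => //; exists w. Qed.

Lemma words_stable g (W : set V) u w :
  (forall x w, g x -> W w -> W (act x w)) -> words g u -> W w -> W (wact act u w).
Proof.
move=> gW; elim: u => [//|x u IH] /words_consP [gx gu] Ww.
by apply: gW => //; apply: IH.
Qed.

Lemma cyc_min g (W W' : set V) : subspace W' ->
  (forall x w, g x -> W' w -> W' (act x w)) -> W `<=` W' -> cyc g W `<=` W'.
Proof.
move=> sW' gW' WW'; apply: span_min => // _ [u gu [w /WW' Ww <-]].
exact: words_stable gu Ww.
Qed.

Lemma cyc_act g W x w : g x -> cyc g W w -> cyc g W (act x w).
Proof.
move=> gx; apply: (span_min (W := act x @^-1` cyc g W)).
  exact: subspace_preim (subspace_span _).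
move=> _ [u gu [w' Ww' <-]]; apply: sub_span; exists (x :: u).
  exact: words_cons.
by exists w'.
Qed.

Lemma cyc_sub g g' W W' : g `<=` g' -> W `<=` W' -> cyc g W `<=` cyc g' W'.
Proof.
move=> gg' WW'; apply: cyc_min; first exact: subspace_cyc.
  by move=> x w /gg' gx; apply: cyc_act.
by apply: subset_trans WW' _; apply: sub_cyc.
Qed.

(** [negpart g E v] is the span of the [E]-images of the module generated by
    [v]; when [E] consists of negative root vectors and [v] is a highest
    weight vector, it is a complement of the line of [v]. *)
Definition negpart g E v : set V :=
  span [set act y w | y in E & w in cyc g [set v]].

End Module.

(** [E] plays the part of the negative root vectors, [B] that of the Borel
    subalgebra, and [ad H] grades [g] with [E] in negative degrees. *)
Record triangular g E B (H : 'M[R[i]]_N) : Prop := Triangular {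
  tri_neg : E `<=` g;
  tri_borel : B `<=` g;
  tri_span : g `<=` span (E `|` B);
  tri_grading : B H;
  tri_degree : forall y, E y -> exists j : nat, comm H y = - j.+1%:R *: y
}.

Section HighestWeight.
Variables (V : lmodType R[i]) (act : 'M[R[i]]_N -> {linear V -> V}).
Variables (g E B : set 'M[R[i]]_N) (H : 'M[R[i]]_N) (chi : 'M[R[i]]_N -> R[i]).
Variable v : V.
Hypotheses (rep : lie_rep g act) (tri : triangular g E B H).
Hypothesis hv : forall b, B b -> act b v = chi b *: v.

(** Moving an element of [g] past the negative letters of a word leaves
    commutators, which again lie in [g]; on [v] itself it is a negative
    element plus a scalar. *)
Lemma cyc_negative_stable x w :
  g x -> cyc act E [set v] w -> cyc act E [set v] (act x w).
Proof.
pose P := [set w | cyc act E [set v] w /\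
                   forall x, g x -> cyc act E [set v] (act x w)].
have sC : subspace (cyc act E [set v]) by exact: subspace_cyc.
have sP : subspace P.
  split; first by split=> [|y _]; rewrite ?linear0; apply: subspace0 sC.
  move=> a u u' [Pu gu] [Pu' gu']; split; first exact: sC.2.
  by move=> y gy; rewrite linearP; apply: sC.2; [apply: gu|apply: gu'].
suff PC : cyc act E [set v] `<=` P by move=> gx /PC [_ /(_ x gx)].
apply: (cyc_min sP) => [y u Ey [Cu gu]|_ ->].
  have gy : g y := tri_neg tri Ey.
  split; first exact: cyc_act.
  move=> x' gx'; rewrite -[act x' _](subrK (act y (act x' u))) -(rep_comm rep) //.
  apply: (subspaceD sC); first by apply: gu; apply: rep_lie rep _ _ _ _.
  by apply: cyc_act => //; apply: gu.
split=> [|y /(tri_span tri)]; first exact: sub_cyc.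
apply: (act_span (rep_subspace rep) (rep_linear rep)) => // [z [/(tri_neg tri)|/(tri_borel tri)] //|z [Ez|Bz]].
  by apply: cyc_act => //; apply: sub_cyc.
by rewrite hv //; apply: (subspaceZ _ sC); apply: sub_cyc.
Qed.

Lemma cyc_negative : cyc act g [set v] `<=` cyc act E [set v].
Proof.
apply: cyc_min; first exact: subspace_cyc.
  by move=> x w; apply: cyc_negative_stable.
exact: sub_cyc.
Qed.

Lemma highest_coef u : words g u ->
  exists c, negpart act g E v (wact act u v - c *: v).
Proof.
move=> gu; have : cyc act E [set v] (wact act u v).
  by apply: cyc_negative; apply: sub_span; exists u => //; exists v.
apply: (span_min (W := [set w | exists c, negpart act g E v (w - c *: v)])).
  split; first by exists 0; rewrite scale0r subrr; apply: subspace0 (subspace_span _).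
  move=> a w w' [c cw] [c' cw']; exists (a * c + c').
  rewrite scalerDl opprD addrACA -scalerA -scalerBr.
  exact: (subspace_span _).2.
move=> _ [[|y t] Et [_ -> <-]] /=.
  by exists 1; rewrite scale1r subrr; apply: subspace0 (subspace_span _).
exists 0; rewrite scale0r subr0; have [Ey {}Et] := words_consP Et.
apply: sub_span; exists y => //; exists (wact act t v) => //.
apply: sub_span; exists t; last by exists v.
exact: words_sub (tri_neg tri) Et.
Qed.

(** Everything in [negpart] has grading strictly below that of [v]. *)
Lemma highest_notin_negpart : v != 0 -> ~ negpart act g E v v.
Proof.
move=> /eqP v0 nv; apply: v0; apply: (lower_eigen _ (hv (tri_grading tri))).
have gH := tri_borel tri (tri_grading tri).
have deg y : E y -> exists j : nat, forall u,
    act H (act y u) = act y (act H u) - j.+1%:R *: act y u.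
  move=> Ey; have [j Hy] := tri_degree tri Ey; exists j => u.
  have gy := tri_neg tri Ey.
  have := rep_comm rep u gH gy.
  rewrite Hy (actZ (rep_subspace rep) (rep_linear rep)) // scaleNr => ->.
  by rewrite addrC subrK.
apply: (span_min (subspace_span _) _ nv) => _ [y Ey [w /cyc_negative Cw <-]].
have [j degj] := deg _ Ey.
suff : [set w | lower (act H) (chi H) (act y w)] w by [].
apply: (span_min _ _ Cw); first exact: subspace_preim (subspace_span _).
move=> _ [t Et [_ -> <-]] /=.
elim: t y Ey j degj Et => [|y' t IH] y Ey j degj Et.
  by apply: (lower_eigen_act (j := j)) => //; apply: hv; apply: tri_grading tri.
have [Ey' Et'] := words_consP Et; have [j' degj'] := deg _ Ey'.
by apply: (lower_act (j := j)) => //; apply: (IH _ Ey' j').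
Qed.

End HighestWeight.

Section Universal.
Variables (V V' : lmodType R[i]).
Variables (act : 'M[R[i]]_N -> {linear V -> V}) (act' : 'M[R[i]]_N -> {linear V' -> V'}).
Variables (g E B : set 'M[R[i]]_N) (H : 'M[R[i]]_N) (chi : 'M[R[i]]_N -> R[i]).
Variables (v : V) (v' : V').
Hypotheses (rep : lie_rep g act) (rep' : lie_rep g act') (tri : triangular g E B H).
Hypothesis hv : forall b, B b -> act b v = chi b *: v.
Hypothesis hv' : forall b, B b -> act' b v' = chi b *: v'.

Let pact x (p : V * V') : V * V' := (act x p.1, act' x p.2).

Let pact_linear x : linear (pact x).
Proof. by move=> a p q; rewrite /pact /= !linearP. Qed.

HB.instance Definition _ x :=
  GRing.isLinear.Build R[i] (V * V')%type (V * V')%type *:%R (pact x) (pact_linear x).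

Let pl x : {linear (V * V')%type -> (V * V')%type} := pact x.

Let rep_pact : lie_rep g pl.
Proof.
split; [exact: rep_subspace rep|exact: rep_lie rep| |].
  move=> c x y p gx gy; rewrite /pl /= /pact.
  by rewrite (rep_linear rep) // (rep_linear rep').
by move=> x y p gx gy; rewrite /pl /= /pact (rep_comm rep) // (rep_comm rep').
Qed.

Let wact_pact u p : wact pl u p = (wact act u p.1, wact act' u p.2).
Proof. by elim: u => [|x u IH] /=; [case: p|rewrite IH]. Qed.

(** The coefficient of the highest weight vector depends only on the word and
    the highest weight: it can be read off in the diagonal submodule of a
    direct sum. *)
Lemma universal_coef u : words g u -> exists c,
  negpart act g E v (wact act u v - c *: v) /\
  negpart act' g E v' (wact act' u v' - c *: v').
Proof.
move=> gu; have hp b : B b -> pl b (v, v') = chi b *: (v, v').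
  by move=> Bb; rewrite /pl /= /pact /= hv // hv'.
have [c] := highest_coef rep_pact tri hp gu; rewrite wact_pact => nc; exists c.
suff : [set p | negpart act g E v p.1 /\ negpart act' g E v' p.2]
    ((wact act u v, wact act' u v') - c *: (v, v')) by [].
have sN : subspace (negpart act g E v) by exact: subspace_span.
have sN' : subspace (negpart act' g E v') by exact: subspace_span.
have sC : subspace (cyc act g [set v]) by exact: subspace_span.
have sC' : subspace (cyc act' g [set v']) by exact: subspace_span.
apply: (span_min _ _ nc).
  split; first by split; [apply: subspace0 sN|apply: subspace0 sN'].
  by move=> a p q [? ?] [? ?]; split; [apply: sN.2|apply: sN'.2].
move=> _ [y Ey [p Cp <-]].
have [C1 C2] : [set p | cyc act g [set v] p.1 /\ cyc act' g [set v'] p.2] p.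
  apply: (span_min _ _ Cp).
    split; first by split; [apply: subspace0 sC|apply: subspace0 sC'].
    by move=> a q q' [? ?] [? ?]; split; [apply: sC.2|apply: sC'.2].
  move=> _ [t gt [_ -> <-]]; rewrite wact_pact /=.
  by split; apply: sub_span; exists t => //; [exists v|exists v'].
by split; apply: sub_span; exists y => //; [exists p.1|exists p.2].
Qed.

End Universal.
End Cyclic.

(** * Lie superalgebras of type I *)

Section Commutators.
Variables (R : realType) (N : nat).
Implicit Types x y z : 'M[R[i]]_N.

Lemma comm_jacobi z x y : comm z (comm x y) = comm (comm z x) y + comm x (comm z y).
Proof.
have zmod_id (V : zmodType) (a b c d e f : V) :
    a - b - (c - d) = a - e - (f - d) + (e - c - (b - f)).
  rewrite !opprB [RHS]addrACA !subrKA.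
  by rewrite addrACA [RHS]addrACA [- b - c]addrC.
rewrite /comm !mulmxBl !mulmxBr !mulmxA; exact: zmod_id.
Qed.

Lemma comm_mul z x y : comm z (x *m y) = comm z x *m y + x *m comm z y.
Proof. by rewrite /comm mulmxBl mulmxBr !mulmxA subrKA. Qed.

Lemma commDr z x y : comm z (x + y) = comm z x + comm z y.
Proof. by rewrite /comm mulmxDr mulmxDl opprD addrACA. Qed.

Lemma commZr z c x : comm z (c *: x) = c *: comm z x.
Proof. by rewrite /comm -scalemxAr -scalemxAl scalerBr. Qed.

Lemma commNr z x : comm z (- x) = - comm z x.
Proof. by rewrite /comm mulmxN mulNmx opprB opprK addrC. Qed.

Lemma comm0r z : comm z 0 = 0.
Proof. by rewrite /comm mulmx0 mul0mx subrr. Qed.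

Lemma commNC x y : comm y x = - comm x y.
Proof. by rewrite /comm opprB. Qed.

Lemma commDl z x y : comm (x + y) z = comm x z + comm y z.
Proof. by rewrite commNC commDr opprD -!commNC. Qed.

End Commutators.

(** The structure on which the proof relies: the even part is the sum of two
    commuting ideals (the images of [s1] and [s2]) and the line of [z], and
    [ad z] has eigenvalues [1] and [-1] on the odd part. *)
Record typeI (R : realType) (N N1 N2 : nat) (g : bool -> set 'M[R[i]]_N)
    (s1 : set 'M[R[i]]_N1) (s2 : set 'M[R[i]]_N2)
    (i1 : {linear 'M[R[i]]_N1 -> 'M[R[i]]_N})
    (i2 : {linear 'M[R[i]]_N2 -> 'M[R[i]]_N}) (z : 'M[R[i]]_N) : Prop := TypeI {
  tI_sub : forall a, subspace (g a);
  tI_lie : forall a b x y, g a x -> g b y ->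
    g (a (+) b) (x *m y - (-1) ^+ (a && b) *: (y *m x));
  tI_sub1 : subspace s1;
  tI_lie1 : forall x y, s1 x -> s1 y -> s1 (comm x y);
  tI_sub2 : subspace s2;
  tI_lie2 : forall x y, s2 x -> s2 y -> s2 (comm x y);
  tI_z : g false z;
  tI_central : forall x, g false x -> comm z x = 0;
  tI_invol : forall x, g true x -> comm z (comm z x) = x;
  tI_in1 : forall x, s1 x -> g false (i1 x);
  tI_in2 : forall x, s2 x -> g false (i2 x);
  tI_comm1 : forall x y, i1 (comm x y) = comm (i1 x) (i1 y);
  tI_comm2 : forall x y, i2 (comm x y) = comm (i2 x) (i2 y);
  tI_comm12 : forall x y, s1 x -> s2 y -> comm (i1 x) (i2 y) = 0;
  tI_split : forall x, g false x -> exists a b c,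
    [/\ s1 a, s2 b & x = i1 a + i2 b + c *: z]
}.

Section OddEigenspaces.
Variables (R : realType) (N N1 N2 : nat) (g : bool -> set 'M[R[i]]_N).
Variables (s1 : set 'M[R[i]]_N1) (s2 : set 'M[R[i]]_N2).
Variables (i1 : {linear 'M[R[i]]_N1 -> 'M[R[i]]_N}).
Variables (i2 : {linear 'M[R[i]]_N2 -> 'M[R[i]]_N}) (z : 'M[R[i]]_N).
Hypothesis tI : typeI g s1 s2 i1 i2 z.

Definition odd_pos : set 'M[R[i]]_N := [set x | g true x /\ comm z x = x].
Definition odd_neg : set 'M[R[i]]_N := [set x | g true x /\ comm z x = - x].

Lemma comm_even a x y : g false x -> g a y -> g a (comm x y).
Proof. by move=> gx gy; have := tI_lie tI gx gy; rewrite /= scale1r. Qed.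

Lemma anticomm_odd x y : g true x -> g true y -> g false (x *m y + y *m x).
Proof. by move=> gx gy; have := tI_lie tI gx gy; rewrite /= scaleN1r opprK. Qed.

Lemma subspace_odd_neg : subspace odd_neg.
Proof.
have sg := tI_sub tI true; split; first by split; rewrite ?comm0r ?oppr0 //; case: sg.
move=> a x y [gx zx] [gy zy]; split; first exact: sg.2.
by rewrite commDr commZr zx zy opprD scalerN.
Qed.

Lemma comm_odd_neg x y : g false x -> odd_neg y -> odd_neg (comm x y).
Proof.
move=> gx [gy zy]; split; first exact: comm_even.
by rewrite comm_jacobi (tI_central tI gx) zy commNr /comm mul0mx mulmx0 subr0 add0r.
Qed.

Lemma comm_odd_pos x y : g false x -> odd_pos y -> odd_pos (comm x y).
Proof.
move=> gx [gy zy]; split; first exact: comm_even.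
by rewrite comm_jacobi (tI_central tI gx) zy /comm mul0mx mulmx0 subr0 add0r.
Qed.

(** The anticommutator of two elements of degree -1 is an even element of
    degree -2, while the even part has degree 0. *)
Lemma anticomm_odd_neg x y : odd_neg x -> odd_neg y -> x *m y + y *m x = 0.
Proof.
move=> [gx zx] [gy zy]; have := tI_central tI (anticomm_odd gx gy).
rewrite commDr !comm_mul zx zy !mulNmx !mulmxN -!opprD => /eqP.
by rewrite oppr_eq0 addrACA -mulr2n -scaler_nat scaler_eq0 pnatr_eq0 => /eqP.
Qed.

Lemma odd_split x : g true x -> exists y y', [/\ odd_neg y, odd_pos y' & x = y + y'].
Proof.
move=> gx; have sg := tI_sub tI true; have gzx := comm_even (tI_z tI) gx.
exists (2^-1 *: (x - comm z x)), (2^-1 *: (x + comm z x)); split.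
- split; first by apply: (subspaceZ _ sg); apply: (subspaceB sg).
  by rewrite commZr commDr commNr (tI_invol tI gx) -scalerN opprB.
- split; first by apply: (subspaceZ _ sg); apply: (subspaceD sg).
  by rewrite commZr commDr (tI_invol tI gx) addrC.
rewrite -scalerDr addrACA addNr addr0 -mulr2n -[x *+ 2]scaler_nat scalerA mulVf ?scale1r //.
Qed.

Lemma sub_total a : g a `<=` total_alg g.
Proof.
move=> x gx; have g0 b := subspace0 (tI_sub tI b); case: a gx => gx.
  by exists 0 => //; exists x => //; rewrite add0r.
by exists x => //; exists 0 => //; rewrite addr0.
Qed.

Lemma subspace_total : subspace (total_alg g).
Proof. by apply: subspace_add; apply: tI_sub tI _. Qed.

Section Super.
Variable L : superModule g.
Implicit Types (W : set L) (w : L).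
Let act := sm_act L.

Lemma sm_linear : linear_on (total_alg g) act.
Proof. by move=> c x y v; apply: sm_actD. Qed.

Lemma sm_actN x w : total_alg g x -> act (- x) w = - act x w.
Proof.
by move=> gx; rewrite -[- x]scaleN1r (actZ subspace_total sm_linear) // scaleN1r.
Qed.

Lemma sm_act0 w : act 0 w = 0.
Proof. exact: act0 subspace_total sm_linear w. Qed.

Lemma sm_act_even a x y w : g false x -> g a y ->
  act x (act y w) = act y (act x w) + act (comm x y) w.
Proof.
move=> gx gy; have := sm_act_bracket w gx gy; rewrite /= !scale1r /comm => ->.
by rewrite addrC subrK.
Qed.

Lemma sm_act_odd x y w : g true x -> g true y ->
  act x (act y w) = - act y (act x w) + act (x *m y + y *m x) w.
Proof.
move=> gx gy; have := sm_act_bracket w gx gy.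
by rewrite /= !scaleN1r !opprK => ->; rewrite addrC addrK.
Qed.

Lemma rep_even : lie_rep (g false) act.
Proof.
split; [exact: tI_sub tI _|by move=> x y; apply: comm_even| |].
  by move=> c x y v gx gy; apply: sm_linear; [exact: sub_total gx|exact: sub_total gy].
by move=> x y v gx gy; rewrite (sm_act_even v gx gy) addrC addKr.
Qed.

(** [cyc act odd_neg W] is what the exterior algebra of the odd negative part
    generates from [W].  An element acting on a product of odd negative elements
    is moved to the right: even elements leave commutators that are again odd
    negative, odd positive ones leave anticommutators that are even. *)
Lemma odd_cyc_act W W' x u :
  W `<=` W' ->
  (forall y w, g false y -> W w -> W' (act y w)) ->
  (forall y w, odd_pos y -> W w -> act y w = 0) ->
  total_alg g x -> cyc act odd_neg W u -> cyc act odd_neg W' (act x u).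
Proof.
move=> WW' evW posW.
have sC' : subspace (cyc act odd_neg W') by exact: subspace_cyc.
have CC' : cyc act odd_neg W `<=` cyc act odd_neg W' by exact: cyc_sub.
have ev : cyc act odd_neg W `<=`
    [set u | cyc act odd_neg W u /\ forall y, g false y -> cyc act odd_neg W' (act y u)].
  apply: cyc_min => [|y w ny [Cw evw]|w Ww].
  - have sC : subspace (cyc act odd_neg W) by exact: subspace_cyc.
    split; first by split=> [|y _]; rewrite ?linear0; apply: subspace0 (subspace_cyc _ _ _).
    move=> a w w' [Cw evw] [Cw' evw']; split; first exact: sC.2.
    by move=> y gy; rewrite linearP; apply: sC'.2; [apply: evw|apply: evw'].
  - split; first exact: cyc_act.
    move=> x' gx'; rewrite (sm_act_even _ gx' ny.1); apply: (subspaceD sC').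
      by apply: cyc_act => //; apply: evw.
    by apply: CC'; apply: cyc_act => //; apply: comm_odd_neg.
  split; first exact: sub_cyc.
  by move=> y gy; apply: sub_cyc; apply: evW.
have pos : cyc act odd_neg W `<=`
    [set u | cyc act odd_neg W u /\ forall y, odd_pos y -> cyc act odd_neg W' (act y u)].
  apply: cyc_min => [|y w ny [Cw posw]|w Ww].
  - have sC : subspace (cyc act odd_neg W) by exact: subspace_cyc.
    split; first by split=> [|y _]; rewrite ?linear0; apply: subspace0 (subspace_cyc _ _ _).
    move=> a w w' [Cw posw] [Cw' posw']; split; first exact: sC.2.
    by move=> y gy; rewrite linearP; apply: sC'.2; [apply: posw|apply: posw'].
  - split; first exact: cyc_act.
    move=> x' px'; rewrite (sm_act_odd _ px'.1 ny.1); apply: (subspaceD sC').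
      by apply: (subspaceN sC'); apply: cyc_act => //; apply: posw.
    by apply: (ev _ Cw).2; apply: anticomm_odd; [exact: px'.1|exact: ny.1].
  split; first exact: sub_cyc.
  by move=> y py; rewrite (posW y) //; apply: subspace0 sC'.
move=> [x0 gx0 [x1 gx1 <-]] Cu; have [y [y' [ny py' x1E]]] := odd_split gx1.
have gy := sub_total ny.1; have gy' := sub_total py'.1.
rewrite -[x0]scale1r sm_linear ?scale1r; [|exact: sub_total gx0|exact: sub_total gx1].
apply: (subspaceD sC'); first by apply: (ev _ Cu).2.
rewrite x1E -[y]scale1r sm_linear // scale1r; apply: (subspaceD sC').
  by apply: CC'; apply: cyc_act.
exact: (pos _ Cu).2.
Qed.

(** Adjoining the image of one more odd negative element at most doubles the
    dimension, and because these elements anticommute and have square zero the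
    result after all of a spanning family is stable. *)
Lemma dim_odd_cyc : exists D, forall W, subspace W -> findim W ->
  findim (cyc act odd_neg W) /\ (dim (cyc act odd_neg W) <= 2 ^ D * dim W)%N.
Proof.
have [D [y [ny yneg]]] := finite_span subspace_odd_neg; exists D => W sW fW.
pose step (x : 'M[R[i]]_N) A : set L := [set a + act x b | a in A & b in A].
pose A ys : set L := foldr step W ys.
have sA ys : subspace (A ys).
  elim: ys => [//|x ys IH] /=; split.
    by exists 0; [exact: subspace0 IH|exists 0; rewrite ?linear0 ?addr0 //; apply: subspace0 IH].
  move=> c _ _ [a Aa [b Ab <-]] [a' Aa' [b' Ab' <-]].
  exists (c *: a + a'); first exact: IH.2.
  exists (c *: b + b'); first exact: IH.2.
  by rewrite linearP scalerDr addrACA.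
have A_cons x ys : A ys `<=` A (x :: ys).
  by move=> a Aa; exists a => //; exists 0; rewrite ?linear0 ?addr0 //; apply: subspace0 (sA ys).
have WA ys : W `<=` A ys.
  by elim: ys => [//|x ys IH]; apply: subset_trans IH _; apply: A_cons.
have A_stable ys x w : (forall x, x \in ys -> odd_neg x) -> x \in ys ->
    A ys w -> A ys (act x w).
  elim: ys x w => [//|x' ys IH] x w nys xys [a Aa [b Ab <-]].
  have nx' : odd_neg x' by apply: nys; rewrite mem_head.
  have nx : odd_neg x by exact: nys.
  have nys' u : u \in ys -> odd_neg u by move=> uys; apply: nys; rewrite inE uys orbT.
  have swap u : act x (act x' u) = - act x' (act x u).
    by rewrite (sm_act_odd _ nx.1 nx'.1) anticomm_odd_neg // sm_act0 addr0.
  rewrite linearD swap; move: xys; rewrite inE => /orP[/eqP xx'|xys].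
    exists 0; first exact: subspace0 (sA ys).
    exists a => //; rewrite add0r; suff -> : act x' (act x b) = 0.
      by rewrite oppr0 addr0 xx'.
    rewrite xx'; have := swap b; rewrite xx' => /eqP.
    by rewrite -addr_eq0 -mulr2n -scaler_nat scaler_eq0 pnatr_eq0 => /eqP.
  exists (act x a); first exact: IH.
  exists (- act x b); first by apply: (subspaceN (sA ys)); apply: IH.
  by rewrite linearN.
have A_fam ys : exists (J : finType) (b : J -> L),
    A ys `<=` span (range b) /\ #|J| = (2 ^ size ys * dim W)%N.
  elim: ys => [|x ys [J [b [Ab cJ]]]].
    have [b [_ bW]] := findimP fW; exists 'I_(dim W), b.
    by split; [rewrite bW|rewrite card_ord mul1n].
  exists (J + J)%type, (fun s => match s with inl j => b j | inr j => act x (b j) end).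
  split; last by rewrite card_sum cJ addnn -mul2n mulnA expnS.
  set S := span _; have sS : subspace S by exact: subspace_span.
  have bS : span (range b) `<=` S.
    by apply: span_mono => _ [j _ <-]; exists (inl j).
  have xbS : span (range b) `<=` act x @^-1` S.
    apply: span_min; first exact: subspace_preim.
    by move=> _ [j _ <-]; apply: sub_span; exists (inr j).
  by move=> _ [a /Ab /bS Sa [b' /Ab /xbS Sb' <-]]; apply: (subspaceD sS).
pose ys := codom y; have nys x : x \in ys -> odd_neg x by move=> /codomP [j ->].
have CA : cyc act odd_neg W `<=` A ys.
  apply: cyc_min => [|x w|]; [exact: sA| |exact: WA].
  rewrite -{1}yneg => xy Aw.
  apply: (act_span subspace_total sm_linear _ (sA ys) _ xy).
    by move=> _ [j _ <-]; apply: sub_total (ny j).1.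
  move=> _ [j _ <-]; apply: A_stable => //; exact: codom_f.
have [J [b [Ab cJ]]] := A_fam ys.
have sC : subspace (cyc act odd_neg W) by exact: subspace_cyc.
have Cb := subset_trans CA Ab.
split; first exact: findim_sub sC Cb (findim_span_fin _).
by apply: leq_trans (dim_le_card sC Cb) _; rewrite cJ size_codom card_ord.
Qed.

End Super.
End OddEigenspaces.

(** * Pairing with the highest weight vector *)

Lemma sum_option (V : nmodType) (I : finType) (F : option I -> V) :
  \sum_i F i = F None + \sum_i F (Some i).
Proof.
rewrite (bigD1 None) //=; congr (_ + _).
rewrite (reindex_omap Some id) => [|[]] //=.
by apply: eq_bigl => i; rewrite eqxx.
Qed.

Section SimpleHighest.
Variables (R : realType) (N : nat) (g E B : set 'M[R[i]]_N) (H : 'M[R[i]]_N).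
Variables (chi : 'M[R[i]]_N -> R[i]).
Hypothesis tri : triangular g E B H.

Lemma rep_lieModule (L : lieModule g) : subspace g ->
  (forall x y, g x -> g y -> g (comm x y)) -> lie_rep g (lm_act L).
Proof.
move=> sg lg; split=> //; first by move=> c x y v; apply: lm_actD.
by move=> x y v; apply: lm_act_bracket.
Qed.

Variables (L : lieModule g) (v : L).
Hypotheses (rep : lie_rep g (lm_act L)) (simpleL : simple_module L).
Hypotheses (v0 : v != 0) (hv : forall b, B b -> lm_act L b v = chi b *: v).

(** The vectors all of whose translates avoid the highest weight line form a
    proper submodule. *)
Lemma simple_nondegenerate (w : L) :
  (forall u, words g u -> negpart (lm_act L) g E v (wact (lm_act L) u w)) -> w = 0.
Proof.
set X := [set w | forall u, words g u -> negpart (lm_act L) g E v (wact (lm_act L) u w)].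
have sK : subspace (negpart (lm_act L) g E v) by exact: subspace_span.
have sX : submodule g (lm_act L) X.
  split; first split=> [u _|a w1 w2 Xw1 Xw2 u gu].
  - by rewrite linear0; apply: subspace0 sK.
  - by rewrite linearP; apply: sK.2; [apply: Xw1|apply: Xw2].
  move=> x w1 gx Xw1 u gu; have := Xw1 (rcons u x).
  rewrite -cats1 wact_cat; apply; apply: words_cat => //.
  by apply: words_cons => //; apply: words_nil.
have [XE|XE] := simpleL.2 X sX => Xw; first by have : X w := Xw; rewrite XE.
case: (highest_notin_negpart rep tri hv v0).
have : X v by rewrite XE.
by move=> /(_ [::] (@words_nil _ _ _)).
Qed.

Variable p : seq 'M[R[i]]_N -> R[i].
Hypothesis pP : forall u, words g u ->
  negpart (lm_act L) g E v (wact (lm_act L) u v - p u *: v).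

Let K_scal c : negpart (lm_act L) g E v (c *: v) -> c = 0.
Proof.
move=> Kc; apply/eqP; apply: contraT => c0.
case: (highest_notin_negpart rep tri hv v0).
have sK : subspace (negpart (lm_act L) g E v) by exact: subspace_span.
by have := subspaceZ c^-1 sK Kc; rewrite scalerA mulVf // scale1r.
Qed.

Let coef_sum (I : finType) (e : I -> R[i]) (u : I -> seq 'M[R[i]]_N) u' :
  (forall i, words g (u i)) -> words g u' ->
  negpart (lm_act L) g E v
    (wact (lm_act L) u' (\sum_i e i *: wact (lm_act L) (u i) v)
     - (\sum_i e i * p (u' ++ u i)) *: v).
Proof.
move=> gu gu'; rewrite linear_sum scaler_suml -sumrB.
apply: (subspace_sum _ (subspace_span _)) => i _.
rewrite linearZ -scalerA -scalerBr; apply: (subspaceZ _ (subspace_span _)).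
by rewrite /= -wact_cat; apply: pP; apply: words_cat.
Qed.

Lemma sum_eq0_coef (I : finType) (e : I -> R[i]) (u : I -> seq 'M[R[i]]_N) :
  (forall i, words g (u i)) ->
  (\sum_i e i *: wact (lm_act L) (u i) v = 0 <->
   forall u', words g u' -> \sum_i e i * p (u' ++ u i) = 0).
Proof.
move=> gu; split=> [s0 u' gu'|s0].
  apply: K_scal; have := coef_sum e gu gu'; rewrite s0 linear0 sub0r => Kc.
  by rewrite -[_ *: v]opprK; apply: (subspaceN (subspace_span _)).
apply: simple_nondegenerate => u' gu'.
by have := coef_sum e gu gu'; rewrite s0 // scale0r subr0.
Qed.

End SimpleHighest.

Lemma word_basis (R : realType) N (g : set 'M[R[i]]_N) (V : lmodType R[i])
    (act : 'M[R[i]]_N -> {linear V -> V}) (v : V) k : lie_rep g act ->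
  exists u : 'I_(dim (Ufilt g act k [set v])) -> seq 'M[R[i]]_N,
    [/\ forall i, word g k (u i), indep (fun i => wact act (u i) v) &
        Ufilt g act k [set v] = span (range (fun i => wact act (u i) v))].
Proof.
move=> rep; have fU : findim (Ufilt g act k [set v]).
  by apply: findim_Ufilt (findim_set1 v); [exact: rep_subspace rep|exact: rep_linear rep].
have [c [_ cU]] := findimP fU.
have [|d [b [Ab fb bU]]] := @basis_from _ _ [set wact act u v | u in word g k] _ c.
  by rewrite cU Ufilt_words; apply: sub_span.
rewrite -Ufilt_words in bU.
have dE : dim (Ufilt g act k [set v]) = d by rewrite (dim_basis fb bU) card_ord.
rewrite dE; have /boolp.choice [u uP] : forall i, exists u, word g k u /\ wact act u v = b i.
  by move=> i; have [u uk ub] := Ab i; exists u.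
have uE : (fun i => wact act (u i) v) = b by apply/funext => i; case: (uP i).
by exists u; rewrite uE bU; split=> // i; case: (uP i).
Qed.

(** * The dimension formula for superalgebras of type I *)

Section GKdimTypeI.
Variables (R : realType) (N N1 N2 : nat) (g : bool -> set 'M[R[i]]_N).
Variables (s1 : set 'M[R[i]]_N1) (s2 : set 'M[R[i]]_N2).
Variables (i1 : {linear 'M[R[i]]_N1 -> 'M[R[i]]_N}).
Variables (i2 : {linear 'M[R[i]]_N2 -> 'M[R[i]]_N}) (z : 'M[R[i]]_N).
Hypothesis tI : typeI g s1 s2 i1 i2 z.

Variables (E1 B1 : set 'M[R[i]]_N1) (H1 : 'M[R[i]]_N1) (chi1 : 'M[R[i]]_N1 -> R[i]).
Variables (E2 B2 : set 'M[R[i]]_N2) (H2 : 'M[R[i]]_N2) (chi2 : 'M[R[i]]_N2 -> R[i]).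
Hypotheses (tri1 : triangular s1 E1 B1 H1) (tri2 : triangular s2 E2 B2 H2).

Variables (L : superModule g) (L1 : lieModule s1) (L2 : lieModule s2).
Variables (v : L) (v1 : L1) (v2 : L2) (a0 : bool) (zeta : R[i]).
Hypotheses (simpleL : graded_simple L) (simpleL1 : simple_module L1).
Hypothesis simpleL2 : simple_module L2.
Hypotheses (v_neq0 : v != 0) (v1_neq0 : v1 != 0) (v2_neq0 : v2 != 0).
Hypotheses (v_part : sm_part a0 v).
Hypothesis v_z : sm_act L z v = zeta *: v.
Hypothesis v_pos : forall x, odd_pos g z x -> sm_act L x v = 0.
Hypothesis v_b1 : forall b, B1 b -> sm_act L (i1 b) v = chi1 b *: v.
Hypothesis v_b2 : forall b, B2 b -> sm_act L (i2 b) v = chi2 b *: v.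
Hypothesis v1_b : forall b, B1 b -> lm_act L1 b v1 = chi1 b *: v1.
Hypothesis v2_b : forall b, B2 b -> lm_act L2 b v2 = chi2 b *: v2.

Let act := sm_act L.
Let act1 x := act (i1 x).
Let act2 x := act (i2 x).
Let T := cyc act (g false) [set v].
Let sT : subspace T. Proof. exact: subspace_cyc. Qed.

Let E := [set i1 y | y in E1] `|` [set i2 y | y in E2].
Let H := i1 H1 + i2 H2.
Let B := [set i1 b | b in B1] `|` [set i2 b | b in B2] `|` [set z] `|` [set H].

Let rep0 : lie_rep (g false) act := rep_even tI L.
Let rep1 : lie_rep s1 (lm_act L1).
Proof. exact: rep_lieModule (tI_sub1 tI) (tI_lie1 tI). Qed.
Let rep2 : lie_rep s2 (lm_act L2).
Proof. exact: rep_lieModule (tI_sub2 tI) (tI_lie2 tI). Qed.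

Let gH : g false H.
Proof.
apply: (subspaceD (tI_sub tI false)).
  by apply: (tI_in1 tI); apply: tri_borel tri1 _ (tri_grading tri1).
by apply: (tI_in2 tI); apply: tri_borel tri2 _ (tri_grading tri2).
Qed.

Let triE : triangular (g false) E B H.
Proof.
split.
- move=> _ [[y Ey <-]|[y Ey <-]].
    by apply: (tI_in1 tI); apply: tri_neg tri1 _ Ey.
  by apply: (tI_in2 tI); apply: tri_neg tri2 _ Ey.
- move=> _ [[[[b Bb <-]|[b Bb <-]]|->]|->] //; last exact: tI_z tI.
    by apply: (tI_in1 tI); apply: tri_borel tri1 _ Bb.
  by apply: (tI_in2 tI); apply: tri_borel tri2 _ Bb.
- move=> _ /(tI_split tI) [a [b [c [s1a s2b ->]]]].
  have sS : subspace (span (E `|` B)) by exact: subspace_span.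
  apply: (subspaceD sS); last first.
    by apply: (subspaceZ _ sS); apply: sub_span; right; left; right.
  apply: (subspaceD sS).
    apply: (span_min (W := i1 @^-1` span (E `|` B)) _ _ (tri_span tri1 s1a)).
      exact: subspace_preim.
    move=> y [Ey|By]; apply: sub_span; first by left; left; exists y.
    by right; left; left; left; exists y.
  apply: (span_min (W := i2 @^-1` span (E `|` B)) _ _ (tri_span tri2 s2b)).
    exact: subspace_preim.
  move=> y [Ey|By]; apply: sub_span; first by left; right; exists y.
  by right; left; left; right; exists y.
- by right.
have sH1 := tri_borel tri1 (tri_grading tri1).
have sH2 := tri_borel tri2 (tri_grading tri2).
move=> _ [[y Ey <-]|[y Ey <-]]; rewrite /H commDl.
  have [j Hy] := tri_degree tri1 Ey; exists j.
  rewrite [comm (i2 H2) _]commNC (tI_comm12 tI) ?oppr0 ?addr0 //.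
    by rewrite -(tI_comm1 tI) Hy linearZ.
  exact: tri_neg tri1 _ Ey.
have [j Hy] := tri_degree tri2 Ey; exists j.
rewrite (tI_comm12 tI) ?add0r //; last exact: tri_neg tri2 _ Ey.
by rewrite -(tI_comm2 tI) Hy linearZ.
Qed.

Let K := negpart act (g false) E v.
Let sK : subspace K. Proof. exact: subspace_span. Qed.

Let v_notin_K : ~ K v.
Proof.
have /boolp.choice [chi chiP] : forall b, exists c, B b -> act b v = c *: v.
  move=> b; have [Bb|nBb] := pselect (B b); last by exists 0 => /nBb.
  case: Bb => [[[[b1 Bb1 <-]|[b2 Bb2 <-]]|->]|->].
  - by exists (chi1 b1); rewrite /act v_b1.
  - by exists (chi2 b2); rewrite /act v_b2.
  - by exists zeta.
  exists (chi1 H1 + chi2 H2) => _; rewrite /H -[i1 H1]scale1r (rep_linear rep0).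
  - rewrite scale1r scalerDl /act v_b1 ?v_b2 //; [exact: tri_grading tri2|exact: tri_grading tri1].
  - by apply: (tI_in1 tI); apply: tri_borel tri1 _ (tri_grading tri1).
  by apply: (tI_in2 tI); apply: tri_borel tri2 _ (tri_grading tri2).
exact: (highest_notin_negpart rep0 triE chiP v_neq0).
Qed.

Let Tv : T v. Proof. exact: sub_cyc. Qed.

Let T_part : T `<=` sm_part a0.
Proof.
apply: cyc_min => [|x w gx pw|_ -> //]; first exact: sm_part_subspace.
exact: (sm_act_part (a := false) gx pw).
Qed.

Let T_pos x w : odd_pos g z x -> T w -> act x w = 0.
Proof.
move=> px Tw; suff : [set w | forall x, odd_pos g z x -> act x w = 0] w by apply.
apply: (cyc_min _ _ _ Tw) => [|y u gy pu|_ ->] //.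
  split=> [y _|a u u' pu pu' y py]; first by rewrite linear0.
  by rewrite linearP /= pu // pu' // scaler0 addr0.
move=> x' px'; have := sm_act_even u gy px'.1.
rewrite -/act (pu x' px') linear0 (pu _ (comm_odd_pos tI gy px')) addr0.
by move/esym.
Qed.

Let T_z w : T w -> act z w = zeta *: w.
Proof.
move=> Tw; suff : [set w | act z w = zeta *: w] w by [].
apply: (cyc_min _ _ _ Tw) => [|y u gy /= zu|_ -> //].
  split=> [|a u u' /= zu zu']; first by rewrite /= linear0 scaler0.
  by rewrite linearP /= zu zu' scalerDr !scalerA mulrC.
rewrite (sm_act_even u (tI_z tI) gy) (tI_central tI gy) (sm_act0 tI) addr0.
by rewrite zu linearZ.
Qed.

(** A vector of [T] all of whose translates lie in [K] generates, over the
    whole superalgebra, a graded submodule whose intersection with [T] still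
    lies in [K]: the exterior part lowers the eigenvalue of [z]. *)
Let T_nondegenerate w : T w ->
  (forall t, words (g false) t -> K (wact act t w)) -> w = 0.
Proof.
move=> Tw Kw; pose X := [set w | T w /\ forall t, words (g false) t -> K (wact act t w)].
have Xw : X w by [].
have sX : subspace X.
  split; first by split=> [|t _]; rewrite ?linear0; [exact: subspace0 sT|exact: subspace0 sK].
  move=> a u u' [Tu Ku] [Tu' Ku']; split; first exact: sT.2.
  by move=> t gt; rewrite linearP; apply: sK.2; [apply: Ku|apply: Ku'].
have X_act y u : g false y -> X u -> X (act y u).
  move=> gy [Tu Ku]; split; first exact: cyc_act.
  move=> t gt; have := Ku (rcons t y); rewrite -cats1 wact_cat; apply.
  by apply: words_cat => //; apply: words_cons => //; apply: words_nil.
pose S := cyc act (odd_neg g z) X; have sS : subspace S by exact: subspace_cyc.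
have S_act x u : total_alg g x -> S u -> S (act x u).
  apply: (odd_cyc_act tI) => // y u' py [Tu' _]; exact: T_pos.
have sp b := @sm_part_subspace _ _ _ L b.
have gradS : graded_submodule S.
  split; first by split.
  move=> u Su; suff : [set u | exists w0 w1,
      [/\ S w0 /\ sm_part false w0, S w1 /\ sm_part true w1 & u = w0 + w1]] u by [].
  apply: (cyc_min _ _ _ Su) => [|y _ ny [w0 [w1 [[Sw0 p0] [Sw1 p1] ->]]]|u' Xu'].
  - split.
      exists 0, 0; rewrite addr0.
      by split=> //; (split; [exact: subspace0 sS|exact: subspace0 (sp _)]).
    move=> a _ _ [w0 [w1 [[Sw0 p0] [Sw1 p1] ->]]] [x0 [x1 [[Sx0 q0] [Sx1 q1] ->]]].
    exists (a *: w0 + x0), (a *: w1 + x1); rewrite scalerDr addrACA.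
    by split=> //; (split; [apply: sS.2|apply: (sp _).2]).
  - exists (act y w1), (act y w0); rewrite linearD addrC; split=> //.
      split; first exact: cyc_act.
      exact: (sm_act_part (a := true) (b := true) ny.1).
    split; first exact: cyc_act.
    exact: (sm_act_part (a := true) (b := false) ny.1).
  have pu' := T_part Xu'.1; have Su' : S u' by exact: sub_cyc.
  case: (a0) pu' => pu'.
    exists 0, u'; rewrite add0r; split=> //.
    by split; [exact: subspace0 sS|exact: subspace0 (sp _)].
  exists u', 0; rewrite addr0; split=> //.
  by split; [exact: subspace0 sS|exact: subspace0 (sp _)].
have [SE|SE] := simpleL.2 S gradS.
  by have : S w by [exact: sub_cyc]; rewrite SE.
have Sv : S v by rewrite SE.
have sl : subspace (lower (act z) zeta) by exact: subspace_span.
have lowS : S `<=` [set x + l | x in X & l in lower (act z) zeta].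
  apply: cyc_min => [|y _ ny [x Xx [l ll <-]]|x Xx].
  - exact: subspace_add.
  - have deg u : act z (act y u) = act y (act z u) - (0%N).+1%:R *: act y u.
      by rewrite (sm_act_even _ (tI_z tI) ny.1) ny.2 (sm_actN tI) ?scale1r //; apply: sub_total tI _ _ ny.1.
    exists 0; first exact: subspace0 sX.
    exists (act y (x + l)); rewrite ?add0r // linearD; apply: (subspaceD sl).
      by apply: (lower_eigen_act deg); apply: T_z Xx.1.
    exact: lower_act deg ll.
  by exists x => //; exists 0; [exact: subspace0 sl|rewrite addr0].
have [x [Tx Kx] [l ll xl]] := lowS v Sv.
have l0 : l = 0.
  apply: (lower_eigen ll); have -> : l = v - x by rewrite -xl addrC addKr.
  by rewrite linearB /= T_z // T_z // scalerBr.
case: v_notin_K; rewrite -xl l0 addr0.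
exact: (Kx [::] (@words_nil _ _ _)).
Qed.

Let act12 x y w : s1 x -> s2 y -> act1 x (act2 y w) = act2 y (act1 x w).
Proof.
move=> s1x s2y; rewrite /act1 /act2.
rewrite (sm_act_even w (tI_in1 tI s1x) (tI_in2 tI s2y)) (tI_comm12 tI) //.
by rewrite (sm_act0 tI) addr0.
Qed.

Let wact12 u w x : words s1 u -> words s2 w ->
  wact act1 u (wact act2 w x) = wact act2 w (wact act1 u x).
Proof.
elim: u => [//|a u IH] /words_consP [s1a s1u] s2w /=; rewrite IH //.
elim: w s2w {IH} => [//|b w IH] /words_consP [s2b s2w] /=.
by rewrite act12 // IH.
Qed.

Let T_act1 x w : s1 x -> T w -> T (act1 x w).
Proof. by move=> s1x; apply: cyc_act; apply: tI_in1 tI _ s1x. Qed.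

Let T_act2 x w : s2 x -> T w -> T (act2 x w).
Proof. by move=> s2x; apply: cyc_act; apply: tI_in2 tI _ s2x. Qed.

Let T_wact1 u w : words s1 u -> T w -> T (wact act1 u w).
Proof. by apply: words_stable => x t; apply: T_act1. Qed.

Let T_wact2 u w : words s2 u -> T w -> T (wact act2 u w).
Proof. by apply: words_stable => x t; apply: T_act2. Qed.

(** As [z] acts on [T] by a scalar, translates by [s1] and [s2] suffice. *)
Let T_nondegenerate12 w : T w ->
  (forall u t, words s1 u -> words s2 t -> K (wact act1 u (wact act2 t w))) -> w = 0.
Proof.
move=> Tw Kw; apply: T_nondegenerate => // t gt.
pose D := span [set wact act1 u x | u in words s1 &
                  x in [set wact act2 t w | t in words s2]].
have sD : subspace D by exact: subspace_span.
suff DK : D (wact act t w).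
  by apply: (span_min sK _ DK) => _ [u s1u [_ [t' s2t' <-] <-]]; apply: Kw.
elim: t gt => [_|y t IH /words_consP [gy gt]] /=.
  by apply: sub_span; exists [::] => //; exists w => //; exists [::].
apply: (span_min (W := act y @^-1` D) _ _ (IH gt)); first exact: subspace_preim.
move=> _ [u s1u [_ [t' s2t' <-] <-]]; rewrite /preimage /=.
have [a [b [c [s1a s2b ->]]]] := tI_split tI gy.
have gab : g false (i1 a + i2 b).
  by apply: (subspaceD (tI_sub tI false)); [apply: tI_in1 tI _ _|apply: tI_in2 tI _ _].
rewrite addrC (rep_linear rep0) //; last exact: tI_z tI.
have Tut : T (wact act1 u (wact act2 t' w)) by apply: T_wact1 => //; apply: T_wact2.
apply: (subspaceD sD).
  apply: (subspaceZ _ sD); rewrite T_z //; apply: (subspaceZ _ sD).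
  by apply: sub_span; exists u => //; exists (wact act2 t' w) => //; exists t'.
rewrite -[i1 a]scale1r (rep_linear rep0) ?scale1r; [|exact: tI_in1 tI _ s1a|exact: tI_in2 tI _ s2b].
apply: (subspaceD sD); apply: sub_span.
  exists (a :: u); first exact: words_cons.
  by exists (wact act2 t' w) => //; exists t'.
exists u => //; exists (wact act2 (b :: t') w); first by exists (b :: t') => //; apply: words_cons.
by rewrite wact12 //=; [rewrite -wact12|apply: words_cons].
Qed.

Let repL1 : lie_rep s1 act1.
Proof.
split; [exact: tI_sub1 tI|exact: tI_lie1 tI| |].
  move=> c x y w s1x s1y; rewrite /act1 linearP (rep_linear rep0) //.
    exact: tI_in1 tI _ s1x.
  exact: tI_in1 tI _ s1y.
move=> x y w s1x s1y; rewrite /act1 (tI_comm1 tI) (rep_comm rep0) //.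
  exact: tI_in1 tI _ s1x.
exact: tI_in1 tI _ s1y.
Qed.

Let repL2 : lie_rep s2 act2.
Proof.
split; [exact: tI_sub2 tI|exact: tI_lie2 tI| |].
  move=> c x y w s2x s2y; rewrite /act2 linearP (rep_linear rep0) //.
    exact: tI_in2 tI _ s2x.
  exact: tI_in2 tI _ s2y.
move=> x y w s2x s2y; rewrite /act2 (tI_comm2 tI) (rep_comm rep0) //.
  exact: tI_in2 tI _ s2x.
exact: tI_in2 tI _ s2y.
Qed.

Let coef1 : exists p, forall u, words s1 u ->
  negpart (lm_act L1) s1 E1 v1 (wact (lm_act L1) u v1 - p u *: v1) /\
  negpart act1 s1 E1 v (wact act1 u v - p u *: v).
Proof.
suff /boolp.choice [p pP] : forall u, exists c, words s1 u ->
    negpart (lm_act L1) s1 E1 v1 (wact (lm_act L1) u v1 - c *: v1) /\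
    negpart act1 s1 E1 v (wact act1 u v - c *: v) by exists p.
move=> u; have [su|nsu] := pselect (words s1 u); last by exists 0.
by have [c cP] := universal_coef rep1 repL1 tri1 v1_b v_b1 su; exists c.
Qed.

Let coef2 : exists p, forall u, words s2 u ->
  negpart (lm_act L2) s2 E2 v2 (wact (lm_act L2) u v2 - p u *: v2) /\
  negpart act2 s2 E2 v (wact act2 u v - p u *: v).
Proof.
suff /boolp.choice [p pP] : forall u, exists c, words s2 u ->
    negpart (lm_act L2) s2 E2 v2 (wact (lm_act L2) u v2 - c *: v2) /\
    negpart act2 s2 E2 v (wact act2 u v - c *: v) by exists p.
move=> u; have [su|nsu] := pselect (words s2 u); last by exists 0.
by have [c cP] := universal_coef rep2 repL2 tri2 v2_b v_b2 su; exists c.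
Qed.

Let cyc1_T : cyc act1 s1 [set v] `<=` T.
Proof. apply: cyc_min => [|x w|_ ->] //; exact: T_act1. Qed.

Let cyc2_T : cyc act2 s2 [set v] `<=` T.
Proof. apply: cyc_min => [|x w|_ ->] //; exact: T_act2. Qed.

Let K_neg1 w x : words s2 w -> negpart act1 s1 E1 v x -> K (wact act2 w x).
Proof.
move=> s2w; apply: (span_min (W := wact act2 w @^-1` K)); first exact: subspace_preim.
move=> _ [y Ey [t /cyc1_T Tt <-]]; rewrite /preimage /=.
have s1y := tri_neg tri1 Ey.
have -> : wact act2 w (act1 y t) = act1 y (wact act2 w t).
  rewrite -[act1 y t]/(wact act1 [:: y] t) -wact12 //.
  by apply: words_cons => //; apply: words_nil.
apply: sub_span; exists (i1 y); first by left; exists y.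
by exists (wact act2 w t) => //; apply: T_wact2.
Qed.

Let K_neg2 : negpart act2 s2 E2 v `<=` K.
Proof.
apply: span_min => // _ [y Ey [t /cyc2_T Tt <-]]; apply: sub_span.
by exists (i2 y); [right; exists y|exists t].
Qed.

Let Tk k := span [set wact act1 u x | u in word s1 k &
                    x in [set wact act2 t v | t in word s2 k]].
Let d1 k := dim (Ufilt s1 (lm_act L1) k [set v1]).
Let d2 k := dim (Ufilt s2 (lm_act L2) k [set v2]).

Let K_scal c : K (c *: v) -> c = 0.
Proof.
move=> Kc; apply/eqP; apply: contraT => c0; case: v_notin_K.
by have := subspaceZ c^-1 sK Kc; rewrite scalerA mulVf // scale1r.
Qed.

(** Modulo [K], the coefficient of the highest weight vector is multiplicative
    over the two factors, so that the Gram matrix of [Tk k] is the Kronecker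
    product of those of the two filtrations. *)
Let dim_Tk k : dim (Tk k) = (d1 k * d2 k)%N.
Proof.
have [p1 p1P] := coef1; have [p2 p2P] := coef2.
have p1L u s1u := (p1P u s1u).1; have p2L u s2u := (p2P u s2u).1.
(* The words in [s2] commute with those in [s1] and preserve [K]. *)
have key u w : words s1 u -> words s2 w ->
    K (wact act1 u (wact act2 w v) - (p1 u * p2 w) *: v).
  move=> s1u s2w; have K1 := K_neg1 s2w (p1P u s1u).2.
  have K2 := K_neg2 (p2P w s2w).2.
  rewrite wact12 // -scalerA -[wact act2 w _](subrK (p1 u *: wact act2 w v)) -addrA -scalerBr.
  apply: (subspaceD sK); last exact: (subspaceZ _ sK).
  by move: K1; rewrite linearB linearZ.
have [u [uk findep uE]] := word_basis v1 k rep1.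
have [w [wk gindep wE]] := word_basis v2 k rep2.
have s1u i : words s1 (u i) := word_words (uk i).
have s2w j : words s2 (w j) := word_words (wk j).
pose fam ij := wact act1 (u ij.1) (wact act2 (w ij.2) v).
have fam_T ij : T (fam ij) by apply: T_wact1 => //; apply: T_wact2.
have gram u' w' u0 w0 : words s1 u' -> words s2 w' -> words s1 u0 -> words s2 w0 ->
    K (wact act1 u' (wact act2 w' (wact act1 u0 (wact act2 w0 v)))
       - (p1 (u' ++ u0) * p2 (w' ++ w0)) *: v).
  move=> su' sw' su0 sw0; rewrite -[wact act2 w' _]wact12 // -!wact_cat.
  by apply: key; apply: words_cat.
have gram_sum u' w' (c : _ -> R[i]) : words s1 u' -> words s2 w' ->
    K (wact act1 u' (wact act2 w' (\sum_ij c ij *: fam ij))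
       - (\sum_ij c ij * (p1 (u' ++ u ij.1) * p2 (w' ++ w ij.2))) *: v).
  move=> su' sw'.
  have -> : wact act1 u' (wact act2 w' (\sum_ij c ij *: fam ij)) =
      \sum_ij c ij *: wact act1 u' (wact act2 w' (fam ij)).
    by rewrite !linear_sum; apply: eq_bigr => ij _; rewrite !linearZ.
  rewrite scaler_suml -sumrB.
  apply: (subspace_sum _ sK) => ij _.
  rewrite -scalerA -scalerBr.
  by apply: (subspaceZ _ sK); apply: gram.
have fam_indep : indep fam.
  move=> c c0 [i j].
  have E0 u' w' : words s1 u' -> words s2 w' ->
      \sum_ij c ij * (p1 (u' ++ u ij.1) * p2 (w' ++ w ij.2)) = 0.
    move=> su' sw'; apply: K_scal; have := gram_sum u' w' c su' sw'.
    rewrite c0 !linear0 sub0r => Kc.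
    by rewrite -[_ *: v]opprK; apply: (subspaceN sK).
  apply: (gindep (fun j => c (i, j))).
  apply/(sum_eq0_coef tri2 rep2 simpleL2 v2_neq0 v2_b p2L) => // w' sw'.
  apply: (findep (fun i => \sum_j c (i, j) * p2 (w' ++ w j))).
  apply/(sum_eq0_coef tri1 rep1 simpleL1 v1_neq0 v1_b p1L) => // u' su'.
  rewrite -[RHS](E0 u' w' su' sw').
  transitivity (\sum_i \sum_j c (i, j) * (p1 (u' ++ u i) * p2 (w' ++ w j))).
    apply: eq_bigr => i' _; rewrite mulr_suml; apply: eq_bigr => j' _.
    by rewrite -mulrA; congr (_ * _); rewrite mulrC.
  by rewrite pair_bigA; apply: eq_bigr => -[].
have fam_span : span (range fam) = Tk k.
  apply/seteqP; split.
    apply: span_mono => _ [ij _ <-]; exists (u ij.1) => //.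
    by exists (wact act2 (w ij.2) v) => //; exists (w ij.2).
  apply: span_min; first exact: subspace_span.
  move=> _ [u0 uk0 [_ [w0 wk0 <-] <-]].
  have su0 := word_words uk0; have sw0 := word_words wk0.
  have /span_rangeP [a aE] : span (range (fun i => wact (lm_act L1) (u i) v1))
      (wact (lm_act L1) u0 v1).
    by rewrite -uE Ufilt_words; apply: sub_span; exists u0.
  have /span_rangeP [b bE] : span (range (fun i => wact (lm_act L2) (w i) v2))
      (wact (lm_act L2) w0 v2).
    by rewrite -wE Ufilt_words; apply: sub_span; exists w0.
  have p1E u' : words s1 u' -> p1 (u' ++ u0) = \sum_i a i * p1 (u' ++ u i).
    (* [u0] joins the family as one more index with coefficient -1. *)
    pose u1 i := if i is Some i then u i else u0.
    pose a1 i := if i is Some i then a i else -1.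
    have su1 i : words s1 (u1 i) by case: i.
    have : \sum_i a1 i *: wact (lm_act L1) (u1 i) v1 = 0.
      by rewrite sum_option /= scaleN1r aE addNr.
    move/(sum_eq0_coef tri1 rep1 simpleL1 v1_neq0 v1_b p1L _ su1) => e0 su'.
    by have := e0 _ su'; rewrite sum_option /= mulN1r => /eqP; rewrite addrC subr_eq0 => /eqP.
  have p2E w' : words s2 w' -> p2 (w' ++ w0) = \sum_j b j * p2 (w' ++ w j).
    pose w1 j := if j is Some j then w j else w0.
    pose b1 j := if j is Some j then b j else -1.
    have sw1 j : words s2 (w1 j) by case: j.
    have : \sum_j b1 j *: wact (lm_act L2) (w1 j) v2 = 0.
      by rewrite sum_option /= scaleN1r bE addNr.
    move/(sum_eq0_coef tri2 rep2 simpleL2 v2_neq0 v2_b p2L _ sw1) => e0 sw'.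
    by have := e0 _ sw'; rewrite sum_option /= mulN1r => /eqP; rewrite addrC subr_eq0 => /eqP.
  apply/span_rangeP; exists (fun ij => a ij.1 * b ij.2).
  apply/eqP; rewrite -subr_eq0; apply/eqP; apply: T_nondegenerate12.
    apply: (subspaceB sT); first by apply: T_wact1 => //; apply: T_wact2.
    by apply: (subspace_sum _ sT) => ij _; apply: (subspaceZ _ sT).
  move=> u' w' su' sw'.
  have Ks := gram_sum u' w' (fun ij => a ij.1 * b ij.2) su' sw'.
  have := subspaceB sK (gram u' w' u0 w0 su' sw' su0 sw0) Ks.
  suff -> : \sum_ij a ij.1 * b ij.2 * (p1 (u' ++ u ij.1) * p2 (w' ++ w ij.2))
      = p1 (u' ++ u0) * p2 (w' ++ w0).
    by rewrite opprB addrA subrK !linearB.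
  rewrite p1E // p2E // big_distrlr /= pair_bigA /=.
  by apply: eq_bigr => ij _; rewrite mulrACA.
by rewrite (dim_basis fam_indep fam_span) card_prod !card_ord.
Qed.

Let Uk k := Ufilt (total_alg g) act k [set v].

Let Tk_Uk k : Tk k `<=` Uk (k + k).
Proof.
apply: span_min; first exact: subspace_Ufilt.
have stepU (M : nat) (j : {linear 'M[R[i]]_M -> 'M[R[i]]_N}) (s : set 'M[R[i]]_M) n l t x :
    (forall y, s y -> g false (j y)) -> word s n t -> Uk l x ->
    Uk (n + l) (wact (fun y => act (j y)) t x).
  move=> sg [tn st] Ux; apply: (@Ufilt_le _ _ _ _ _ (size t + l)); first by rewrite leq_add2r.
  elim: t st {tn} => [_|y t IH /words_consP [sy st]]; first exact: Ux.
  rewrite addSn; apply: (Ufilt_act (k := size t + l)); last exact: IH.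
  by apply: sub_total tI _ _ (sg _ sy).
move=> _ [u su [_ [t st <-] <-]].
apply: (stepU _ _ _ _ _ _ _ _ su); first exact: tI_in1 tI.
rewrite -[k]addn0; apply: (stepU _ _ _ _ _ _ _ _ st); first exact: tI_in2 tI.
exact: sub_Ufilt.
Qed.

Let Tk_le k l : (k <= l)%N -> Tk k `<=` Tk l.
Proof.
move=> kl; apply: span_mono => _ [u su [_ [t st <-] <-]].
exists u; first exact: word_le su.
by exists (wact act2 t v) => //; exists t => //; apply: word_le st.
Qed.

Let Tk_T k : Tk k `<=` T.
Proof.
apply: span_min => // _ [u su [_ [t st <-] <-]].
by apply: T_wact1; [exact: word_words su|apply: T_wact2 => //; exact: word_words st].
Qed.

(** Odd negative elements do not increase the index [k], so that the step for
    the superalgebra exceeds [Tk k] by a bounded factor only. *)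
Let Uk_Tk k : Uk k `<=` cyc act (odd_neg g z) (Tk k).
Proof.
elim: k => [|k IH].
  apply: span_min; first exact: subspace_cyc.
  move=> _ ->; apply: sub_cyc; apply: sub_span; exists [::]; first exact: word_nil.
  by exists v => //; exists [::] => //; apply: word_nil.
have sS : subspace (cyc act (odd_neg g z) (Tk k.+1)) by exact: subspace_cyc.
apply: span_min => // x [/IH|[y gy [w /IH Uw <-]]].
  by apply: cyc_sub => //; apply: Tk_le.
apply: (odd_cyc_act tI _ _ _ gy Uw).
- exact: Tk_le.
- move=> {gy Uw} {}y {}w gy Tw; have sT1 : subspace (Tk k.+1) by exact: subspace_span.
  apply: (span_min (W := act y @^-1` Tk k.+1) _ _ Tw); first exact: subspace_preim.
  move=> _ [u su [_ [t st <-] <-]]; rewrite /preimage /=.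
  have ws1 := word_words su; have ws2 := word_words st.
  have [a [b [c [s1a s2b ->]]]] := tI_split tI gy.
  have gab : g false (i1 a + i2 b).
    by apply: (subspaceD (tI_sub tI false)); [apply: tI_in1 tI _ _|apply: tI_in2 tI _ _].
  rewrite addrC (rep_linear rep0) //; last exact: tI_z tI.
  apply: (subspaceD sT1).
    apply: (subspaceZ _ sT1); rewrite T_z; last by apply: T_wact1 => //; apply: T_wact2.
    apply: (subspaceZ _ sT1); apply: (Tk_le (leqnSn k)).
    by apply: sub_span; exists u => //; exists (wact act2 t v) => //; exists t.
  rewrite -[i1 a]scale1r (rep_linear rep0) ?scale1r; [|exact: tI_in1 tI _ s1a|exact: tI_in2 tI _ s2b].
  apply: (subspaceD sT1); apply: sub_span.
    exists (a :: u); first exact: word_cons.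
    by exists (wact act2 t v) => //; exists t => //; apply: word_le st.
  exists u; first exact: word_le su.
  exists (wact act2 (b :: t) v); first by exists (b :: t) => //; apply: word_cons.
  by rewrite wact12 //=; [rewrite -wact12|apply: words_cons].
by move=> {gy Uw} {}y {}w py /Tk_T; apply: T_pos.
Qed.

(** The product [d1 k * d2 k] and the dimension of [Uk k] bound each other up to
    a constant factor and a doubling of [k]. *)
Theorem GKdim_typeI (M : set L) (M1 : set L1) (M2 : set L2) :
  generates (total_alg g) act [set v] ->
  generates s1 (lm_act L1) [set v1] -> generates s2 (lm_act L2) [set v2] ->
  generating_subspace (total_alg g) act M ->
  generating_subspace s1 (lm_act L1) M1 -> generating_subspace s2 (lm_act L2) M2 ->
  (GKdim (total_alg g) act M
   = GKdim s1 (lm_act L1) M1 + GKdim s2 (lm_act L2) M2)%E.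
Proof.
move=> genv genv1 genv2 genM genM1 genM2.
rewrite (GKdim_growth (subspace_total tI) (sm_linear (L := L)) v_neq0 genM genv).
rewrite (GKdim_growth (tI_sub1 tI) (rep_linear rep1) v1_neq0 genM1 genv1).
rewrite (GKdim_growth (tI_sub2 tI) (rep_linear rep2) v2_neq0 genM2 genv2).
have fUk k : findim (Uk k).
  exact: (findim_Ufilt (subspace_total tI) (sm_linear (L := L)) k (findim_set1 v)).
have Uk_gt0 k : (0 < dim (Uk k))%N by apply: dim_gt0 v_neq0 => //; apply: sub_Ufilt.
have d1_gt0 k : (0 < d1 k)%N.
  apply: dim_gt0 v1_neq0; last exact: sub_Ufilt.
  exact: (findim_Ufilt (tI_sub1 tI) (rep_linear rep1) k (findim_set1 v1)).
have d2_gt0 k : (0 < d2 k)%N.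
  apply: dim_gt0 v2_neq0; last exact: sub_Ufilt.
  exact: (findim_Ufilt (tI_sub2 tI) (rep_linear rep2) k (findim_set1 v2)).
have [d [c dcP]] := cyclic_growth rep1 v1_neq0.
rewrite -(@growth_mul _ d1 d2 d c) //; [|by move=> k /dcP []|by move=> k /dcP []].
have sTk k : subspace (Tk k) by exact: subspace_span.
have fTk k : findim (Tk k) by apply: findim_sub (Tk_Uk (k := k)) (fUk _).
have d12_gt0 k : (0 < d1 k * d2 k)%N by rewrite muln_gt0 d1_gt0 d2_gt0.
have [D DP] := dim_odd_cyc tI L.
apply/eqP; rewrite eq_le; apply/andP; split.
  apply: (@growth_le _ _ _ 1 (2 ^ D)) => // [|k _]; first by rewrite expn_gt0.
  have [fS dS] := DP _ (sTk k) (fTk k).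
  rewrite mul1n -dim_Tk; apply: leq_trans dS; apply: dim_le (Uk_Tk (k := k)) fS.
  exact: subspace_Ufilt.
apply: (@growth_le _ _ _ 2 1) => // k _.
by rewrite mul1n mul2n -addnn -dim_Tk; apply: dim_le (Tk_Uk (k := k)) (fUk _).
Qed.

End GKdimTypeI.

(** * Highest weights for concrete Lie algebras of matrices *)

Section Diagonal.
Variables (R : realType) (N : nat).
Implicit Types (t x : 'M[R[i]]_N) (g P : set 'M[R[i]]_N).

Lemma comm_diag t x i j : is_diag_mx t -> comm t x i j = (t i i - t j j) * x i j.
Proof.
move=> /is_diag_mxP dt; rewrite /comm !mxE mulrBl [t j j * _]mulrC.
congr (_ - _); first by rewrite (bigD1 i) //= big1 ?addr0 // => k ki; rewrite dt ?mul0r // eq_sym.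
by rewrite (bigD1 j) //= big1 ?addr0 // => k kj; rewrite dt ?mulr0.
Qed.

(** Tests membership on the matrix units that occur in [x]. *)
Lemma subspace_lift (V : lmodType R[i]) (S : set V) (f : {linear 'M[R[i]]_N -> V}) x :
  subspace S -> (forall i j, x i j != 0 -> S (f (delta_mx i j))) -> S (f x).
Proof.
move=> sS Sf; rewrite [x]matrix_sum_delta linear_sum.
apply: (subspace_sum _ sS) => i _; rewrite linear_sum.
apply: (subspace_sum _ sS) => j _.
have -> : f (x i j *: delta_mx i j) = x i j *: f (delta_mx i j) by rewrite linearZ.
have [->|xij] := eqVneq (x i j) 0; first by rewrite scale0r; apply: subspace0 sS.
exact: subspaceZ _ sS (Sf _ _ xij).
Qed.

Definition negative g H : set 'M[R[i]]_N :=
  [set x | g x /\ exists j : nat, comm H x = - j.+1%:R *: x].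

(** The character of the Borel subalgebra: the highest weight on the Cartan
    subalgebra, zero on the positive root vectors. *)
Definition borel_char g (Lambda : 'M[R[i]]_N -> R[i]) b : R[i] :=
  if pselect (cartan g b) then Lambda b else 0.

Lemma triangular_cartan g P H :
  P `<=` g -> cartan g H -> g `<=` span (negative g H `|` (cartan g `|` P)) ->
  triangular g (negative g H) (cartan g `|` P) H.
Proof.
move=> Pg cH gS; split=> //; first by move=> x [].
- by move=> x [[]|/Pg].
- by left.
by move=> y [_].
Qed.

Lemma borel_charP g P (V : lmodType R[i]) (act : 'M[R[i]]_N -> {linear V -> V})
    (Lambda : 'M[R[i]]_N -> R[i]) (v : V) :
  (forall t, cartan g t -> act t v = Lambda t *: v) ->
  (forall x, P x -> act x v = 0) ->
  forall b, (cartan g `|` P) b -> act b v = borel_char g Lambda b *: v.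
Proof.
move=> hc hP b; rewrite /borel_char; case: pselect => [cb _|ncb [//|/hP ->]].
  exact: hc.
by rewrite scale0r.
Qed.

End Diagonal.

Section Blocks.
Variables (R : realType) (p q : nat).
Implicit Types (x : 'M[R[i]]_p) (y : 'M[R[i]]_q) (w : 'M[R[i]]_(p + q)).

Definition ul_embed x : 'M[R[i]]_(p + q) := block_mx x 0 0 0.
Definition dr_embed y : 'M[R[i]]_(p + q) := block_mx 0 0 0 y.

Lemma ul_embed_linear : linear ul_embed.
Proof. by move=> a x x'; rewrite /ul_embed scale_block_mx add_block_mx !scaler0 !addr0. Qed.

Lemma dr_embed_linear : linear dr_embed.
Proof. by move=> a x x'; rewrite /dr_embed scale_block_mx add_block_mx !scaler0 !addr0. Qed.

HB.instance Definition _ :=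
  GRing.isLinear.Build R[i] 'M[R[i]]_p 'M[R[i]]_(p + q) *:%R ul_embed ul_embed_linear.
HB.instance Definition _ :=
  GRing.isLinear.Build R[i] 'M[R[i]]_q 'M[R[i]]_(p + q) *:%R dr_embed dr_embed_linear.

Lemma comm_ul_embed x x' : ul_embed (comm x x') = comm (ul_embed x) (ul_embed x').
Proof.
rewrite /comm /ul_embed !mulmx_block !(mulmx0, mul0mx, addr0) opp_block_mx add_block_mx.
by rewrite !(oppr0, addr0).
Qed.

Lemma comm_dr_embed y y' : dr_embed (comm y y') = comm (dr_embed y) (dr_embed y').
Proof.
rewrite /comm /dr_embed !mulmx_block !(mulmx0, mul0mx, add0r) opp_block_mx add_block_mx.
by rewrite !(oppr0, addr0).
Qed.

Lemma comm_ul_dr x y : comm (ul_embed x) (dr_embed y) = 0.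
Proof.
rewrite /comm /ul_embed /dr_embed !mulmx_block !(mulmx0, mul0mx, addr0).
by rewrite subrr.
Qed.

Lemma comm_block_dr x y y' : comm (block_mx x 0 0 y) (dr_embed y') = dr_embed (comm y y').
Proof.
rewrite /comm /dr_embed !mulmx_block !(mulmx0, mul0mx, add0r) opp_block_mx add_block_mx.
by rewrite !(oppr0, addr0).
Qed.

Lemma parity_lshift (i : 'I_p) : parity (lshift q i) = false.
Proof. by rewrite /parity /= leqNgt ltn_ord. Qed.

Lemma parity_rshift (i : 'I_q) : parity (rshift p i) = true.
Proof. by rewrite /parity /= leq_addr. Qed.

Lemma gl_super_block a x y (u : 'M[R[i]]_(p, q)) (d : 'M[R[i]]_(q, p)) :
  gl_super a (block_mx x u d y) <-> if a then x = 0 /\ y = 0 else u = 0 /\ d = 0.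
Proof.
split=> [gw|].
  have ulE i j := gw (lshift q i) (lshift q j).
  have urE i j := gw (lshift q i) (rshift p j).
  have dlE i j := gw (rshift p i) (lshift q j).
  have drE i j := gw (rshift p i) (rshift p j).
  case: a ulE urE dlE drE {gw} => ulE urE dlE drE; split; apply/matrixP => i j.
  - by have := ulE i j; rewrite block_mxEul !parity_lshift mxE; apply.
  - by have := drE i j; rewrite block_mxEdr !parity_rshift mxE; apply.
  - by have := urE i j; rewrite block_mxEur parity_lshift parity_rshift mxE; apply.
  by have := dlE i j; rewrite block_mxEdl parity_lshift parity_rshift mxE; apply.
move=> aE i j; case: (split_ordP i) => i' ->; case: (split_ordP j) => j' ->;
  rewrite ?parity_lshift ?parity_rshift ?block_mxEul ?block_mxEur ?block_mxEdl
    ?block_mxEdr; case: a aE => -[e1 e2] // _; by rewrite ?e1 ?e2 mxE.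
Qed.

Lemma gl_super_even w : gl_super false w -> w = block_mx (ulsubmx w) 0 0 (drsubmx w).
Proof. by rewrite -{1}[w]submxK => /gl_super_block [ur0 dl0]; rewrite -[LHS]submxK ur0 dl0. Qed.

Lemma subspace_gl_super a : subspace (@gl_super R p q a).
Proof.
split=> [i j _|c w w' gw gw' i j ij]; first by rewrite mxE.
by rewrite !mxE gw // gw' // mulr0 addr0.
Qed.

Lemma gl_superM a b w w' : gl_super a w -> gl_super b w' ->
  gl_super (a (+) b) (w *m w').
Proof.
move=> gw gw' i j ij; rewrite mxE big1 // => k _.
have [ik|ik] := eqVneq (parity i (+) parity k) a; last by rewrite gw // mul0r.
rewrite gw' ?mulr0 //; apply: contra ij => /eqP <-; rewrite -ik.
by case: (parity i); case: (parity j); case: (parity k).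
Qed.

Lemma gl_super_lie a b w w' : gl_super a w -> gl_super b w' ->
  gl_super (a (+) b) (w *m w' - (-1) ^+ (a && b) *: (w' *m w)).
Proof.
move=> gw gw'; have sG := subspace_gl_super (a (+) b).
apply: (subspaceB sG); first exact: gl_superM.
by apply: (subspaceZ _ sG); rewrite addbC; apply: gl_superM.
Qed.

Lemma supertraceM a b w w' : gl_super a w -> gl_super b w' ->
  supertrace (w *m w') = (-1) ^+ (a && b) * supertrace (w' *m w).
Proof.
move=> gw gw'; rewrite /supertrace mulr_sumr.
under eq_bigr => k _ do rewrite mxE mulr_sumr.
rewrite exchange_big /=; apply: eq_bigr => k _.
rewrite mxE !mulr_sumr; apply: eq_bigr => i _.
have [ik|ik] := eqVneq (parity i (+) parity k) a; last by rewrite gw // !(mul0r, mulr0).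
have [ki|ki] := eqVneq (parity k (+) parity i) b; last by rewrite gw' // !(mul0r, mulr0).
rewrite -ik -ki; case: (parity i); case: (parity k);
  by rewrite /= ?expr0 ?expr1 ?mul1r ?mulN1r ?opprK mulrC.
Qed.

Lemma supertraceP c w w' : supertrace (c *: w + w') = c * supertrace w + supertrace w'.
Proof.
rewrite /supertrace mulr_sumr -big_split; apply: eq_bigr => i _ /=.
by rewrite !mxE mulrDr mulrCA.
Qed.

Lemma supertrace_block x y : supertrace (block_mx x 0 0 y) = \tr x - \tr y.
Proof.
rewrite /supertrace big_split_ord /=; congr (_ + _).
  by apply: eq_bigr => i _; rewrite parity_lshift block_mxEul mul1r.
rewrite -sumrN; apply: eq_bigr => i _.
by rewrite parity_rshift block_mxEdr expr1 mulN1r.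
Qed.

End Blocks.

(** * The superalgebras [sl(m|n)] *)

Section SpecialLinearPart.
Variables (R : realType) (m : nat).

Lemma subspace_sl : subspace (sl R m).
Proof.
split=> [|a x y /= tx ty]; first by rewrite /sl /= mxtrace0.
by rewrite /sl /= mxtraceD mxtraceZ tx ty mulr0 addr0.
Qed.

Lemma sl_comm x y : sl R m x -> sl R m y -> sl R m (comm x y).
Proof.
by move=> _ _; rewrite /sl /comm /= raddfB /= mxtrace_mulC subrr.
Qed.

(** The half-sum of the positive coroots, multiplied by [m] to make its entries
    integers. *)
Definition sl_grading : 'M[R[i]]_m :=
  diag_mx (\row_i (\sum_(k < m) k%:R - m%:R * i%:R)).

Definition sl_positive : set 'M[R[i]]_m :=
  [set x | exists k l : 'I_m, (k < l)%N /\ x = delta_mx k l].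

Lemma sl_delta_mx (k l : 'I_m) : k != l -> sl R m (delta_mx k l).
Proof.
move=> kl; rewrite /sl /= /mxtrace big1 // => j _; rewrite mxE.
by have [jk|//] := eqVneq j k; rewrite jk (negPf kl).
Qed.

Lemma sl_grading_cartan : cartan (sl R m) sl_grading.
Proof.
split; last exact: diag_mx_is_diag.
rewrite /sl /= mxtrace_diag; under eq_bigr => j _ do rewrite mxE.
by rewrite sumrB sumr_const card_ord -mulr_sumr -[X in X - _]mulr_natl subrr.
Qed.

Lemma comm_diag_delta (t : 'M[R[i]]_m) k l : is_diag_mx t ->
  comm t (delta_mx k l) = (t k k - t l l) *: delta_mx k l.
Proof.
move=> dt; apply/matrixP => i j; rewrite comm_diag // !mxE.
by case: eqP => [->|_]; case: eqP => [->|_]; rewrite ?mulr0.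
Qed.

Lemma sl_triangular : triangular (sl R m) (negative (sl R m) sl_grading)
  (cartan (sl R m) `|` sl_positive) sl_grading.
Proof.
apply: triangular_cartan; last 2 first.
- exact: sl_grading_cartan.
- set S := span _ => x slx; have sS : subspace S by exact: subspace_span.
  pose d := diag_mx (\row_i x i i) : 'M[R[i]]_m.
  have -> : x = d + (x - d) by rewrite addrC subrK.
  apply: (subspaceD sS).
    apply: sub_span; right; left; split; last exact: diag_mx_is_diag.
    have trx : \tr x = 0 := slx; rewrite /sl /= mxtrace_diag -[RHS]trx; apply: eq_bigr => i _; by rewrite mxE.
  apply: (subspace_lift (f := idfun : {linear 'M[R[i]]_m -> 'M[R[i]]_m}) sS) => k l.
  rewrite !mxE; have [->|kl _] := eqVneq k l; first by rewrite mulr1n subrr eqxx.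
  apply: sub_span; have [ltkl|] := ltnP k l; first by right; right; exists k, l.
  rewrite leq_eqVlt eq_sym (inj_eq val_inj) (negPf kl) /= => ltlk; left.
  split; first exact: sl_delta_mx.
  exists (m * (k - l)).-1; rewrite prednK ?muln_gt0 ?subn_gt0 ?ltlk ?andbT; last first.
    exact: leq_ltn_trans (leq0n l) (ltn_ord l).
  rewrite comm_diag_delta ?diag_mx_is_diag // /sl_grading !mxE !eqxx !mulr1n; congr (_ *: _).
  rewrite natrM natrB; last exact: ltnW.
  by ring.
move=> _ [k [l [kl ->]]]; apply: sl_delta_mx.
by apply: contraTneq kl => ->; rewrite ltnn.
Qed.

Lemma sl_positive_nilradical : sl_positive `<=` nilradical (sl R m) (sl_roots R m).
Proof.
move=> _ [k [l [kl ->]]]; apply: sub_span.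
exists (diag_coord k \- diag_coord l); first by exists k, l.
split=> [|t [_ dt]]; last exact: comm_diag_delta.
by apply: sl_delta_mx; apply: contraTneq kl => ->; rewrite ltnn.
Qed.

End SpecialLinearPart.

Section SuperSpecialLinear.
Variables (R : realType) (m n : nat).
Hypotheses (m0 : (0 < m)%N) (n0 : (0 < n)%N) (mn : m <> n).

Let mR : (m%:R : R[i]) != 0. Proof. by rewrite pnatr_eq0 -lt0n. Qed.
Let nR : (n%:R : R[i]) != 0. Proof. by rewrite pnatr_eq0 -lt0n. Qed.
Let nmR : (n%:R - m%:R : R[i]) != 0.
Proof. by rewrite subr_eq0 eqr_nat; apply/eqP => /esym. Qed.

Let za : R[i] := n%:R / (n%:R - m%:R).
Let zb : R[i] := m%:R / (n%:R - m%:R).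
Let zbn : zb * n%:R = za * m%:R.
Proof. by rewrite /za /zb mulrAC [RHS]mulrAC [m%:R * _]mulrC. Qed.
Let zab : za - zb = 1. Proof. by rewrite -mulrBl divff. Qed.

(** The generator of the centre of the even part; it has supertrace zero and
    acts nontrivially on the odd part because [m] and [n] differ. *)
Definition sl_center : 'M[R[i]]_(m + n) := block_mx za%:M 0 0 zb%:M.

Let sl_center_diag : is_diag_mx sl_center.
Proof.
apply/is_diag_mxP => i j; case: (split_ordP i) => i' ->; case: (split_ordP j) => j' ->;
  rewrite ?block_mxEul ?block_mxEur ?block_mxEdl ?block_mxEdr mxE //= => ij.
  by rewrite (_ : (i' == j') = false) //; apply: contra_neqF ij => /eqP ->.
by rewrite (_ : (i' == j') = false) //; apply: contra_neqF ij => /eqP ->.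
Qed.

Let sl_centerE (i : 'I_(m + n)) : sl_center i i = if parity i then zb else za.
Proof.
case: (split_ordP i) => i' ->; rewrite ?parity_lshift ?parity_rshift;
  by rewrite ?block_mxEul ?block_mxEdr mxE eqxx.
Qed.

Lemma subspace_sl_super a : subspace (sl_super R m n a).
Proof.
have sG := @subspace_gl_super R m n a; split.
  split; first exact: subspace0 sG.
  by rewrite /supertrace big1 // => i _; rewrite mxE mulr0.
move=> c x y [gx sx] [gy sy]; split; first exact: sG.2.
by rewrite supertraceP sx sy mulr0 addr0.
Qed.

Lemma sl_super_lie a b x y : sl_super R m n a x -> sl_super R m n b y ->
  sl_super R m n (a (+) b) (x *m y - (-1) ^+ (a && b) *: (y *m x)).
Proof.
move=> [gx _] [gy _]; split; first exact: gl_super_lie.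
by rewrite addrC -scaleNr supertraceP (supertraceM gx gy) mulNr addNr.
Qed.

Lemma sl_typeI : typeI (sl_super R m n) (sl R m) (sl R n)
  (@ul_embed R m n) (@dr_embed R m n) sl_center.
Proof.
split.
- exact: subspace_sl_super.
- exact: sl_super_lie.
- exact: subspace_sl.
- exact: sl_comm.
- exact: subspace_sl.
- exact: sl_comm.
- split; first by apply/gl_super_block.
  by rewrite supertrace_block !mxtrace_scalar -[za *+ m]mulr_natr -[zb *+ n]mulr_natr zbn subrr.
- move=> x [gx _]; apply/matrixP => i j; rewrite comm_diag // [RHS]mxE !sl_centerE.
  have [ij|ij] := boolP (parity i (+) parity j); first by rewrite gx ?mulr0 // eqbF_neg negbK.
  have -> : parity i = parity j by case: (parity i) (parity j) ij => -[].
  by rewrite subrr mul0r.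
- move=> x [gx _]; apply/matrixP => i j; rewrite !comm_diag // !sl_centerE.
  have [ij|ij] := boolP (parity i (+) parity j); last by rewrite gx ?mulr0 // eqb_id.
  case: (parity i) (parity j) ij => -[] // _; last by rewrite zab !mul1r.
  by rewrite -opprB zab !mulN1r opprK.
- move=> x slx; split; first by apply/gl_super_block.
  by rewrite supertrace_block slx mxtrace0 subrr.
- move=> x slx; split; first by apply/gl_super_block.
  by rewrite supertrace_block slx mxtrace0 subrr.
- exact: comm_ul_embed.
- exact: comm_dr_embed.
- by move=> x y _ _; apply: comm_ul_dr.
move=> x [/gl_super_even -> ]; set a := ulsubmx x; set b := drsubmx x.
rewrite supertrace_block => /eqP; rewrite subr_eq0 => /eqP trab.
pose c := \tr a / (za * m%:R).
have zm : za * m%:R != 0 by rewrite !mulf_neq0 // invr_eq0.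
exists (a - (c * za)%:M), (b - (c * zb)%:M), c; split.
- by rewrite /sl /= raddfB /= mxtrace_scalar -[_ *+ m]mulr_natr -mulrA divfK // subrr.
- by rewrite /sl /= raddfB /= mxtrace_scalar -[_ *+ n]mulr_natr -mulrA zbn divfK // trab subrr.
rewrite /ul_embed /dr_embed /sl_center scale_block_mx !add_block_mx !scaler0 !addr0 add0r.
by rewrite !scale_scalar_mx !subrK.
Qed.

Lemma sl_odd_pos_nilradical x : odd_pos (sl_super R m n) sl_center x ->
  super_nilradical (sl_super R m n) (sl_super_roots R m n) x.
Proof.
move=> [[gx _] zx]; set S := super_nilradical _ _.
have sS : subspace S by exact: subspace_span.
apply: (subspace_lift (f := idfun : {linear 'M[R[i]]_(m + n) -> _}) sS) => i j xij.
have ij : parity i (+) parity j by apply: contraNT xij => /negbTE ij; rewrite gx ?ij.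
have : comm sl_center x i j = x i j by rewrite zx.
rewrite comm_diag // !sl_centerE; move: ij xij.
case: (split_ordP i) => k ->; case: (split_ordP j) => l ->; rewrite ?parity_lshift ?parity_rshift //= => _ xij;
  last first.
  rewrite -[zb - za]opprB zab mulN1r => /eqP.
  by rewrite eq_sym -addr_eq0 -mulr2n -mulr_natr mulf_eq0 pnatr_eq0 orbF => /eqP e0; rewrite e0 eqxx in xij.
move=> _; apply: sub_span; exists true => //; exists (sl_eps k \- sl_delta l); first by exists k, l.
split; last by move=> t [_ dt]; exact: comm_diag_delta.
split.
  move=> i' j'; rewrite mxE.
  have [->|//] := eqVneq i' (lshift n k); have [->|] := eqVneq j' (rshift m l).
    by rewrite parity_lshift parity_rshift.
  by rewrite andbF.
rewrite /supertrace big1 // => i' _; rewrite mxE.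
have [->|_] := eqVneq i' (lshift n k); last by rewrite mulr0.
by rewrite eq_lrshift mulr0.
Qed.

Let nilrad := super_nilradical (sl_super R m n) (sl_super_roots R m n).

Let ul_delta (k l : 'I_m) :
  ul_embed n (delta_mx k l : 'M[R[i]]_m) = delta_mx (lshift n k) (lshift n l).
Proof.
apply/matrixP => i j; case: (split_ordP i) => i' ->; case: (split_ordP j) => j' ->;
  by rewrite ?block_mxEul ?block_mxEur ?block_mxEdl ?block_mxEdr !mxE
    ?eq_lshift ?eq_rlshift ?andbF.
Qed.

Let dr_delta (k l : 'I_n) :
  dr_embed m (delta_mx k l : 'M[R[i]]_n) = delta_mx (rshift m k) (rshift m l).
Proof.
apply/matrixP => i j; case: (split_ordP i) => i' ->; case: (split_ordP j) => j' ->;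
  by rewrite ?block_mxEul ?block_mxEur ?block_mxEdl ?block_mxEdr !mxE
    ?eq_rshift ?eq_lrshift ?andbF.
Qed.

Lemma sl_positive_ul x : sl_positive x -> nilrad (ul_embed n x).
Proof.
move=> [k [l [kl ->]]]; have slkl : sl R m (delta_mx k l).
  by apply: sl_delta_mx; apply: contraTneq kl => ->; rewrite ltnn.
apply: sub_span; exists false => //; exists (sl_eps k \- sl_eps l).
  by left; exists k, l.
split=> [|t [_ dt]]; first exact: tI_in1 sl_typeI _ slkl.
by rewrite ul_delta; apply: comm_diag_delta.
Qed.

Lemma sl_positive_dr x : sl_positive x -> nilrad (dr_embed m x).
Proof.
move=> [k [l [kl ->]]]; have slkl : sl R n (delta_mx k l).
  by apply: sl_delta_mx; apply: contraTneq kl => ->; rewrite ltnn.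
apply: sub_span; exists false => //; exists (sl_delta k \- sl_delta l).
  by right; exists k, l.
split=> [|t [_ dt]]; first exact: tI_in2 sl_typeI _ slkl.
by rewrite dr_delta; apply: comm_diag_delta.
Qed.

Theorem GKdim_sl (lambda : 'I_m -> R[i]) (mu : 'I_n -> R[i])
    (L : superModule (sl_super R m n)) (L1 : lieModule (sl R m)) (L2 : lieModule (sl R n)) :
  super_simple_highest_weight (sl_super_roots R m n) (sl_super_weight lambda mu) L ->
  simple_highest_weight (sl_roots R m) (sl_weight lambda) L1 ->
  simple_highest_weight (sl_roots R n) (sl_weight mu) L2 ->
  forall (M : set L) (M1 : set L1) (M2 : set L2),
  generating_subspace (total_alg (sl_super R m n)) (sm_act L) M ->
  generating_subspace (sl R m) (lm_act L1) M1 ->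
  generating_subspace (sl R n) (lm_act L2) M2 ->
  (GKdim (total_alg (sl_super R m n)) (sm_act L) M
   = GKdim (sl R m) (lm_act L1) M1 + GKdim (sl R n) (lm_act L2) M2)%E.
Proof.
move=> [simpleL [v [[a pv] [v0 vh vn] genv]]] [simpleL1 [v1 [[v10 v1h v1n] genv1]]].
move=> [simpleL2 [v2 [[v20 v2h v2n] genv2]]] M M1 M2 genM genM1 genM2.
have cartan_ul t : cartan (sl R m) t -> cartan (sl_super R m n false) (ul_embed n t).
  move=> [slt dt]; split; first exact: tI_in1 sl_typeI _ slt.
  by rewrite /ul_embed is_diag_block_mx // dt !eqxx /= mx0_is_diag.
have cartan_dr t : cartan (sl R n) t -> cartan (sl_super R m n false) (dr_embed m t).
  move=> [slt dt]; split; first exact: tI_in2 sl_typeI _ slt.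
  by rewrite /dr_embed is_diag_block_mx // dt !eqxx /= mx0_is_diag.
have weight_ul t : sl_super_weight lambda mu (ul_embed n t) = sl_weight lambda t.
  rewrite /sl_super_weight [X in _ + X]big1 ?addr0 => [|k _].
    by apply: eq_bigr => k _; rewrite /sl_eps /diag_coord block_mxEul.
  by rewrite /sl_delta /diag_coord block_mxEdr mxE mulr0.
have weight_dr t : sl_super_weight lambda mu (dr_embed m t) = sl_weight mu t.
  rewrite /sl_super_weight [X in X + _]big1 ?add0r => [|k _].
    by apply: eq_bigr => k _; rewrite /sl_delta /diag_coord block_mxEdr.
  by rewrite /sl_eps /diag_coord block_mxEul mxE mulr0.
apply: (GKdim_typeI sl_typeI (@sl_triangular R m) (@sl_triangular R n)
  (chi1 := borel_char (sl R m) (sl_weight lambda))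
  (chi2 := borel_char (sl R n) (sl_weight mu))
  simpleL simpleL1 simpleL2 v0 v10 v20 pv
  (zeta := sl_super_weight lambda mu sl_center)) => //.
- by apply: vh; split=> //; exact: tI_z sl_typeI.
- by move=> x /sl_odd_pos_nilradical; apply: vn.
- apply: (borel_charP (act := fun x => sm_act L (ul_embed n x))) => [t ct|x px].
    by rewrite vh ?weight_ul //; apply: cartan_ul.
  exact: vn (sl_positive_ul px).
- apply: (borel_charP (act := fun x => sm_act L (dr_embed m x))) => [t ct|x px].
    by rewrite vh ?weight_dr //; apply: cartan_dr.
  exact: vn (sl_positive_dr px).
- by apply: borel_charP => // x /sl_positive_nilradical; apply: v1n.
by apply: borel_charP => // x /sl_positive_nilradical; apply: v2n.
Qed.

End SuperSpecialLinear.

(** * The superalgebras [osp(2|2n)] *)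

Section Forms.
Variables (R : realType) (N : nat) (B : 'M[R[i]]_N).
Implicit Types t x : 'M[R[i]]_N.

Lemma subspace_form_alg : subspace (form_alg B).
Proof.
split=> [|a x y /= fx fy]; first by rewrite /form_alg /= trmx0 mul0mx mulmx0 addr0.
rewrite /form_alg /= linearP /= mulmxDl mulmxDr -scalemxAl -scalemxAr.
by rewrite addrACA -scalerDr fx fy scaler0 addr0.
Qed.

Lemma form_alg_comm x y : form_alg B x -> form_alg B y -> form_alg B (comm x y).
Proof.
move=> /eqP + /eqP; rewrite !addr_eq0 => /eqP fx /eqP fy.
rewrite /form_alg /comm /= linearB /= !trmx_mul mulmxBl mulmxBr.
rewrite -[y^T *m x^T *m B]mulmxA -[x^T *m y^T *m B]mulmxA fx fy !mulmxN !mulmxA fx fy.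
by rewrite !mulNmx !opprK addrC addrA subrK subrr.
Qed.

Lemma form_alg_torus t a b : is_diag_mx t -> form_alg B t -> (t a a + t b b) * B a b = 0.
Proof.
move=> /is_diag_mxP dt /(congr1 (fun M : 'M[R[i]]_N => M a b)); rewrite !mxE.
rewrite (bigD1 a) //= big1 => [|k ka]; last by rewrite mxE dt ?mul0r.
rewrite (bigD1 b) //= big1 => [|k kb]; last by rewrite dt ?mulr0.
by rewrite !addr0 mxE mulrDl [B a b * _]mulrC.
Qed.

Lemma diag_form_alg (d : 'rV[R[i]]_N) :
  (forall a b, (d 0 a + d 0 b) * B a b = 0) -> form_alg B (diag_mx d).
Proof.
move=> dB; apply/matrixP => a b; rewrite tr_diag_mx mul_diag_mx mul_mx_diag !mxE.
by rewrite [B a b * _]mulrC -mulrDl dB.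
Qed.

(** For the sign [c] dictated by form and parity, twice the projection of a matrix
    onto the algebra of the form. *)
Definition fold_form (c : R[i]) x : 'M[R[i]]_N := x + c *: (B *m x^T *m B).

Lemma fold_form_linear c : linear (fold_form c).
Proof.
move=> a x y; rewrite /fold_form linearP /= mulmxDr mulmxDl -scalemxAr -scalemxAl.
by rewrite !scalerDr !scalerA [c * a]mulrC addrACA.
Qed.

HB.instance Definition _ c :=
  GRing.isLinear.Build R[i] 'M[R[i]]_N 'M[R[i]]_N *:%R (fold_form c) (fold_form_linear c).

(** Folding preserves weights for the diagonal torus of the form, because the
    form pairs only opposite weights. *)
Lemma comm_fold_form c t k l : is_diag_mx t -> form_alg B t ->
  comm t (fold_form c (delta_mx k l)) = (t k k - t l l) *: fold_form c (delta_mx k l).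
Proof.
move=> dt ft; have sandwich a b : (B *m (delta_mx k l)^T *m B) a b = B a l * B k b.
  rewrite mxE (bigD1 k) //= big1 => [|j jk]; last first.
    rewrite mxE big1 ?mul0r // => i _; by rewrite !mxE (negPf jk) ?mulr0.
  rewrite addr0 mxE (bigD1 l) //= big1 ?addr0 => [|j jl]; last first.
    by rewrite !mxE (negPf jl) andbF mulr0.
  by rewrite !mxE !eqxx mulr1.
apply/matrixP => a b; rewrite comm_diag // [RHS]mxE.
have -> : fold_form c (delta_mx k l) a b = delta_mx k l a b + c * (B a l * B k b).
  by rewrite /fold_form mxE [X in _ + X]mxE sandwich.
rewrite !mulrDr; congr (_ + _).
  by rewrite mxE; case: eqP => [->|_]; case: eqP => [->|_]; rewrite ?mulr0.
have tal := form_alg_torus a l dt ft; have tkb := form_alg_torus k b dt ft.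
rewrite mulrCA [RHS]mulrCA; congr (_ * _).
have -> : t a a = (t a a + t l l) - t l l by rewrite addrK.
have -> : t b b = (t k k + t b b) - t k k by rewrite [t k k + _]addrC addrK.
have E (x y z w p q : R[i]) : x * p = 0 -> y * q = 0 ->
    (x - z - (y - w)) * (p * q) = (w - z) * (p * q).
  move=> xp yq; have -> : (x - z - (y - w)) * (p * q) =
    (x * p) * q - p * (y * q) + (w - z) * (p * q) by ring.
  by rewrite xp yq mul0r mulr0 subr0 add0r.
by rewrite E.
Qed.

End Forms.

Lemma split_lshift p q (k : 'I_p) : fintype.split (lshift q k) = inl k.
Proof. exact: unsplitK (inl k). Qed.

Lemma split_rshift p q (k : 'I_q) : fintype.split (rshift p k) = inr k.
Proof. exact: unsplitK (inr k). Qed.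

Section Symplectic.
Variables (R : realType) (n : nat).

Lemma sp_formE (a b : 'I_(n + n)) : sp_form R n a b =
  match fintype.split a, fintype.split b with
  | inl k, inr l => (k == l)%:R
  | inr k, inl l => - (k == l)%:R
  | _, _ => 0
  end.
Proof.
rewrite /sp_form; case: (split_ordP a) => k ->; case: (split_ordP b) => l ->.
- by rewrite block_mxEul mxE.
- by rewrite block_mxEur mxE.
- by rewrite block_mxEdl !mxE.
by rewrite block_mxEdr mxE.
Qed.

Lemma sp_form_sqr : sp_form R n *m sp_form R n = - 1%:M.
Proof.
rewrite /sp_form mulmx_block !mul0mx !mulmx0 !mul1mx !mulmx1 !addr0 !add0r.
by rewrite scalar_mx_block opp_block_mx !oppr0.
Qed.

Lemma sp_form_tr : (sp_form R n)^T = - sp_form R n.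
Proof.
by rewrite /sp_form tr_block_mx opp_block_mx !trmx0 !linearN /= !trmx1 !oppr0 opprK.
Qed.

Lemma fold_sp x : sp R n (fold_form (sp_form R n) 1 x).
Proof.
set B := sp_form R n; have BB : B *m B = - 1%:M := sp_form_sqr.
have foldT : (fold_form B 1 x)^T = x^T + B *m x *m B.
  rewrite /fold_form scale1r linearD /= !trmx_mul trmxK sp_form_tr.
  by rewrite !mulNmx !mulmxN opprK mulmxA.
rewrite /sp /form_alg /= foldT /fold_form scale1r mulmxDl mulmxDr.
rewrite -[B *m x *m B *m B]mulmxA BB mulmxN mulmx1 !mulmxA BB !mulNmx mul1mx.
by rewrite addrA subrK subrr.
Qed.

Lemma fold_sp_id x : sp R n x -> fold_form (sp_form R n) 1 x = 2 *: x.
Proof.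
move=> /eqP; rewrite addr_eq0 => /eqP fx; rewrite /fold_form scale1r -mulmxA fx.
by rewrite mulmxN mulmxA sp_form_sqr mulNmx mul1mx opprK scaler_nat mulr2n.
Qed.

Lemma sp_torus t k : cartan (sp R n) t -> t (rshift n k) (rshift n k) = - sp_delta k t.
Proof.
move=> [spt dt]; have := form_alg_torus (lshift n k) (rshift n k) dt spt.
rewrite sp_formE split_lshift split_rshift eqxx mulr1 => /eqP.
by rewrite addrC addr_eq0 => /eqP.
Qed.

(** The coordinates of a principal grading element: they are pairwise distinct,
    so that only diagonal matrices commute with it, and a root is positive
    exactly when it takes a positive value there. *)
Definition sp_height (a : 'I_(n + n)) : int :=
  match fintype.split a with inl k => (n - k)%N%:Z | inr k => - (n - k)%N%:Z end.

Definition sp_grading : 'M[R[i]]_(n + n) := diag_mx (\row_a (sp_height a)%:~R).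

Lemma sp_height_inj : injective sp_height.
Proof.
move=> a b; rewrite /sp_height; case: (split_ordP a) => k ->; case: (split_ordP b) => l ->.
- move=> kl; congr lshift; apply: val_inj => /=; have := ltn_ord k; have := ltn_ord l; lia.
- have := ltn_ord k; have := ltn_ord l; lia.
- have := ltn_ord k; have := ltn_ord l; lia.
move=> kl; congr rshift; apply: val_inj => /=; have := ltn_ord k; have := ltn_ord l; lia.
Qed.

Lemma sp_grading_cartan : cartan (sp R n) sp_grading.
Proof.
split; last exact: diag_mx_is_diag.
apply: diag_form_alg => a b; rewrite sp_formE !mxE /sp_height.
case: (fintype.split a) => k; case: (fintype.split b) => l; rewrite ?mulr0 //.
  by have [->|_] := eqVneq k l; rewrite ?mulr0 // mulrNz subrr mul0r.
by have [->|_] := eqVneq k l; rewrite ?oppr0 ?mulr0 // mulrNz addNr mul0r.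
Qed.

Definition sp_positive : set 'M[R[i]]_(n + n) :=
  \bigcup_(alpha in sp_roots R n) root_space (sp R n) (cartan (sp R n)) alpha.

Lemma sp_positive_root (a b : 'I_(n + n)) : (sp_height b < sp_height a)%R ->
  exists2 alpha, sp_roots R n alpha &
    forall t, cartan (sp R n) t -> t a a - t b b = alpha t.
Proof.
rewrite /sp_height; case: (split_ordP a) => k ->; case: (split_ordP b) => l ->.
- move=> kl; exists (sp_delta k \- sp_delta l) => //.
  by left; exists k, l; split; [lia|left].
- move=> _; case: (ltngtP k l) => kl.
  + exists (sp_delta k \+ sp_delta l); first by left; exists k, l; split; [|right].
    by move=> t ct; rewrite sp_torus // opprK.
  + exists (sp_delta l \+ sp_delta k); first by left; exists l, k; split; [|right].
    by move=> t ct; rewrite sp_torus // opprK addrC.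
  exists (sp_delta k \+ sp_delta k); first by right; exists k.
  by move=> t ct; rewrite sp_torus // opprK (val_inj kl).
- by have := ltn_ord k; have := ltn_ord l; lia.
move=> kl; exists (sp_delta l \- sp_delta k).
  by left; exists l, k; split; [have := ltn_ord k; have := ltn_ord l; lia|left].
by move=> t ct; rewrite !sp_torus // opprK addrC.
Qed.

Lemma sp_triangular : triangular (sp R n) (negative (sp R n) sp_grading)
  (cartan (sp R n) `|` sp_positive) sp_grading.
Proof.
have [spH dH] := sp_grading_cartan.
apply: triangular_cartan; last 2 first.
- exact: sp_grading_cartan.
- set S := span _ => x spx; have sS : subspace S by exact: subspace_span.
  have -> : x = fold_form (sp_form R n) 1 (2^-1 *: x).
    by rewrite linearZ /= fold_sp_id // scalerA mulVf ?scale1r // pnatr_eq0.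
  apply: (@subspace_lift _ _ _ S (fold_form (sp_form R n) 1) (2^-1 *: x) sS) => a b _.
  pose y := fold_form (sp_form R n) 1 (delta_mx a b); suff : S y by [].
  have spy : sp R n y by exact: fold_sp.
  have wt t : cartan (sp R n) t -> comm t y = (t a a - t b b) *: y.
    by move=> [spt dt]; apply: comm_fold_form.
  apply: sub_span; case: (ltgtP (sp_height a) (sp_height b)) => ab.
  + left; split => //; exists (`|sp_height b - sp_height a|.-1)%N.
    rewrite wt; last exact: sp_grading_cartan.
    congr (_ *: _); rewrite !mxE !eqxx !mulr1n -rmorphB /=.
    rewrite -[_%:R]/((_%:Z)%:~R) -rmorphN; congr (_%:~R); lia.
  + right; right; have [alpha ralpha alphaE] := sp_positive_root ab.
    exists alpha => //; split=> // t ct; rewrite -alphaE //; exact: wt.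
  right; left; split=> //; apply/is_diag_mxP => c d cd.
  have := wt _ sp_grading_cartan; rewrite (sp_height_inj ab) subrr scale0r.
  move=> /(congr1 (fun M : 'M[R[i]]_(n + n) => M c d)); rewrite comm_diag // !mxE !eqxx !mulr1n.
  move=> /eqP; rewrite mulf_eq0 subr_eq0 eqr_int (inj_eq sp_height_inj).
  by rewrite -(inj_eq val_inj) (negPf cd) => /eqP.
by move=> x [alpha _ []].
Qed.

Lemma sp_positive_nilradical : sp_positive `<=` nilradical (sp R n) (sp_roots R n).
Proof. exact: sub_span. Qed.

End Symplectic.

Section So2.
Variable R : realType.

Lemma so2P (x : 'M[R[i]]_2) : so2 R x ->
  is_diag_mx x.
Proof.
move=> sx; apply/is_diag_mxP.
have E i j : (x^T *m so2_form R + so2_form R *m x) i j = 0 by rewrite sx mxE.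
have E00 := E ord0 ord0; have E11 := E ord_max ord_max.
move: E00 E11; rewrite !mxE !big_ord_recl !big_ord0 !mxE /=.
rewrite !(mulr0, mul0r, mulr1, mul1r, addr0, add0r) => E00 E11 i j.
have half (c : R[i]) : c + c = 0 -> c = 0.
  by rewrite -mulr2n -mulr_natr => /eqP; rewrite mulf_eq0 pnatr_eq0 orbF => /eqP.
have x10 : x ord_max ord0 = 0.
  by apply: half; rewrite -[RHS]E00; congr (x _ _ + x _ _); apply: val_inj.
have x01 : x ord0 ord_max = 0.
  by apply: half; rewrite -[RHS]E11; congr (x _ _ + x _ _); apply: val_inj.
case: i => -[|[|//]] ilt; case: j => -[|[|//]] jlt //= _.
  by rewrite -[RHS]x01; congr (x _ _); apply: val_inj.
by rewrite -[RHS]x10; congr (x _ _); apply: val_inj.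
Qed.

Definition so2_gen : 'M[R[i]]_2 := diag_mx (\row_i (-1) ^+ i).

Lemma so2_gen_so2 : so2 R so2_gen.
Proof.
apply: diag_form_alg => a b; rewrite !mxE.
by case: a => -[|[|//]] ?; case: b => -[|[|//]] ? /=;
  rewrite ?mulr0 // expr0 expr1 ?subrr ?addNr mul0r.
Qed.

Lemma so2_triangular : triangular (so2 R) (negative (so2 R) 0)
  (cartan (so2 R) `|` set0) 0.
Proof.
apply: triangular_cartan => //.
  by split; [exact: subspace0 (subspace_form_alg _)|exact: mx0_is_diag].
by move=> x sx; apply: sub_span; right; left; split=> //; apply: so2P.
Qed.

End So2.

Section SuperForms.
Variables (R : realType) (p q : nat) (B : 'M[R[i]]_(p + q)).
Implicit Types x y : 'M[R[i]]_(p + q).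

(** The signs of the form condition: the identity for even elements and the
    parity operator for odd ones. *)
Definition form_sign (a : bool) : 'M[R[i]]_(p + q) :=
  diag_mx (\row_i (-1) ^+ (a && parity i)).

Lemma form_sign_even : form_sign false = 1%:M.
Proof.
by rewrite /form_sign -diag_const_mx; congr diag_mx; apply/rowP => j; rewrite !mxE.
Qed.

Lemma form_signM a b : form_sign a *m form_sign b = form_sign (a (+) b).
Proof.
rewrite /form_sign mulmx_diag; congr diag_mx; apply/rowP => j; rewrite !mxE.
by case: a; case: b; case: (parity j); rewrite /= ?mulr1 ?mul1r // mulrNN mulr1.
Qed.

Lemma form_sign_comm a b x : gl_super a x ->
  form_sign b *m x = (-1) ^+ (a && b) *: (x *m form_sign b).
Proof.
move=> gx; apply/matrixP => i j; rewrite mul_diag_mx mul_mx_diag !mxE.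
have [ij|ij] := eqVneq (parity i (+) parity j) a; last by rewrite gx // !(mul0r, mulr0).
rewrite -ij; case: b; case: (parity i); case: (parity j);
  by rewrite /= ?expr0 ?expr1 ?mul1r ?mulr1 ?mulN1r ?mulrN1 ?opprK.
Qed.

Lemma gl_super_tr a x : gl_super a x -> gl_super a x^T.
Proof. by move=> gx i j; rewrite addbC mxE; apply: gx. Qed.

Lemma osp_formP a x : osp_form B a x <->
  gl_super a x /\ x^T *m B + form_sign a *m B *m x = 0.
Proof.
have sE i j : (form_sign a *m B *m x) i j = (-1) ^+ (a && parity i) * (B *m x) i j.
  by rewrite -mulmxA mul_diag_mx mxE [X in X * _]mxE.
split=> -[gx bx]; split=> //.
  by apply/matrixP => i j; rewrite mxE sE [RHS]mxE; apply: bx.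
move=> i j; have /(congr1 (fun M : 'M[R[i]]_(p + q) => M i j)) := bx.
by rewrite mxE sE [RHS]mxE.
Qed.

Lemma subspace_osp_form a : subspace (osp_form B a).
Proof.
have sG := @subspace_gl_super R p q a; split.
  apply/osp_formP; split; first exact: subspace0 sG.
  by rewrite trmx0 mul0mx mulmx0 addr0.
move=> c x y /osp_formP [gx bx] /osp_formP [gy yx]; apply/osp_formP.
split; first exact: sG.2.
rewrite linearP /= mulmxDl mulmxDr -scalemxAl -scalemxAr addrACA -scalerDr bx yx.
by rewrite scaler0 addr0.
Qed.

Lemma osp_form_lie a b x y : gl_super false B ->
  osp_form B a x -> osp_form B b y ->
  osp_form B (a (+) b) (x *m y - (-1) ^+ (a && b) *: (y *m x)).
Proof.
move=> gB /osp_formP [gx /eqP] + /osp_formP [gy /eqP]; rewrite !addr_eq0 => /eqP bx /eqP yx.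
apply/osp_formP; split; first exact: gl_super_lie.
have BP c : form_sign c *m B = B *m form_sign c.
  by rewrite (form_sign_comm c gB) scale1r.
set e := (-1) ^+ (a && b); have ee : e * e = 1 by rewrite /e -expr2 sqrr_sign.
have xP : x^T *m form_sign b = e *: (form_sign b *m x^T).
  by rewrite (form_sign_comm b (gl_super_tr gx)) scalerA ee scale1r.
have yP : y^T *m form_sign a = e *: (form_sign a *m y^T).
  by rewrite (form_sign_comm a (gl_super_tr gy)) andbC -/e scalerA ee scale1r.
have xyB : y^T *m x^T *m B = e *: (form_sign (a (+) b) *m B *m y *m x).
  rewrite -mulmxA bx mulmxN !mulmxA yP -!scalemxAl -[_ *m y^T *m B]mulmxA yx.
  by rewrite mulmxN !mulmxA form_signM !mulNmx scalerN opprK.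
have yxB : x^T *m y^T *m B = e *: (form_sign (a (+) b) *m B *m x *m y).
  rewrite -mulmxA yx mulmxN !mulmxA xP -!scalemxAl -[_ *m x^T *m B]mulmxA bx.
  by rewrite mulmxN !mulmxA form_signM addbC !mulNmx scalerN opprK.
rewrite linearB linearZ /= !trmx_mul mulmxBl -scalemxAl xyB yxB scalerA ee scale1r.
by rewrite mulmxBr -scalemxAr !mulmxA addrC addrA subrK subrr.
Qed.

End SuperForms.

Section OrthoSymplectic.
Variables (R : realType) (n : nat).

Let B : 'M[R[i]]_(2 + (n + n)) := block_mx (so2_form R) 0 0 (sp_form R n).
Let P : 'M[R[i]]_(2 + (n + n)) := form_sign R 2 (n + n) true.

Let gB : gl_super false B. Proof. exact/gl_super_block. Qed.

Let PE : P = block_mx 1%:M 0 0 (- 1%:M).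
Proof.
apply/matrixP => i j; rewrite /P /form_sign.
case: (split_ordP i) => k ->; case: (split_ordP j) => l ->;
  rewrite ?block_mxEul ?block_mxEur ?block_mxEdl ?block_mxEdr !mxE
    ?parity_lshift ?parity_rshift ?eq_lshift ?eq_rshift ?eq_lrshift ?eq_rlshift //=.
by rewrite expr1 mulNrn.
Qed.

Let so2_form_sqr : so2_form R *m so2_form R = 1%:M.
Proof.
apply/matrixP => i j; rewrite !mxE !big_ord_recl big_ord0 !mxE.
by case: i => -[|[|//]] ?; case: j => -[|[|//]] ?; rewrite /= ?(mulr0, mulr1, addr0, add0r).
Qed.

Let so2_form_tr : (so2_form R)^T = so2_form R.
Proof. by apply/matrixP => i j; rewrite !mxE eq_sym. Qed.

Let BB : B *m B = P.
Proof.
rewrite /B mulmx_block !mul0mx !mulmx0 !addr0 !add0r so2_form_sqr sp_form_sqr.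
by rewrite PE.
Qed.

Let Btr : B^T = P *m B.
Proof.
rewrite PE /B tr_block_mx mulmx_block !mul0mx !mulmx0 !trmx0 so2_form_tr sp_form_tr.
by rewrite !mul1mx mulNmx mul1mx !addr0 !add0r.
Qed.

Let PP : P *m P = 1%:M.
Proof. by rewrite /P form_signM form_sign_even. Qed.

Let PB : P *m B = B *m P.
Proof. by rewrite /P (form_sign_comm true gB) scale1r. Qed.

Let osp_even_block x1 x2 : osp R n false (block_mx x1 0 0 x2) <->
  so2 R x1 /\ sp R n x2.
Proof.
rewrite /osp osp_formP form_sign_even mul1mx tr_block_mx !trmx0 /B !mulmx_block.
rewrite !mul0mx !mulmx0 !addr0 !add0r add_block_mx !addr0.
split=> [[_]|[so2x spx]].
  by rewrite -[RHS]block_mx0 => /eq_block_mx [e1 _ _ e2].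
by split; [apply/gl_super_block|rewrite so2x spx block_mx0].
Qed.

Let osp_evenE x : osp R n false x -> exists2 x1, so2 R x1 &
  exists2 x2, sp R n x2 & x = block_mx x1 0 0 x2.
Proof.
move=> ox; have [/gl_super_even xE _] := ox.
move: ox; rewrite xE => /osp_even_block [s1 s2].
by exists (ulsubmx x) => //; exists (drsubmx x).
Qed.

Definition osp_center : 'M[R[i]]_(2 + (n + n)) := ul_embed (n + n) (so2_gen R).

Let osp_centerE i : osp_center i i =
  match fintype.split i with inl k => (-1) ^+ k | inr _ => 0 end.
Proof.
rewrite /osp_center /ul_embed; case: (split_ordP i) => k ->.
  by rewrite block_mxEul !mxE eqxx mulr1n.
by rewrite block_mxEdr mxE.
Qed.

Let osp_center_diag : is_diag_mx osp_center.
Proof.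
by rewrite /osp_center /ul_embed is_diag_block_mx // diag_mx_is_diag !eqxx /= mx0_is_diag.
Qed.

Lemma osp_typeI : typeI (osp R n) (so2 R) (sp R n)
  (@ul_embed R 2 (n + n)) (@dr_embed R 2 (n + n)) osp_center.
Proof.
have sp0 : sp R n 0 by exact: subspace0 (subspace_form_alg _).
have so0 : so2 R 0 by exact: subspace0 (subspace_form_alg _).
split.
- by move=> a; apply: subspace_osp_form.
- by move=> a b x y; apply: osp_form_lie.
- exact: subspace_form_alg.
- exact: form_alg_comm.
- exact: subspace_form_alg.
- exact: form_alg_comm.
- exact: (osp_even_block (so2_gen R) 0).2 (conj (so2_gen_so2 R) sp0).
- move=> _ /osp_evenE [x1 s1 [x2 s2 ->]]; apply/matrixP => i j.
  rewrite comm_diag // !osp_centerE [RHS]mxE.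
  case: (split_ordP i) => k ->; case: (split_ordP j) => l ->; last by rewrite subrr mul0r.
  + have [->|kl] := eqVneq k l; first by rewrite subrr mul0r.
    by rewrite block_mxEul (is_diag_mxP (so2P s1)) ?mulr0.
  + by rewrite block_mxEur mxE mulr0.
  by rewrite block_mxEdl mxE mulr0.
- move=> x [gx _]; apply/matrixP => i j; rewrite !comm_diag // !osp_centerE mulrA -expr2.
  move: (gx i j); case: (split_ordP i) => k ->; case: (split_ordP j) => l ->;
    rewrite ?parity_lshift ?parity_rshift /= => gij.
  + by rewrite gij ?mulr0.
  + by rewrite subr0 sqrr_sign mul1r.
  + by rewrite sub0r sqrrN sqrr_sign mul1r.
  by rewrite gij ?mulr0.
- by move=> x sx; apply/osp_even_block.
- by move=> x sx; apply/osp_even_block.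
- exact: comm_ul_embed.
- exact: comm_dr_embed.
- by move=> x y _ _; apply: comm_ul_dr.
move=> _ /osp_evenE [x1 s1 [x2 s2 ->]]; exists x1, x2, 0; split=> //.
by rewrite scale0r addr0 /ul_embed /dr_embed add_block_mx !addr0 !add0r.
Qed.

Let nilrad := super_nilradical (osp R n) (osp_roots R n).

Let cartan_form t : cartan (osp R n false) t -> form_alg B t /\ is_diag_mx t.
Proof.
by move=> [/osp_formP [_]]; rewrite form_sign_even mul1mx.
Qed.

Let cartan_block t : cartan (osp R n false) t -> exists2 t1, cartan (so2 R) t1 &
  exists2 t2, cartan (sp R n) t2 & t = block_mx t1 0 0 t2.
Proof.
move=> [/osp_evenE [x1 s1 [x2 s2 ->]]]; rewrite is_diag_block_mx // => /and4P [_ _ d1 d2].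
by exists x1 => //; exists x2.
Qed.

Lemma sp_positive_dr x : sp_positive x -> nilrad (dr_embed 2 x).
Proof.
move=> [alpha ralpha [spx wx]].
have [beta rbeta betaE] : exists2 beta, osp_roots R n false beta &
    forall t1 t2, beta (block_mx t1 0 0 t2) = alpha t2.
  case: ralpha => [[k [l [kl [->|->]]]]|[k ->]].
  - exists (osp_delta k \- osp_delta l); first by left; exists k, l; split; [|left].
    by move=> t1 t2; rewrite /osp_delta /diag_coord /= !block_mxEdr.
  - exists (osp_delta k \+ osp_delta l); first by left; exists k, l; split; [|right].
    by move=> t1 t2; rewrite /osp_delta /diag_coord /= !block_mxEdr.
  exists (osp_delta k \+ osp_delta k); first by right; exists k.
  by move=> t1 t2; rewrite /osp_delta /diag_coord /= !block_mxEdr.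
apply: sub_span; exists false => //; exists beta => //.
split=> [|t /cartan_block [t1 _ [t2 ct2 ->]]]; first exact: tI_in2 osp_typeI _ spx.
rewrite betaE -[LHS]/(comm (block_mx t1 0 0 t2) (dr_embed 2 x)) comm_block_dr.
by rewrite -[alpha t2 *: _]linearZ /= -wx.
Qed.

(** With [B * B] the parity operator, the form condition on an odd element [x]
    reads [x = - B x^T B]; hence the sign in the folding. *)
Let fold_odd i j : parity i (+) parity j ->
  osp R n true (fold_form B (-1) (delta_mx i j)).
Proof.
move=> ij; set x := delta_mx i j; have gx : gl_super true x.
  move=> k l; rewrite mxE; have [->|//] := eqVneq k i; have [->|] := eqVneq l j.
    by rewrite ij.
  by rewrite andbF.
have gfx : gl_super true (fold_form B (-1) x).
  have sG := @subspace_gl_super R 2 (n + n) true.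
  rewrite /fold_form; apply: (subspaceD sG) => //; apply: (subspaceZ _ sG).
  exact: (gl_superM (gl_superM gB (gl_super_tr gx)) gB).
apply/osp_formP; split=> //; rewrite -/P.
have foldT : (fold_form B (-1) x)^T = x^T - B^T *m x *m B^T.
  by rewrite /fold_form scaleN1r linearB /= !trmx_mul trmxK mulmxA.
rewrite foldT /fold_form scaleN1r mulmxBl mulmxBr.
have -> : B^T *m x *m B^T *m B = P *m B *m x.
  by rewrite -mulmxA {2}Btr -[P *m B *m B]mulmxA BB PP mulmx1 Btr.
have -> : P *m B *m (B *m x^T *m B) = x^T *m B.
  by rewrite !mulmxA -[P *m B *m B]mulmxA BB PP mul1mx.
by rewrite addrA subrK subrr.
Qed.

Let fold_odd_id x : osp R n true x -> fold_form B (-1) x = 2 *: x.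
Proof.
move=> /osp_formP [gx /eqP]; rewrite addr_eq0 => /eqP bx.
rewrite /fold_form scaleN1r -mulmxA bx -/P mulmxN opprK !mulmxA.
by rewrite -PB -[P *m B *m B]mulmxA BB PP mul1mx scaler_nat mulr2n.
Qed.

Let torus_eps t : cartan (osp R n false) t ->
  t (lshift (n + n) ord_max) (lshift (n + n) ord_max) = - osp_eps t.
Proof.
move=> /cartan_form [ft dt].
have := form_alg_torus (lshift (n + n) (ord0 : 'I_2)) (lshift (n + n) ord_max) dt ft.
by rewrite /B block_mxEul mxE mulr1 addrC => /eqP; rewrite addr_eq0 => /eqP.
Qed.

Let torus_delta t k : cartan (osp R n false) t ->
  t (rshift 2 (rshift n k)) (rshift 2 (rshift n k)) = - osp_delta k t.
Proof.
move=> /cartan_block [t1 _ [t2 ct2 ->]].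
by rewrite block_mxEdr sp_torus // /sp_delta /osp_delta /diag_coord block_mxEdr.
Qed.

(** On the torus the coordinates of a dual pair of basis vectors are opposite,
    so the weights of degree 1 are exactly the [eps - delta k] and
    [eps + delta k]. *)
Let odd_root i j : parity i (+) parity j -> osp_center i i - osp_center j j = 1 ->
  exists2 alpha, osp_roots R n true alpha &
    forall t, cartan (osp R n false) t -> t i i - t j j = alpha t.
Proof.
have one_neqN1 : (1 : R[i]) <> -1.
  by move=> /eqP; rewrite -addr_eq0 -mulr2n pnatr_eq0.
rewrite !osp_centerE; case: (split_ordP i) => k ->; case: (split_ordP j) => l ->;
  rewrite ?parity_lshift ?parity_rshift //= => _.
  rewrite subr0; case: k => -[|[|//]] klt; rewrite /= ?expr1 => kE; last by case: one_neqN1.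
  have -> : Ordinal klt = ord0 :> 'I_2 by apply: val_inj.
  case: (split_ordP l) => j' ->.
    by exists (@osp_eps R n \- osp_delta j') => //; exists j'; left.
  exists (@osp_eps R n \+ osp_delta j'); first by exists j'; right.
  by move=> t ct; rewrite torus_delta // opprK.
rewrite sub0r; case: l => -[|[|//]] llt; rewrite /= ?expr0 => lE; first by case: one_neqN1.
have -> : Ordinal llt = ord_max :> 'I_2 by apply: val_inj.
case: (split_ordP k) => i' ->.
  exists (@osp_eps R n \+ osp_delta i'); first by exists i'; right.
  by move=> t ct; rewrite torus_eps // opprK addrC.
exists (@osp_eps R n \- osp_delta i'); first by exists i'; left.
by move=> t ct; rewrite torus_eps // torus_delta // opprK addrC.
Qed.

Lemma osp_odd_pos_nilradical x : odd_pos (osp R n) osp_center x -> nilrad x.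
Proof.
move=> [ox zx]; have sS : subspace nilrad by exact: subspace_span.
have [gx _] := ox; have xE : x = fold_form B (-1) (2^-1 *: x).
  by rewrite linearZ /= fold_odd_id // scalerA mulVf ?scale1r // pnatr_eq0.
rewrite xE.
apply: (@subspace_lift _ _ _ nilrad (fold_form B (-1)) (2^-1 *: x) sS) => i j.
rewrite mxE mulf_eq0 negb_or => /andP[_ xij].
have ij : parity i (+) parity j by apply: contraNT xij => /negbTE ij; rewrite gx ?ij.
have : comm osp_center x i j = x i j by rewrite zx.
rewrite comm_diag // -[RHS]mul1r => /(mulIf xij) zij.
have [alpha ralpha alphaE] := odd_root ij zij.
apply: sub_span; exists true => //; exists alpha => //; split; first exact: fold_odd.
move=> t ct; have [ft dt] := cartan_form ct.
by rewrite -alphaE //; apply: comm_fold_form.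
Qed.

Theorem GKdim_osp (lambda : R[i]) (mu : 'I_n -> R[i])
    (L : superModule (osp R n)) (L1 : lieModule (so2 R)) (L2 : lieModule (sp R n)) :
  super_simple_highest_weight (osp_roots R n) (osp_weight lambda mu) L ->
  simple_highest_weight set0 (so2_weight lambda) L1 ->
  simple_highest_weight (sp_roots R n) (sp_weight mu) L2 ->
  forall (M : set L) (M1 : set L1) (M2 : set L2),
  generating_subspace (total_alg (osp R n)) (sm_act L) M ->
  generating_subspace (so2 R) (lm_act L1) M1 ->
  generating_subspace (sp R n) (lm_act L2) M2 ->
  (GKdim (total_alg (osp R n)) (sm_act L) M
   = GKdim (so2 R) (lm_act L1) M1 + GKdim (sp R n) (lm_act L2) M2)%E.
Proof.
move=> [simpleL [v [[a pv] [v0 vh vn] genv]]] [simpleL1 [v1 [[v10 v1h v1n] genv1]]].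
move=> [simpleL2 [v2 [[v20 v2h v2n] genv2]]] M M1 M2 genM genM1 genM2.
have cartan_ul t : cartan (so2 R) t -> cartan (osp R n false) (ul_embed (n + n) t).
  move=> [st dt]; split; first exact: tI_in1 osp_typeI _ st.
  by rewrite /ul_embed is_diag_block_mx // dt !eqxx /= mx0_is_diag.
have cartan_dr t : cartan (sp R n) t -> cartan (osp R n false) (dr_embed 2 t).
  move=> [st dt]; split; first exact: tI_in2 osp_typeI _ st.
  by rewrite /dr_embed is_diag_block_mx // dt !eqxx /= mx0_is_diag.
have weight_ul t : osp_weight lambda mu (ul_embed (n + n) t) = so2_weight lambda t.
  rewrite /osp_weight big1 ?addr0 => [|k _].
    by rewrite /osp_eps /so2_weight /diag_coord block_mxEul.
  by rewrite /osp_delta /diag_coord block_mxEdr mxE mulr0.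
have weight_dr t : osp_weight lambda mu (dr_embed 2 t) = sp_weight mu t.
  rewrite /osp_weight /osp_eps /diag_coord block_mxEul mxE mulr0 add0r.
  by apply: eq_bigr => k _; rewrite /osp_delta /diag_coord block_mxEdr.
apply: (GKdim_typeI osp_typeI (@so2_triangular R) (@sp_triangular R n)
  (chi1 := borel_char (so2 R) (so2_weight lambda))
  (chi2 := borel_char (sp R n) (sp_weight mu))
  simpleL simpleL1 simpleL2 v0 v10 v20 pv
  (zeta := osp_weight lambda mu osp_center)) => //.
- by apply: vh; split=> //; exact: tI_z osp_typeI.
- by move=> x /osp_odd_pos_nilradical; apply: vn.
- apply: (borel_charP (act := fun x => sm_act L (ul_embed (n + n) x))) => // t ct.
  by rewrite vh ?weight_ul //; apply: cartan_ul.
- apply: (borel_charP (act := fun x => sm_act L (dr_embed 2 x))) => [t ct|x px].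
    by rewrite vh ?weight_dr //; apply: cartan_dr.
  exact: vn (sp_positive_dr px).
- exact: borel_charP.
by apply: borel_charP => // x /sp_positive_nilradical; apply: v2n.
Qed.

End OrthoSymplectic.

Theorem proposition1p1 (R : realType) :
  (forall (m n : nat) (lambda : 'I_m -> R[i]) (mu : 'I_n -> R[i])
     (L : superModule (sl_super R m n))
     (L1 : lieModule (sl R m)) (L2 : lieModule (sl R n)),
   (0 < m)%N -> (0 < n)%N -> m <> n ->
   super_simple_highest_weight (sl_super_roots R m n)
     (sl_super_weight lambda mu) L ->
   simple_highest_weight (sl_roots R m) (sl_weight lambda) L1 ->
   simple_highest_weight (sl_roots R n) (sl_weight mu) L2 ->
   forall (M : set L) (M1 : set L1) (M2 : set L2),
   generating_subspace (total_alg (sl_super R m n)) (sm_act L) M ->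
   generating_subspace (sl R m) (lm_act L1) M1 ->
   generating_subspace (sl R n) (lm_act L2) M2 ->
   (GKdim (total_alg (sl_super R m n)) (sm_act L) M
    = GKdim (sl R m) (lm_act L1) M1 + GKdim (sl R n) (lm_act L2) M2)%E)
  /\
  (forall (n : nat) (lambda : R[i]) (mu : 'I_n -> R[i])
     (L : superModule (osp R n))
     (L1 : lieModule (so2 R)) (L2 : lieModule (sp R n)),
   (0 < n)%N ->
   super_simple_highest_weight (osp_roots R n) (osp_weight lambda mu) L ->
   simple_highest_weight set0 (so2_weight lambda) L1 ->
   simple_highest_weight (sp_roots R n) (sp_weight mu) L2 ->
   forall (M : set L) (M1 : set L1) (M2 : set L2),
   generating_subspace (total_alg (osp R n)) (sm_act L) M ->
   generating_subspace (so2 R) (lm_act L1) M1 ->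
   generating_subspace (sp R n) (lm_act L2) M2 ->
   (GKdim (total_alg (osp R n)) (sm_act L) M
    = GKdim (so2 R) (lm_act L1) M1 + GKdim (sp R n) (lm_act L2) M2)%E).
Proof.
split=> [m n lambda mu L L1 L2 m0 n0 mn|n lambda mu L L1 L2 _].
  exact: GKdim_sl.
exact: GKdim_osp.
Qed.
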